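(* Let $n,m\ge1$ be integers. For $u>0$, $v\gg1$ and $v\gg u$ ($v$ real), we have $$p(n,m;u,v)=2^{-2n-\frac{m-1}{2}}\,v^{-\frac{m-1}{2}}\,e^{-\frac{d^2(u,v)}{4}}\,\epsilon^{1-n}\,e^{-\frac{\pi}{2\epsilon}u}\,I_{n-1}\!\left(\frac{\pi}{2\epsilon}u\right)(1+o(1)).$$ Here the asymptotic statement means: for every $\rho>0$ there exists $M=M(n,m,\rho)>0$ such that for all real $u>0$ and $v$ with $v\ge M$ and $v\ge Mu$, the ratio of the left-hand side to the right-hand side without the factor $(1+o(1))$ differs from $1$ by at most $\rho$.
   Context: For integers $n,m\ge1$ and $u,v\ge0$, $$p(n,m;u,v)=\frac{2}{(4\pi)^{n+\frac m2}}\int_0^\infty s^{m-1}e^{-\frac u4 s\coth s}\left(\frac{s}{\sinh s}\right)^n\left(\frac{sv}{2}\right)^{-\frac{m-2}{2}}J_{\frac{m-2}{2}}(sv)\,ds,$$ where $J_\nu$ is the Bessel function of the first kind. (The heat kernel at time $h>0$ on the H-type group $\mathbb{R}^{2n}\times\mathbb{R}^m$ is $p_h(z,t)=h^{-n-m}p(n,m;|z|^2/h,|t|/h)$.) The function $\mu:(-\pi,\pi)\to\mathbb{R}$, $\mu(w)=\frac{2w-\sin(2w)}{2\sin^2 w}$, is a strictly increasing diffeomorphism. For $u>0$, $v>0$ put $$\theta=\mu^{-1}\!\left(\frac{4v}{u}\right)\in(0,\pi),\qquad \epsilon=\pi-\theta,\qquad d^2(u,v)=\left(\frac{\theta}{\sin\theta}\right)^2u.$$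 The modified Bessel function is, for $\nu>-\frac12$, $$I_\nu(x)=\frac{1}{\sqrt\pi\,\Gamma(\nu+\frac12)}\left(\frac x2\right)^\nu\int_{-1}^1(1-h^2)^{\nu-\frac12}e^{-xh}\,dh.$$ *)

(* Defs.v *)
From mathcomp Require Export all_boot all_order all_algebra.
From mathcomp Require Export all_classical all_reals all_analysis.
Export Order.TTheory GRing.Theory Num.Theory.
Export numFieldNormedType.Exports.

#[export] Set Implicit Arguments.
#[export] Unset Strict Implicit.
#[export] Unset Printing Implicit Defensive.

Local Open Scope classical_set_scope.
Local Open Scope ring_scope.

Definition sinh {R : realType} (x : R) : R := (expR x - expR (- x)) / 2.

Definition cosh {R : realType} (x : R) : R := (expR x + expR (- x)) / 2.

Definition coth {R : realType} (x : R) : R := cosh x / sinh x.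

(* Euler's integral, which represents the Gamma function for x > 0 only. *)
Definition Gamma {R : realType} (x : R) : R :=
  \int[lebesgue_measure]_(t in `]0, +oo[) (t `^ (x - 1) * expR (- t)).

(* Meant for nu > -1 and x > 0: then every argument of Gamma is positive and
   every base of a real power is positive. *)
Definition besselJ {R : realType} (nu x : R) : R :=
  limn (series (fun k : nat =>
    (- 1) ^+ k / ((k`!)%:R * Gamma (k%:R + nu + 1))
      * (x / 2) `^ (2 * k%:R + nu))).

(* Meant for nu > -1/2 and x > 0, or nu = 0 and x = 0 (0 `^ 0 = 1). The
   integrand blows up at h = -1 and h = 1 when nu < 1/2; these two points are
   Lebesgue-null. *)
Definition besselI {R : realType} (nu x : R) : R :=
  (Num.sqrt pi * Gamma (nu + 1 / 2))^-1 * (x / 2) `^ nu *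
  \int[lebesgue_measure]_(h in `[- 1, 1])
    ((1 - h ^+ 2) `^ (nu - 1 / 2) * expR (- (x * h))).

(* Meant for n, m >= 1, u >= 0 and v > 0. At v = 0 the product of the real
   power of s * v / 2 and besselJ is only defined by continuous extension,
   which this expression does not perform. *)
Definition heat_p {R : realType} (n m : nat) (u v : R) : R :=
  2 / (4 * pi) `^ (n%:R + m%:R / 2) *
  \int[lebesgue_measure]_(s in `]0, +oo[)
    (s ^+ m.-1 * expR (- (u / 4 * s * coth s)) * (s / sinh s) ^+ n
     * (s * v / 2) `^ (- ((m%:R - 2) / 2)) * besselJ ((m%:R - 2) / 2) (s * v)).

(* At w = 0 division by zero gives 0, which is the continuous extension. *)
Definition mu {R : realType} (w : R) : R :=
  (2 * w - sin (2 * w)) / (2 * sin w ^+ 2).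

(* The restriction of mu to ]-pi, pi[ is a bijection onto R, so the default
   value of the partial inverse is never used. *)
Definition mu_inv {R : realType} : R -> R := 'pinv_(fun=> 0) `]- pi, pi[ mu.

Definition theta {R : realType} (u v : R) : R := mu_inv (4 * v / u).

Definition epsilon {R : realType} (u v : R) : R := pi - theta u v.

Definition dist2 {R : realType} (u v : R) : R :=
  (theta u v / sin (theta u v)) ^+ 2 * u.

Definition heat_p_equiv {R : realType} (n m : nat) (u v : R) : R :=
  2 `^ (- (2 * n%:R) - (m%:R - 1) / 2) * v `^ (- ((m%:R - 1) / 2)) *
  expR (- (dist2 u v / 4)) * epsilon u v ^ (1 - n%:Z) *
  expR (- (pi / (2 * epsilon u v) * u)) *
  besselI (n%:R - 1) (pi / (2 * epsilon u v) * u).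

(* Main.v *)
Require Import Defs.
From HB Require Import structures.
From mathcomp Require Import measurable_realfun ring lra zify.

Local Open Scope classical_set_scope.
Local Open Scope ring_scope.

(* The product formula for sinh writes exp(-(u/4) s coth s) (s/sinh s)^n, as a
   function of s^2, as the Laplace transform of T = T_0 + T_1 + ..., a sum of
   independent nonnegative variables attached to the poles c_k = (pi (k+1))^2.
   Integrating the Bessel function against exp(-s^2 T) turns the heat kernel
   into the expectation of T^(-m/2) exp(-v^2/(4T)).  Completing the square,
     -v^2/(4T) = -theta v + theta^2 T - (theta v/2) (r-1)^2/r,
   with T = (v/(2 theta)) r, the law is tilted by exp(theta^2 T).  As theta
   tends to pi the dominant variable is T_0, whose density is explicit and
   contains I_(n-1); the other variables stay within O(sqrt(1+u)) of their
   tilted mean, while r is concentrated at 1 because theta v/2 is large.  The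
   equation mu(theta) = 4v/u says exactly that the tilted mean of T is the
   centre v/(2 theta), so the density of T_0 is evaluated at its own centre. *)

(** * Calculus on the real line *)

(** The infinite sum is never built: for each N only the first N + 1 poles are kept, the error
    bounds do not depend on N, and N tends to infinity last. The obstacle is uniformity. The
    argument [pi u / (2 epsilon)] ranges over all of ]0, +oo[, so I_(n-1) cannot be replaced by an
    expansion at 0 or at infinity. Instead, two monotonicities of the scaled Bessel function bound
    the variation of the tilted density of T_0 on a window of relative width proportional to kap =
    (1 + a)^(-1/2) around its centre a = u pi^2 / (2 b), where b = pi^2 - theta^2 and times are
    multiplied by b. The errors are then of order (1 + a) / A with A = theta v / 2, from the spread
    of r, and b^2 (1 + a) (1 + u) / a^2, from the spread of the other variables. The equation for
    theta gives u ~ v epsilon^2, hence b ~ epsilon and a ~ v epsilon, and both errors vanish in the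
    limit. The integral over r needs no separate Laplace method: r^(-m/2) is compared with a weight,
    equal to it at r = 1, for which the integral is exactly Gaussian. *)

Section Derivatives.
Context {R : realType}.
Implicit Types (f g : R -> R) (x a b : R).

(* Unlike [is_derive], not a type class: it is never inferred by unification. *)
Definition hasD (f : R -> R) (x a : R) : Prop := is_derive x (1 : R) f a.

Lemma dcst (k x : R) : hasD (fun=> k) x 0.
Proof. exact: is_derive_cst. Qed.

Lemma deq f x a b : hasD f x a -> a = b -> hasD f x b.
Proof. by move=> ? <-. Qed.

Lemma hasD_derivable f x a : hasD f x a -> derivable f x 1.
Proof. by case. Qed.

Lemma hasD_derive1 f x a : hasD f x a -> derive1 f x = a.
Proof. by move=> [_ fx]; rewrite derive1E. Qed.

Lemma dsin x : hasD (@sin R) x (cos x).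
Proof. exact: is_derive_sin. Qed.

Lemma dcos x : hasD (@cos R) x (- sin x).
Proof. exact: is_derive_cos. Qed.

Lemma dexp x : hasD (@expR R) x (expR x).
Proof. exact: is_derive_expR. Qed.

Lemma dln x : 0 < x -> hasD (@ln R) x x^-1.
Proof. exact: is_derive1_ln. Qed.

Lemma dsqrt x : 0 < x -> hasD (@Num.sqrt R) x (2 * Num.sqrt x)^-1.
Proof. exact: is_derive1_sqrt. Qed.

Lemma did x : hasD (fun y => y) x 1.
Proof. exact: is_derive_id. Qed.

Lemma dD f g x a b : hasD f x a -> hasD g x b ->
  hasD (fun y => f y + g y) x (a + b).
Proof. exact: is_deriveD. Qed.

Lemma dN f x a : hasD f x a ->
  hasD (fun y => - f y) x (- a).
Proof. exact: is_deriveN. Qed.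

Lemma dB f g x a b : hasD f x a -> hasD g x b ->
  hasD (fun y => f y - g y) x (a - b).
Proof. exact: is_deriveB. Qed.

Lemma dM f g x a b : hasD f x a -> hasD g x b ->
  hasD (fun y => f y * g y) x (a * g x + f x * b).
Proof.
move=> fa gb; apply: (is_derive_eq (is_deriveM fa gb)).
by rewrite /GRing.scale/= addrC mulrC.
Qed.

Lemma dX f n x a : hasD f x a ->
  hasD (fun y => f y ^+ n) x (n%:R * f x ^+ n.-1 * a).
Proof.
move=> fa; have -> : (fun y => f y ^+ n) = (f ^+ n : R -> R).
  by apply/funext => y; elim: n => [|n IH]; rewrite ?expr0// !exprS IH.
exact: is_deriveX.
Qed.

Lemma dcomp f g x a b : hasD f (g x) a ->
  hasD g x b -> hasD (fun y => f (g y)) x (a * b).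
Proof. exact: is_derive1_comp. Qed.

Lemma dV f x a : f x != 0 -> hasD f x a ->
  hasD (fun y => (f y)^-1) x (- a / f x ^+ 2).
Proof.
move=> fx0 fa; apply: (is_derive_eq (is_deriveV fx0 fa)).
by rewrite /GRing.scale/= mulNr mulrC mulNr.
Qed.

Lemma hasD_continuous f x a : hasD f x a ->
  {for x, continuous f}.
Proof. by case=> fx _; apply: differentiable_continuous; exact/derivable1_diffP. Qed.

Lemma nondecreasing_of_derive (f df : R -> R) a b : a <= b ->
  (forall x, x \in `[a, b] -> hasD f x (df x)) ->
  (forall x, x \in `]a, b[ -> 0 <= df x) -> f a <= f b.
Proof.
rewrite le_eqVlt => /predU1P[->//|ab] fdf df0.
have dfo x : x \in `]a, b[ -> hasD f x (df x).
  by move=> xab; apply: fdf; rewrite in_itv/= !ltW ?(itvP xab).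
have cf : {within `[a, b], continuous f}.
  by apply: derivable_within_continuous => x xab; exact: hasD_derivable (fdf x xab).
have [x xab fE] := MVT ab dfo cf.
by rewrite -subr_ge0 fE mulr_ge0 ?df0// subr_ge0 ltW.
Qed.

Lemma nonincreasing_of_derive (f df : R -> R) a b : a <= b ->
  (forall x, x \in `[a, b] -> hasD f x (df x)) ->
  (forall x, x \in `]a, b[ -> df x <= 0) -> f b <= f a.
Proof.
move=> ab fdf df0; rewrite -lerN2.
apply: (@nondecreasing_of_derive (fun x => - f x) (fun x => - df x)) => [//|x xab|x xab].
- by apply: dN; exact: fdf.
- by rewrite oppr_ge0 df0.
Qed.

Lemma sin_lex x : 0 <= x -> sin x <= x.
Proof.
move=> x0; suff : 0 - sin 0 <= x - sin x by rewrite sin0 subr0 subr_ge0.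
apply: (@nondecreasing_of_derive (fun y => y - sin y) (fun y => 1 - cos y)) => [//|y _|y _].
- by apply: dB; [exact: did|exact: dsin].
- by rewrite subr_ge0 cos_le1.
Qed.

Lemma xcos_le_sin x : 0 <= x <= pi -> x * cos x <= sin x.
Proof.
move=> /andP[x0 xpi].
suff : sin 0 - 0 * cos 0 <= sin x - x * cos x by rewrite sin0 mul0r subr0 subr_ge0.
apply: (@nondecreasing_of_derive (fun y => sin y - y * cos y) (fun y => y * sin y)) => [//|y yx|y yx].
- apply: (deq (dB (dsin y) (dM (did y) (dcos y)))).
  by rewrite mul1r mulrN opprD opprK addrA subrr add0r.
- rewrite mulr_ge0 ?(itvP yx)//; apply: sin_ge0_pi; rewrite (itvP yx)/=.
  by rewrite (le_trans _ xpi)// (itvP yx).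
Qed.

End Derivatives.

(** * Change of variables for nonnegative integrands on open intervals *)

Section Substitution.
Context {R : realType}.
Notation leb := (@lebesgue_measure R).
Implicit Types (F f G : R -> R).

(** Substitution on each compact [[a n, b n]], then monotone convergence on both sides.
    Nonnegativity of [G] and [f] lets the identity hold in the extended reals, with no finiteness
    assumed. *)
Lemma ge0_substitution_exhaustion F f G (I J : set R) (a b : nat -> R) :
  open I -> J = F @` I -> I = \bigcup_n `[a n, b n]%classic ->
  (forall n, a n < b n) -> nonincreasing_seq a -> nondecreasing_seq b ->
  (forall x, I x -> hasD F x (f x)) ->
  (forall x, I x -> {for x, continuous f}) ->
  {in I &, {homo F : x y / x < y}} -> (forall x, I x -> 0 <= f x) ->
  (forall y, J y -> {for y, continuous G}) -> (forall y, J y -> 0 <= G y) ->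
  (\int[leb]_(y in J) (G y)%:E = \int[leb]_(x in I) (G (F x) * f x)%:E)%E.
Proof.
move=> oI JE IE ab na nb dF cf Fh f0 cG G0.
have abI n x : a n <= x <= b n -> I x.
  by move=> xab; rewrite IE; exists n => //=; rewrite in_itv.
(* Continuity and sign of [G] are known only on the image of [F]; by the intermediate value theorem
   that image contains the whole interval between [F (a n)] and [F (b n)]. *)
have abJ n y : F (a n) <= y <= F (b n) -> exists2 x, a n <= x <= b n & F x = y.
  move=> yab.
  have cF : {within `[a n, b n], continuous F}.
    apply: continuous_in_subspaceT => x; rewrite inE/= in_itv/= => /abI /dF.
    exact: hasD_continuous.
  have Fab : F (a n) <= F (b n).
    by apply/ltW/Fh; rewrite ?inE; [apply: (abI n)|apply: (abI n)|exact: ab];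
       rewrite lexx ltW// ab.
  have [|x xab <-] := IVT (ltW (ab n)) cF (v := y).
    by rewrite min_l// max_r.
  by exists x => //; rewrite in_itv/= in xab.
have Fhle : {in I &, {homo F : x y / x <= y}}.
  move=> x y xI yI; rewrite le_eqVlt => /predU1P[->//|xy].
  by apply/ltW/Fh.
have JE' : J = \bigcup_n `[F (a n), F (b n)]%classic.
  apply/seteqP; split => [y|y [n _]]; rewrite JE.
    move=> [x Ix <-]; have := Ix; rewrite {1}IE => -[n _ /=].
    rewrite in_itv/= => /andP[ax xb]; exists n => //=; rewrite in_itv/=.
    by rewrite !Fhle ?inE//; apply: (abI n); rewrite lexx ltW ?ab.
  by rewrite /= in_itv/= => /abJ[x /abI Ix <-]; exists x.
have stp n : (\int[leb]_(y in `[F (a n), F (b n)]) (G y)%:E =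
    \int[leb]_(x in `[a n, b n]) (G (F x) * f x)%:E)%E.
  have F'E x : I x -> derive1 F x = f x.
    by move=> Ix; exact: hasD_derive1 (dF x Ix).
  have cF' x : I x -> derive1 F y @[y --> x] --> f x.
    move=> Ix; have := cf x Ix; apply: cvg_trans; apply: near_eq_cvg.
    by apply: filterS (open_nbhs_nbhs (conj oI Ix)) => y /F'E/esym.
  have Ia : I (a n) by apply: (abI n); rewrite lexx ltW.
  have Ib : I (b n) by apply: (abI n); rewrite lexx ltW.
  rewrite (@integration_by_substitution_increasing R F G _ _ (ltW (ab n))).
  - apply: eq_integral => x; rewrite inE/= in_itv/= => /abI Ix.
    by rewrite /= fctE F'E.
  - move=> x y; rewrite !in_itv/= => /abI Ix /abI Iy; apply: Fh; exact: mem_set.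
  - move=> x; rewrite in_itv/= => /andP[/ltW ax /ltW xb].
    have Ix : I x by apply: (abI n); rewrite ax.
    by rewrite /continuous_at F'E//; exact: cF'.
  - by apply/cvg_ex; exists (f (a n)); apply: cvg_at_right_filter; exact: cF'.
  - by apply/cvg_ex; exists (f (b n)); apply: cvg_at_left_filter; exact: cF'.
  - split.
    + move=> x; rewrite in_itv/= => /andP[/ltW ax /ltW xb].
      by apply: (@hasD_derivable _ _ _ (f x)); apply/dF/(abI n); rewrite ax.
    + by apply: cvg_at_right_filter; exact: (hasD_continuous (dF _ Ia)).
    + by apply: cvg_at_left_filter; exact: (hasD_continuous (dF _ Ib)).
  - apply: continuous_in_subspaceT => y; rewrite inE/= in_itv/= => /abJ[x xab <-].
    by apply: cG; rewrite JE; exists x => //; exact: abI xab.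
have mG n : measurable_fun `[F (a n), F (b n)] G.
  apply: subspace_continuous_measurable_fun => //.
  apply: continuous_in_subspaceT => y; rewrite inE/= in_itv/= => /abJ[x xab <-].
  by apply: cG; rewrite JE; exists x => //; exact: abI xab.
have mGF n : measurable_fun `[a n, b n] (fun x => G (F x) * f x).
  apply: subspace_continuous_measurable_fun => //.
  apply: continuous_in_subspaceT => x; rewrite inE/= in_itv/= => /abI Ix.
  apply: continuousM; last exact: cf.
  apply: continuous_comp; first exact: hasD_continuous (dF _ Ix).
  by apply: cG; rewrite JE; exists x.
have -> : (\int[leb]_(y in J) (G y)%:E = limn (fun n =>
    \int[leb]_(y in `[F (a n), F (b n)]) (G y)%:E))%E.
  rewrite JE'; apply/esym/cvg_lim => //; apply: ge0_nondecreasing_set_cvg_integral => //.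
  - move=> i j ij; apply/subsetPset; apply: subset_itv; rewrite bnd_simp.
    + apply: Fhle; rewrite ?inE; last exact: na.
        by apply: (abI j); rewrite lexx ltW.
      by apply: (abI i); rewrite lexx ltW.
    + apply: Fhle; rewrite ?inE; last exact: nb.
        by apply: (abI i); rewrite lexx ltW.
      by apply: (abI j); rewrite lexx ltW.
  - by move=> n; apply/measurable_EFinP; exact: mG.
  - move=> i y /= yab; rewrite lee_fin G0// JE'; by exists i.
rewrite (eq_fun stp) IE; apply/cvg_lim => //.
apply: ge0_nondecreasing_set_cvg_integral => //.
- move=> i j ij; apply/subsetPset; apply: subset_itv; rewrite bnd_simp.
    exact: na.
  exact: nb.
- by move=> n; apply/measurable_EFinP; exact: mGF.
- move=> i x /=; rewrite in_itv/= => /abI Ix; rewrite lee_fin mulr_ge0 ?f0//.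
  by apply: G0; rewrite JE; exists x.
Qed.

(** The index [n.+2] on the right keeps every interval nondegenerate, since 1/(n+1) <= 1 < n+2. *)
Lemma itvoy_bigcup (l : R) :
  `]l, +oo[%classic = \bigcup_n `[l + n.+1%:R^-1, l + n.+2%:R]%classic.
Proof.
apply/seteqP; split => x /=; last first.
  move=> [n _ /=]; rewrite !in_itv/= andbT => /andP[lx _].
  by rewrite (lt_le_trans _ lx)// ltrDl invr_gt0.
rewrite in_itv/= andbT => lx; have lx0 : 0 < x - l by rewrite subr_gt0.
exists (maxn (Num.truncn (x - l)^-1) (Num.truncn (x - l))) => //=; rewrite in_itv/=.
apply/andP; split.
- rewrite -lerBrDl -[leRHS]invrK lef_pV2 ?posrE ?invr_gt0//.
  by rewrite ltW// (lt_le_trans (Num.Theory.truncnS_gt _))// ler_nat ltnS leq_maxl.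
- rewrite -lerBlDl ltW// (lt_le_trans (Num.Theory.truncnS_gt _))// ler_nat.
  by rewrite (@leq_trans (maxn (Num.truncn (x - l)^-1) (Num.truncn (x - l))).+1)// ltnS leq_maxr.
Qed.

Lemma ge0_substitution_oy F f G (l : R) (J : set R) :
  J = F @` `]l, +oo[%classic ->
  (forall x, l < x -> hasD F x (f x)) ->
  (forall x, l < x -> {for x, continuous f}) ->
  (forall x, l < x -> 0 < f x) ->
  (forall y, J y -> {for y, continuous G}) -> (forall y, J y -> 0 <= G y) ->
  (\int[leb]_(y in J) (G y)%:E =
   \int[leb]_(x in `]l, +oo[) (G (F x) * f x)%:E)%E.
Proof.
move=> JE dF cf f0 cG G0.
apply: (@ge0_substitution_exhaustion _ _ _ _ _ (fun n => l + n.+1%:R^-1)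
   (fun n => l + n.+2%:R)) => //.
- exact: itvoy_bigcup.
- move=> n; rewrite ltrD2l (@le_lt_trans _ _ 1)// ?invf_le1 ?ler1n// ltr1n//.
- by move=> i j ij; rewrite lerD2l lef_pV2 ?posrE// ler_nat ltnS.
- by move=> i j ij; rewrite lerD2l ler_nat !ltnS.
- by move=> x /=; rewrite in_itv/= andbT; exact: dF.
- by move=> x /=; rewrite in_itv/= andbT; exact: cf.
- move=> x y; rewrite !inE/= !in_itv/= !andbT => lx ly xy.
  have dfo z : z \in `]x, y[ -> hasD F z (f z).
    by rewrite in_itv/= => /andP[xz _]; apply: dF; exact: lt_trans xz.
  have cfo : {within `[x, y], continuous F}.
    apply: continuous_in_subspaceT => z; rewrite inE/= in_itv/= => /andP[xz _].
    by apply: hasD_continuous; apply: dF; exact: lt_le_trans xz.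
  have [z zxy zE] := MVT xy dfo cfo.
  by rewrite -subr_gt0 zE mulr_gt0 ?subr_gt0// f0// (lt_trans lx)// (itvP zxy).
- by move=> x /=; rewrite in_itv/= andbT => /f0 /ltW.
Qed.

End Substitution.

(** * Gamma and Bessel functions *)

Section GammaFunction.
Context {R : realType}.
Notation leb := (@lebesgue_measure R).
Implicit Types (c t x : R).

Definition gammaf c t : R := t `^ (c - 1) * expR (- t).

(** [Gamma] is the real part [fine] of this integral. Working in the extended reals allows Tonelli
    and substitutions before finiteness is established in [eGamma_halfint]. *)
Definition eGamma c : \bar R := (\int[leb]_(t in `]0%R, +oo[) (gammaf c t)%:E)%E.

Lemma dpowR (p x : R) : 0 < x -> hasD (fun y : R => y `^ p) x (p * x `^ (p - 1)).
Proof. exact: is_derive1_powR. Qed.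

Lemma dexpN x : hasD (fun y : R => expR (- y)) x (- expR (- x)).
Proof. by apply: (deq (dcomp (dexp _) (dN (did x)))); rewrite mulrN1. Qed.

Lemma gammaf_ge0 c t : 0 <= gammaf c t.
Proof. by rewrite mulr_ge0 ?powR_ge0 ?expR_ge0. Qed.

Lemma continuous_gammaf c t : 0 < t -> {for t, continuous (gammaf c)}.
Proof. by move=> t0; exact: hasD_continuous (dM (dpowR (c - 1) t0) (dexpN t)). Qed.

(** Half of the exponential absorbs the power: this is ln x <= x at x = t / (2c), raised to the
    power c. It kills the boundary term at infinity in [eGammaS]. *)
Lemma powR_expN_le c t : 0 < c -> 0 < t ->
  t `^ c * expR (- t) <= (2 * c) `^ c * expR (- (t / 2)).
Proof.
move=> c0 t0; rewrite -ler_pdivlMr ?expR_gt0// -expRN opprK -mulrA -expRD.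
have -> : - (t / 2) + t = t / 2 by lra.
have d0 : 0 < 2 * c by rewrite mulr_gt0.
have td0 : 0 < t / (2 * c) by rewrite divr_gt0.
have {1}-> : t = (2 * c) * (t / (2 * c)) by rewrite mulrC divfK// gt_eqF.
rewrite powRM ?(ltW d0) ?(ltW td0)// ler_wpM2l ?powR_ge0// /powR gt_eqF// ler_expR.
apply: le_trans (_ : c * (t / (2 * c)) <= _); first by rewrite ler_pM2l// ltW// ln_sublinear.
by rewrite invfM mulrCA [c * _]mulrCA mulfV ?gt_eqF// mulr1.
Qed.

Lemma itvoy_cvg (f : R -> \bar R) (l : R) : measurable_fun `]l, +oo[ f ->
  (forall x, l < x -> (0 <= f x)%E) ->
  (\int[leb]_(x in `[(l + n.+1%:R^-1)%R, (l + n.+2%:R)%R]) f x)%E @[n --> \oo]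
    --> (\int[leb]_(x in `]l, +oo[) f x)%E.
Proof.
move=> mf f0; rewrite itvoy_bigcup; apply: ge0_nondecreasing_set_cvg_integral => //.
- move=> i j ij; apply/subsetPset; apply: subset_itv; rewrite bnd_simp lerD2l.
    by rewrite lef_pV2 ?posrE// ler_nat ltnS.
  by rewrite ler_nat !ltnS.
- move=> n; apply: measurable_funS mf => // x /=; rewrite !in_itv/= andbT.
  by move=> /andP[+ _]; apply: lt_le_trans; rewrite ltrDl invr_gt0.
- move=> n x /=; rewrite in_itv/= => /andP[lx _]; apply: f0.
  by apply: lt_le_trans lx; rewrite ltrDl invr_gt0.
Qed.

Lemma measurable_continuous_oy (f : R -> R) (l : R) :
  (forall x, l < x -> {for x, continuous f}) -> measurable_fun `]l, +oo[ f.
Proof.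
move=> cf; apply: open_continuous_measurable_fun; first exact: interval_open.
by move=> x; rewrite inE/= in_itv/= andbT; exact: cf.
Qed.

(** Integration by parts on compact intervals. The boundary term [h] tends to 0 at the left end
    because c > 0, and at the right end by exponential decay. *)
Lemma eGammaS c : 0 < c -> (eGamma (c + 1) = c%:E * eGamma c)%E.
Proof.
move=> c0.
pose h t := t `^ c * expR (- t).
have mg d : measurable_fun `](0 : R), +oo[ (EFin \o gammaf d).
  by apply/measurable_EFinP; apply: measurable_continuous_oy => x; exact: continuous_gammaf.
pose a n : R := 0 + n.+1%:R^-1; pose b n : R := 0 + n.+2%:R.
have a0 n : 0 < a n by rewrite /a add0r invr_gt0.
have ab n : a n < b n.
  by rewrite /a /b !add0r (@le_lt_trans _ _ 1)// ?invf_le1 ?ler1n// ltr1n.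
have part n : (\int[leb]_(t in `[a n, b n]) (gammaf (c + 1) t)%:E =
    (h (a n) - h (b n))%:E + c%:E * \int[leb]_(t in `[a n, b n]) (gammaf c t)%:E)%E.
  have dF x : 0 < x -> hasD (fun t : R => t `^ c) x (c * x `^ (c - 1)).
    by move=> x0; exact: dpowR.
  have dG x : hasD (fun t : R => - expR (- t)) x (expR (- x)).
    by apply: (deq (dN (dexpN x))); rewrite opprK.
  have cf x : 0 < x -> {for x, continuous (fun t : R => c * t `^ (c - 1))}.
    by move=> x0; exact: hasD_continuous (dM (dcst c x) (dpowR (c - 1) x0)).
  have abp x : x \in `[a n, b n] -> 0 < x.
    by rewrite in_itv/= => /andP[+ _]; exact: lt_le_trans.
  have abp' x : x \in `]a n, b n[ -> 0 < x.
    by rewrite in_itv/= => /andP[+ _]; exact: lt_trans.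
  transitivity (\int[leb]_(t in `[a n, b n]) (t `^ c * expR (- t))%:E)%E.
    by apply: eq_integral => t _; rewrite /gammaf addrK.
  rewrite (@integration_by_parts R (fun t : R => t `^ c) (fun t => - expR (- t))
     (fun t => c * t `^ (c - 1)) (fun t => expR (- t)) _ _ (ab n)); last 6 first.
  - by apply: continuous_in_subspaceT => x; rewrite inE/= => /abp; exact: cf.
  - split.
    + by move=> x /abp' x0; exact: hasD_derivable (dF x x0).
    + by apply: cvg_at_right_filter; exact: (hasD_continuous (dF _ _)).
    + by apply: cvg_at_left_filter; apply: (hasD_continuous (dF _ _)); exact: lt_trans (ab n).
  - by move=> x /abp' x0; exact: hasD_derive1 (dF x x0).
  - by apply: continuous_in_subspaceT => x _; exact: hasD_continuous (dexpN x).
  - split.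
    + by move=> x _; exact: hasD_derivable (dG x).
    + by apply: cvg_at_right_filter; exact: (hasD_continuous (dG _)).
    + by apply: cvg_at_left_filter; exact: (hasD_continuous (dG _)).
  - by move=> x _; exact: hasD_derive1 (dG x).
  rewrite !mulrN opprK [X in X%:E]addrC; congr (_ + _)%E.
  have mgn : measurable_fun `[a n, b n] (EFin \o gammaf c).
    apply: measurable_funS (mg c) => // x /= /abp.
    by rewrite in_itv/= andbT.
  rewrite -ge0_integralZl_EFin//; last 2 first.
  - by move=> x _; rewrite lee_fin gammaf_ge0.
  - exact: ltW.
  have -> : (\int[leb]_(x in `[a n, b n]) (c * x `^ (c - 1) * - expR (- x))%:E =
     \int[leb]_(x in `[a n, b n]) - (c%:E * (gammaf c x)%:E))%E.
    by apply: eq_integral => x _; rewrite -EFinM -EFinN /gammaf mulrN mulrA.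
  rewrite integral_ge0N ?oppeK// => x _.
  by rewrite -EFinM lee_fin mulr_ge0 ?gammaf_ge0// ltW.
have ha : h (a n) @[n --> \oo] --> (0 : R).
  have aa : a n @[n --> \oo] --> (0 : R).
    rewrite /a; under eq_fun do rewrite add0r; exact: cvg_harmonic.
  apply: (@squeeze_cvgr _ _ _ _ (cst 0) (fun n => a n `^ c)).
  - near=> n; rewrite /h mulr_ge0 ?powR_ge0 ?expR_ge0//=.
    by rewrite ler_piMr ?powR_ge0// -expR0 ler_expR oppr_le0 ltW.
  - exact: cvg_cst.
  - by move/cvg_at_rightP: (powR_cvg0 c0) => /(_ a); apply.
have hb : h (b n) @[n --> \oo] --> (0 : R).
  have bb : expR (- (b n / 2)) @[n --> \oo] --> (0 : R).
    apply: (@cvg_comp _ _ _ (fun n => b n / 2) (fun x => expR (- x)) _ (pinfty_nbhs R)); last first.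
      exact: cvgr_expR.
    apply/cvgryPge => A; near=> n; rewrite /b add0r ler_pdivlMr//.
    apply: (@le_trans _ _ n%:R); last by rewrite ler_nat -addn2 leq_addr.
    by near: n; exact: nbhs_infty_ger.
  apply: (@squeeze_cvgr _ _ _ _ (cst 0) (fun n => (2 * c) `^ c * expR (- (b n / 2)))).
  - near=> n; rewrite /h mulr_ge0 ?powR_ge0 ?expR_ge0//=.
    by apply: powR_expN_le => //; exact: lt_trans (ab n).
  - exact: cvg_cst.
  - by rewrite -[X in _ --> X](mulr0 ((2 * c) `^ c)); exact: cvgMr.
have g0 d x : 0 < x -> (0 <= (gammaf d x)%:E)%E by rewrite lee_fin gammaf_ge0.
have H1 := itvoy_cvg (mg (c + 1)) (g0 (c + 1)).
rewrite [X in X @ _ --> _](eq_fun part) in H1.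
have H2 : ((h (a n) - h (b n))%:E + c%:E *
    \int[leb]_(t in `[a n, b n]) (gammaf c t)%:E)%E @[n --> \oo]
    --> (0%:E + c%:E * eGamma c)%E.
  apply: cvgeD => //.
  - apply/cvg_EFin; first by near=> n.
    by rewrite -[X in _ --> X](subr0 0); apply: cvgB.
  - by apply: cvgeZl => //; exact: itvoy_cvg (mg c) (g0 c).
by rewrite -[RHS]add0e; exact: cvg_unique H1 H2.
Unshelve. all: by end_near. Qed.

End GammaFunction.

Section GammaValues.
Context {R : realType}.
Notation leb := (@lebesgue_measure R).
Implicit Types (c t x : R).

Lemma itvoy_imageE (F : R -> R) (l l' : R) :
  (forall x, l < x -> l' < F x) ->
  (forall y, l' < y -> exists2 x, l < x & F x = y) ->
  `]l', +oo[%classic = F @` `]l, +oo[%classic.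
Proof.
move=> Flt Fsurj; apply/seteqP; split => [y /=|_ [x /= + <-]].
  by rewrite in_itv/= andbT => /Fsurj[x lx <-]; exists x => //; rewrite /= in_itv/= andbT.
by rewrite !in_itv/= !andbT; exact: Flt.
Qed.

Lemma powR_sub1 x c : 0 < x -> x `^ (c - 1) * x = x `^ c.
Proof.
move=> x0; rewrite -[X in _ * X](powRr1 (ltW x0)) -powRD ?subrK//.
by rewrite (gt_eqF x0) implybT.
Qed.

Lemma eGamma_scale c (lam : R) : 0 < lam ->
  (eGamma c = (lam `^ c)%:E *
    \int[leb]_(t in `]0%R, +oo[) (t `^ (c - 1) * expR (- (lam * t)))%:E)%E.
Proof.
move=> lam0; rewrite -ge0_integralZl_EFin//; last 3 first.
- by move=> x _; rewrite lee_fin mulr_ge0 ?powR_ge0 ?expR_ge0.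
- apply/measurable_EFinP; apply: measurable_continuous_oy => t t0.
  apply: hasD_continuous; apply: (dM (dpowR _ t0)).
  exact: (dcomp (dexp _) (dN (dM (dcst lam t) (did t)))).
- by rewrite powR_ge0.
rewrite /eGamma (@ge0_substitution_oy R (fun t => lam * t) (fun=> lam) (gammaf c) 0).
- apply: eq_integral => t; rewrite inE/= in_itv/= andbT => t0.
  rewrite -EFinM /gammaf powRM ?ltW//.
  rewrite -(powR_sub1 c lam0).
  by congr EFin; ring.
- apply: itvoy_imageE => [x x0|y y0]; first by rewrite mulr_gt0.
  by exists (y / lam); rewrite ?divr_gt0// mulrC divfK// gt_eqF.
- by move=> x _; apply: (deq (dM (dcst lam x) (did x))); rewrite mul0r add0r mulr1.
- by move=> x _; exact: cst_continuous.
- by [].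
- by move=> y /=; rewrite in_itv/= andbT; exact: continuous_gammaf.
- by move=> y _; exact: gammaf_ge0.
Qed.

Lemma eGamma_square (j : nat) (tau : R) : 0 < tau ->
  (eGamma (j.+1%:R / 2) = (2 * tau `^ (j.+1%:R / 2))%:E *
    \int[leb]_(s in `]0%R, +oo[) (s ^+ j * expR (- (s ^+ 2 * tau)))%:E)%E.
Proof.
move=> tau0; set c := j.+1%:R / 2.
have dsq x : hasD (fun s => tau * s ^+ 2) x (2 * tau * x).
  by apply: (deq (dM (dcst tau x) (dX 2 (did x)))); rewrite /= expr1; ring.
rewrite -ge0_integralZl_EFin//; last 3 first.
- move=> x /=; rewrite in_itv/= andbT => x0.
  by rewrite lee_fin mulr_ge0 ?expR_ge0// exprn_ge0// ltW.
- apply/measurable_EFinP; apply: measurable_continuous_oy => s s0.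
  apply: hasD_continuous; apply: (dM (dX j (did s))).
  exact: (dcomp (dexp _) (dN (dM (dX 2 (did s)) (dcst tau s)))).
- by rewrite mulr_ge0 ?powR_ge0.
rewrite /eGamma (@ge0_substitution_oy R (fun s => tau * s ^+ 2)
   (fun s => 2 * tau * s) (gammaf c) 0).
- apply: eq_integral => s; rewrite inE/= in_itv/= andbT => s0.
  rewrite -EFinM /gammaf powRM ?ltW ?exprn_gt0//.
  rewrite -(powR_sub1 c tau0).
  have -> : s ^+ j = (s ^+ 2) `^ (c - 1) * s.
    rewrite -(powR_mulrn 2 (ltW s0)) -powRrM -[X in _ * X](powRr1 (ltW s0)) -powRD; last first.
      by rewrite (gt_eqF s0) implybT.
    rewrite -powR_mulrn ?ltW//; congr (_ `^ _).
    by rewrite /c -natr1; field.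
  by congr EFin; rewrite [tau * s ^+ 2]mulrC; ring.
- apply: itvoy_imageE => [x x0|y y0]; first by rewrite mulr_gt0 ?exprn_gt0.
  exists (Num.sqrt (y / tau)); rewrite ?sqrtr_gt0 ?divr_gt0//.
  by rewrite sqr_sqrtr ?divr_ge0 ?ltW// mulrC divfK// gt_eqF.
- by move=> x _; exact: dsq.
- move=> x _; exact: hasD_continuous (dM (dcst (2 * tau) x) (did x)).
- by move=> x x0; rewrite !mulr_gt0.
- by move=> y /=; rewrite in_itv/= andbT; exact: continuous_gammaf.
- by move=> y _; exact: gammaf_ge0.
Qed.

Lemma eGamma_half : eGamma (1 / 2) = (Num.sqrt pi)%:E :> \bar R.
Proof.
have := @eGamma_square 0 1 ltr01; rewrite powR1 mulr1 => ->.
have -> : (\int[leb]_(s in `]0%R, +oo[) (s ^+ 0 * expR (- (s ^+ 2 * 1)))%:E =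
   \int[leb]_(s in `[0%R, +oo[) (gauss_fun s)%:E)%E.
  rewrite integral_itv_obnd_cbnd//; last first.
    apply/measurable_EFinP; apply: measurable_continuous_oy => s s0.
    apply: hasD_continuous; apply: (dM (dX 0 (did s))).
    exact: (dcomp (dexp _) (dN (dM (dX 2 (did s)) (dcst 1 s)))).
  by apply: eq_integral => s _; rewrite expr0 mul1r mulr1.
by rewrite integral0y_gauss -EFinM mulrC divfK.
Qed.

Lemma eGamma1 : eGamma 1 = 1%:E :> \bar R.
Proof.
have := @eGamma_square 1 1 ltr01; rewrite powR1 mulr1.
have -> : 2%:R / 2 = 1 :> R by rewrite divff.
move=> _; rewrite /eGamma.
rewrite (_ : \int[leb]_(t in _) _ = \int[leb]_(t in `[0%R, +oo[) (expR (- t))%:E)%E; last first.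
  rewrite integral_itv_obnd_cbnd//; last first.
    apply/measurable_EFinP; apply: measurable_continuous_oy => x x0.
    exact: (@continuous_gammaf R 1 x).
  by apply: eq_integral => t _; rewrite /gammaf subrr powRr0 mul1r.
have dF x : hasD (fun t => - expR (- t)) x (expR (- x)).
  by apply: (deq (dN (dexpN x))); rewrite opprK.
rewrite (@ge0_continuous_FTC2y _ _ (fun t => - expR (- t)) _ (- 0)).
- by rewrite oppr0 expR0 sub0e -EFinN opprK.
- by move=> x _; exact: expR_ge0.
- by apply: continuous_in_subspaceT => x _; exact: hasD_continuous (dexpN x).
- by apply: cvgN; exact: cvgr_expR.
- by move=> x _; exact: hasD_derivable (dF x).
- by apply: cvg_at_right_filter; exact: hasD_continuous (dF 0).
- by move=> x _; exact: hasD_derive1 (dF x).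
Qed.

(** Induction in steps of two, since k -> k + 2 is the functional equation; the two starting values
    are Gamma(1/2) and Gamma(1). Finiteness and positivity are carried together. *)
Lemma eGamma_halfint (k : nat) : (0 < k)%N ->
  eGamma (k%:R / 2) = (Gamma (k%:R / 2))%:E :> \bar R /\ 0 < Gamma (k%:R / 2) :> R.
Proof.
move=> k0; suff [g g0 ge] : exists2 g : R, 0 < g & eGamma (k%:R / 2) = g%:E.
  suff -> : Gamma (k%:R / 2) = g by [].
  by change (fine (eGamma (k%:R / 2)) = g); rewrite ge.
move: k0; elim/ltn_ind: k => -[//|[|[|k]]] IH _.
- by exists (Num.sqrt pi); rewrite ?sqrtr_gt0 ?pi_gt0// eGamma_half.
- by exists 1 => //; rewrite divff// eGamma1.
- have [g g0 ge] := IH k.+1 (leqnSn _) isT.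
  exists (k.+1%:R / 2 * g); first by rewrite mulr_gt0.
  have -> : k.+3%:R / 2 = k.+1%:R / 2 + 1 :> R.
    by rewrite -addn2 natrD mulrDl divff.
  by rewrite eGammaS// ge.
Qed.

Fact hGam_key : unit. Proof. by []. Qed.

(* Locked because unification otherwise unfolds the integral. *)
Definition hGam : nat -> R := locked_with hGam_key (fun k => Gamma (k%:R / 2)).

Lemma hGamE (k : nat) : hGam k = Gamma (k%:R / 2).
Proof. by rewrite /hGam unlock. Qed.

Lemma eGammaE (k : nat) : (0 < k)%N -> eGamma (k%:R / 2) = (hGam k)%:E :> \bar R.
Proof. by rewrite hGamE => /eGamma_halfint[]. Qed.

Lemma hGam_gt0 (k : nat) : (0 < k)%N -> 0 < hGam k.
Proof. by rewrite hGamE => /eGamma_halfint[]. Qed.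

Lemma hGamS (k : nat) : (0 < k)%N -> hGam k.+2 = k%:R / 2 * hGam k.
Proof.
move=> k0; apply: EFin_inj; rewrite EFinM -!eGammaE//.
have -> : k.+2%:R / 2 = k%:R / 2 + 1 :> R by rewrite -addn2 natrD mulrDl divff.
by rewrite eGammaS// divr_gt0 ?ltr0n.
Qed.

Lemma hGam1 : hGam 1 = Num.sqrt pi.
Proof. by apply: EFin_inj; rewrite -eGammaE// eGamma_half. Qed.

Lemma hGam2 : hGam 2 = 1.
Proof. by apply: EFin_inj; rewrite -eGammaE// divff// eGamma1. Qed.

Lemma hGam_fact (n : nat) : hGam n.+1.*2 = n`!%:R.
Proof.
elim: n => [|n IH]; first exact: hGam2.
by rewrite doubleS hGamS// IH factS natrM -muln2 natrM mulfK.
Qed.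

End GammaValues.

(** * The entire function behind Bessel J and I, and its monotonicity properties *)

Section BesselSeries.
Context {R : realType}.
Implicit Types (w x X : R) (k j : nat).

Definition gcoef k j : R := (j`!%:R * hGam (j.*2 + k))^-1.

(** The regularised hypergeometric function 0F1 with parameter k/2. With nu = k/2 - 1 one has
    J_nu(x) = (x/2)^nu G(-x^2/4) and I_nu(x) = (x/2)^nu G(x^2/4), so J and I are treated at once;
    differentiation raises k by 2. *)
Definition hG k w : R := limn (pseries (gcoef k) w).

Lemma gcoef_gt0 k j : (0 < k)%N -> 0 < gcoef k j.
Proof.
move=> k0; rewrite invr_gt0 mulr_gt0 ?ltr0n ?fact_gt0// hGam_gt0//.
by rewrite addn_gt0 k0 orbT.
Qed.

Lemma gcoef_diffs k : pseries_diffs (gcoef k) = gcoef k.+2.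
Proof.
apply/funext => j; rewrite /pseries_diffs /gcoef factS natrM doubleS !addnS !addSn.
by rewrite -mulrA invfM mulrA mulfV ?mul1r// pnatr_eq0.
Qed.

(** Gamma is not monotone near its minimum. Only the first step can lose, by a factor k/2 >= 1/2;
    every later step multiplies by i/2 with i >= 2. *)
Lemma Gamma_shift_ge k j : (0 < k)%N ->
  hGam k / 2 <= hGam (j.*2 + k) :> R.
Proof.
move=> k0; have G0 := @hGam_gt0 R k k0.
case: j => [|j]; first by rewrite add0n; lra.
suff : hGam k.+2 <= hGam (j.+1.*2 + k) :> R.
  apply: le_trans; rewrite hGamS//.
  have k1 : 1 <= k%:R :> R by rewrite ler1n.
  nra.
elim: j => [|j IH]; first exact: lexx.
apply: (le_trans IH); have -> : (j.+2.*2 + k)%N = (j.+1.*2 + k).+2 by [].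
have jk0 : (1 < j.+1.*2 + k)%N by rewrite doubleS.
move: (_ + _)%N jk0 => i i1; rewrite hGamS ?(ltnW i1)//.
have jk : 1 <= i%:R / 2 :> R by rewrite ler_pdivlMr// mul1r ler_nat.
by rewrite ler_peMl// ltW// hGam_gt0// ltnW.
Qed.

Lemma gcoef_le k j : (0 < k)%N ->
  gcoef k j <= 2 / hGam k * j`!%:R^-1.
Proof.
move=> k0; rewrite /gcoef invfM mulrC ler_wpM2r ?invr_ge0//.
rewrite -[leRHS]invrK lef_pV2 ?posrE ?hGam_gt0 ?addn_gt0 ?k0 ?orbT//.
  by rewrite invfM invrK mulrC; exact: Gamma_shift_ge.
by rewrite invr_gt0 divr_gt0// hGam_gt0.
Qed.

Lemma cvg_hG_norm k w : (0 < k)%N ->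
  cvgn (series (fun j => `|gcoef k j * w ^+ j|)).
Proof.
move=> k0.
apply: (@series_le_cvg _ _ (fun j => 2 / hGam k * exp_coeff `|w| j)).
- by move=> j; exact: normr_ge0.
- by move=> j; rewrite mulr_ge0 ?exp_coeff_ge0// divr_ge0 ?ltW ?hGam_gt0.
- move=> j; rewrite normrM normrX (ger0_norm (ltW (gcoef_gt0 j k0))) exp_coeffE mulrA.
  by rewrite ler_wpM2r ?exprn_ge0// gcoef_le.
- by apply: is_cvg_seriesZ; exact: is_cvg_series_exp_coeff.
Qed.

Lemma cvg_hG k w : (0 < k)%N -> cvgn (pseries (gcoef k) w).
Proof. by move=> k0; apply: normed_cvg; exact: cvg_hG_norm. Qed.

Lemma dhG k w : (0 < k)%N -> hasD (hG k) w (hG k.+2 w).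
Proof.
move=> k0; rewrite /hasD /hG -gcoef_diffs.
apply: (@pseries_snd_diffs R _ (`|w| + 1)).
- exact: cvg_hG.
- by rewrite gcoef_diffs; exact: cvg_hG.
- by rewrite !gcoef_diffs; exact: cvg_hG.
- by rewrite (@ger0_norm _ (_ + 1)) ?addr_ge0// ltrDl.
Qed.

(** The three-term Bessel recurrence. Coefficientwise it is the splitting (2j + 2 + k)/2 = k/2 + (j
    + 1) of the factor produced by [hGamS]. *)
Lemma hG_rec k w : (0 < k)%N -> hG k w = k%:R / 2 * hG k.+2 w + w * hG k.+4 w.
Proof.
move=> k0.
have coefE j : gcoef k j.+1 = k%:R / 2 * gcoef k.+2 j.+1 + gcoef k.+4 j.
  rewrite /gcoef doubleS factS !addnS !addSn [in RHS]hGamS ?addn_gt0 ?k0 ?orbT//.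
  have G0 : hGam (j.*2 + k).+2 != 0 :> R by rewrite gt_eqF// hGam_gt0.
  have j0 : j`!%:R != 0 :> R by rewrite pnatr_eq0 -lt0n fact_gt0.
  have nE : (j.*2 + k).+2%:R = 2 * j%:R + k%:R + 2 :> R.
    by rewrite -muln2 -[_.+2]addn2 !natrD natrM [_ * 2]mulrC.
  have n0 : 2 * j%:R + k%:R + 2 != 0 :> R by rewrite -nE pnatr_eq0.
  have jj : j%:R + 1 != 0 :> R by rewrite natr1 pnatr_eq0.
  rewrite natrM nE -(natr1 j); set g := hGam _ in G0 *.
  by field; rewrite G0 j0 n0 jj.
have sumE n : pseries (gcoef k) w n.+1 =
    k%:R / 2 * pseries (gcoef k.+2) w n.+1 + w * pseries (gcoef k.+4) w n.
  elim: n => [|n IH].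
    rewrite /pseries /series/= !big_nat1 big_nil mulr0 addr0 !expr0 !mulr1.
    rewrite /gcoef !add0n fact0 !mul1r hGamS// invfM mulrA mulfV ?mul1r//.
    by rewrite mulf_neq0// pnatr_eq0 -lt0n.
  have pS c N : pseries c w N.+1 = pseries c w N + c N * w ^+ N.
    by rewrite /pseries /series/= big_nat_recr.
  by rewrite pS IH (pS _ n.+1) (pS (gcoef k.+4)) coefE exprS; ring.
have H : pseries (gcoef k) w n.+1 @[n --> \oo] --> hG k w.
  by rewrite (cvg_shiftS (pseries (gcoef k) w)); exact: cvg_hG.
have H2 : pseries (gcoef k.+2) w n.+1 @[n --> \oo] --> hG k.+2 w.
  by rewrite (cvg_shiftS (pseries (gcoef k.+2) w)); exact: cvg_hG.
have H4 : pseries (gcoef k.+4) w n @[n --> \oo] --> hG k.+4 w by exact: cvg_hG.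
rewrite (eq_fun sumE) in H; apply: (cvg_unique _ H) => //.
by apply: cvgD; apply: cvgMr.
Qed.

Lemma hG_ge k w : (0 < k)%N -> 0 <= w -> (hGam k)^-1 <= hG k w.
Proof.
move=> k0 w0.
have -> : (hGam k)^-1 = pseries (gcoef k) w 1%N.
  by rewrite /pseries /series/= big_nat1 expr0 mulr1 /gcoef add0n fact0 mul1r.
apply: nondecreasing_cvgn_le; last exact: cvg_hG.
apply: nondecreasing_series => j _ _.
by rewrite mulr_ge0 ?exprn_ge0// ltW// gcoef_gt0.
Qed.

Lemma hG_gt0 k w : (0 < k)%N -> 0 <= w -> 0 < hG k w.
Proof.
by move=> k0 w0; apply: lt_le_trans (hG_ge k0 w0); rewrite invr_gt0 hGam_gt0.
Qed.

Lemma hG0 k : hG k 0 = (hGam k)^-1.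
Proof.
apply/cvg_lim => //; rewrite -(cvg_shiftS (pseries (gcoef k) 0)).
have -> : (fun n => pseries (gcoef k) 0 n.+1) = cst (hGam k)^-1.
  apply/funext => n; rewrite /pseries /series/= big_nat_recl// big1_seq ?addr0.
    by rewrite expr0 mulr1 /gcoef add0n fact0 mul1r.
  by move=> i _; rewrite expr0n/= mulr0.
exact: cvg_cst.
Qed.

(* With c = k/2 this quantity has derivative (2c - 1) G_{c+1}^2, so it is
   nondecreasing on the whole line: left of 0 this bounds Bessel J, right of 0
   it gives the Turan-type inequality for Bessel I. *)
Definition hG_energy k w : R := hG k w ^+ 2 - w * hG k.+2 w ^+ 2.

Lemma hG_energy_le k w1 w2 : (0 < k)%N -> w1 <= w2 ->
  hG_energy k w1 <= hG_energy k w2.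
Proof.
move=> k0 w12.
apply: (@nondecreasing_of_derive R _ (fun w => (k%:R - 1) * hG k.+2 w ^+ 2)) => [//|w _|w _].
  apply: (deq (dB (dX 2 (dhG w k0)) (dM (did w) (dX 2 (dhG w (ltn0Sn k.+1)))))).
  by rewrite /= !expr1 mul1r (hG_rec w k0); field.
by rewrite mulr_ge0 ?exprn_even_ge0// subr_ge0 ler1n.
Qed.

Lemma hG_energy0 k : hG_energy k 0 = (hGam k)^-1 ^+ 2.
Proof. by rewrite /hG_energy mul0r subr0 hG0. Qed.

Lemma hG_neg_bound k w : (0 < k)%N -> 0 <= w ->
  `|hG k (- w)| <= (hGam k)^-1.
Proof.
move=> k0 w0; have G0 := @hGam_gt0 R k k0.
have := @hG_energy_le k (- w) 0 k0; rewrite oppr_le0 => /(_ w0).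
rewrite hG_energy0 /hG_energy mulNr opprK => E.
rewrite -(@ler_pXn2r _ 2)// ?nnegrE ?invr_ge0 ?(ltW G0)// -normrX ger0_norm ?exprn_even_ge0//.
by apply: le_trans E; rewrite lerDl mulr_ge0// exprn_even_ge0.
Qed.

Lemma hG_turan k X : (0 < k)%N -> 0 <= X ->
  X / 2 * hG k.+2 (X ^+ 2 / 4) <= hG k (X ^+ 2 / 4).
Proof.
move=> k0 X0; set w := _ / 4; have w0 : 0 <= w by rewrite divr_ge0// exprn_ge0.
rewrite -(@ler_pXn2r _ 2)// ?nnegrE ?mulr_ge0 ?divr_ge0//; try exact/ltW/hG_gt0.
have := hG_energy_le k0 w0; rewrite hG_energy0 /hG_energy => E.
have -> : (X / 2 * hG k.+2 w) ^+ 2 = w * hG k.+2 w ^+ 2 by rewrite exprMn /w; field.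
by rewrite -subr_ge0; apply: le_trans E; rewrite exprn_even_ge0.
Qed.

(** [hG_turan] at [k.+2] turns the recurrence into G_k <= (X/2 + k/2) G_(k+2). Multiplying by X/2 -
    k/2, when positive, gives a difference of squares, which is at most X^2/4. *)
Lemma hG_turan_rev k X : (0 < k)%N -> 0 <= X ->
  (X / 2 - k%:R / 2) * hG k (X ^+ 2 / 4) <= X ^+ 2 / 4 * hG k.+2 (X ^+ 2 / 4).
Proof.
move=> k0 X0; have := @hG_turan k.+2 X isT X0; set w := _ / 4.
have w0 : 0 <= w by rewrite divr_ge0// exprn_ge0.
have g0 := hG_gt0 k0 w0; have g2 := @hG_gt0 k.+2 w isT w0.
have XE : w = (X / 2) ^+ 2 by rewrite /w; field.
set g4 := hG k.+4 w => T.
have le1 : hG k w <= (X / 2 + k%:R / 2) * hG k.+2 w.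
  rewrite (hG_rec w k0) -/g4 mulrDl addrC lerD2r.
  have -> : w * g4 = X / 2 * (X / 2 * g4) by rewrite /w; field.
  by rewrite ler_wpM2l// divr_ge0.
have [Xk|Xk] := leP (X / 2) (k%:R / 2).
  apply: (@le_trans _ _ 0); last by rewrite mulr_ge0// ltW.
  by rewrite mulr_le0_ge0 ?subr_le0// ltW.
apply: le_trans (ler_wpM2l _ le1) _; first by rewrite subr_ge0 ltW.
rewrite mulrA ler_wpM2r ?(ltW g2)// -subr_sqr XE.
by rewrite gerBl exprn_even_ge0.
Qed.

(** This is exp(-X) (X/2)^(-nu) I_nu(X) with nu = k/2 - 1. That it decreases while X^k times it
    increases bounds its variation uniformly over all X >= 0. *)
Definition hPhi k X : R := expR (- X) * hG k (X ^+ 2 / 4).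

Lemma dhPhi k X : (0 < k)%N -> hasD (hPhi k) X
  (expR (- X) * (X / 2 * hG k.+2 (X ^+ 2 / 4) - hG k (X ^+ 2 / 4))).
Proof.
move=> k0.
have dq : hasD (fun X => X ^+ 2 / 4) X (X / 2).
  by apply: (deq (dM (dX 2 (did X)) (dcst 4^-1 X))); rewrite /= expr1; field.
apply: (deq (dM (dexpN X) (dcomp (dhG _ k0) dq))); ring.
Qed.

Lemma hPhi_gt0 k X : (0 < k)%N -> 0 < hPhi k X.
Proof. by move=> k0; rewrite mulr_gt0 ?expR_gt0// hG_gt0// divr_ge0// exprn_even_ge0. Qed.

Lemma hPhi_le k X Y : (0 < k)%N -> 0 <= X -> X <= Y -> hPhi k Y <= hPhi k X.
Proof.
move=> k0 X0 XY; apply: (@nonincreasing_of_derive R _ _ _ _ XY).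
  by move=> x _; exact: dhPhi.
move=> x xXY; rewrite pmulr_rle0 ?expR_gt0// subr_le0 hG_turan//.
by rewrite (le_trans X0)// (itvP xXY).
Qed.

(** The derivative of X^k [hPhi] is 2 X^(k-1) exp(-X) times the difference of the two sides of
    [hG_turan_rev]; this determines the power k. *)
Lemma hPhi_ge k X Y : (0 < k)%N -> 0 <= X -> X <= Y ->
  X ^+ k * hPhi k X <= Y ^+ k * hPhi k Y.
Proof.
move=> k0 X0 XY.
apply: (@nondecreasing_of_derive R (fun X => X ^+ k * hPhi k X) _ _ _ XY).
  by move=> x _; exact: dM (dX k (did x)) (dhPhi x k0).
move=> x xXY; have x0 : 0 <= x by rewrite (le_trans X0)// (itvP xXY).
have := hG_turan_rev k0 x0; rewrite /hPhi; set w := _ / 4 => T.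
case: k k0 T => // k _ T /=; rewrite exprS.
rewrite (_ : _ + _ = x ^+ k * expR (- x) * 2 * (x ^+ 2 / 4 * hG k.+3 w -
   (x / 2 - k.+1%:R / 2) * hG k.+1 w)); last by field.
by rewrite mulr_ge0 ?subr_ge0// !mulr_ge0 ?exprn_ge0 ?expR_ge0.
Qed.

End BesselSeries.

(** * Termwise integration of series *)

Section SeriesIntegration.
Context d (T : measurableType d) (R : realType).
Variable mu : {measure set T -> \bar R}.

Lemma EFin_limn_series (u : nat -> R) : (forall j, 0 <= u j) -> cvgn (series u) ->
  (\sum_(j <oo) (u j)%:E)%E = (limn (series u))%:E.
Proof.
move=> u0 cu; apply/cvg_lim => //.
have -> : (fun n => \sum_(0 <= j < n) (u j)%:E)%E = EFin \o series u.
  by apply/funext => n; rewrite /series/= sumEFin.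
by apply: cvg_EFin => //; exact: nearW.
Qed.

(** The partial sums are dominated by the series [g] of absolute values, which is integrable because
    its terms integrate to a convergent series. Signed coefficients must be allowed: the expansion
    of Bessel J alternates. *)
Lemma integral_series (D : set T) (h : nat -> T -> R) (x H : nat -> R) :
  measurable D -> (forall j, measurable_fun D (h j)) ->
  (forall j s, D s -> 0 <= h j s) ->
  (forall j, (\int[mu]_(s in D) (h j s)%:E)%E = (H j)%:E) ->
  cvgn (series (fun j => `|x j| * H j)) ->
  (forall s, D s -> cvgn (series (fun j => `|x j| * h j s))) ->
  mu.-integrable D (EFin \o (fun s => limn (series (fun j => x j * h j s)))) /\
  (\int[mu]_(s in D) (limn (series (fun j => x j * h j s)))%:E)%E =
    (limn (series (fun j => x j * H j)))%:E.
Proof.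
move=> mD mh h0 hH cH ch.
have H0 j : 0 <= H j.
  by rewrite -lee_fin -hH; apply: integral_ge0 => s Ds; rewrite lee_fin h0.
have mhj j : measurable_fun D (EFin \o h j) by exact/measurable_EFinP.
have ih j : mu.-integrable D (EFin \o h j).
  apply/integrableP; split => //.
  rewrite (_ : (\int[mu]_(s in D) _)%E = (H j)%:E) ?ltry// -hH.
  by apply: eq_integral => s /set_mem Ds; rewrite /= ger0_norm// h0.
pose F n s := series (fun j => x j * h j s) n.
pose g s := limn (series (fun j => `|x j| * h j s)).
have mF n : measurable_fun D (F n).
  rewrite /F /series/=; apply: measurable_sum => j.
  by apply: measurable_funM => //; exact: measurable_cst.
have cF s : D s -> F n s @[n --> \oo] --> limn (series (fun j => x j * h j s)).
  move=> Ds; have E : (fun j => `|x j * h j s|) = (fun j => `|x j| * h j s).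
    by apply/funext => j; rewrite normrM (ger0_norm (h0 j s Ds)).
  by apply: normed_cvg; rewrite /normed_series_of/= E; exact: ch.
have mg : measurable_fun D g.
  apply: (@measurable_fun_cvg _ _ _ D (fun n s => series (fun j => `|x j| * h j s) n)).
  - move=> n; rewrite /series/=; apply: measurable_sum => j.
    by apply: measurable_funM => //; exact: measurable_cst.
  - by move=> s Ds; exact: ch.
have mL : measurable_fun D (fun s => limn (series (fun j => x j * h j s))).
  by apply: (@measurable_fun_cvg _ _ _ D F) => // s Ds; exact: cF.
have g0 s : D s -> 0 <= g s.
  move=> Ds; apply: limr_ge; first exact: ch.
  by near=> n; apply: sumr_ge0 => j _; rewrite mulr_ge0// h0.
have ig : mu.-integrable D (EFin \o g).
  apply/integrableP; split; first exact/measurable_EFinP.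
  rewrite (_ : (\int[mu]_(s in D) _)%E =
     \int[mu]_(s in D) \sum_(j <oo) (`|x j| * h j s)%:E)%E; last first.
    apply: eq_integral => s /set_mem Ds /=; rewrite ger0_norm ?g0//.
    by rewrite EFin_limn_series//; [move=> j; rewrite mulr_ge0// h0|exact: ch].
  rewrite integral_nneseries//; last 2 first.
  - move=> j; apply/measurable_EFinP; apply: (measurable_funM (f := fun=> `|x j|)).
      exact: measurable_cst.
    exact: mh.
  - by move=> j s Ds; rewrite lee_fin mulr_ge0// h0.
  have xH j : (\int[mu]_(s in D) (`|x j| * h j s)%:E)%E = (`|x j| * H j)%:E.
    rewrite EFinM -hH -ge0_integralZl_EFin//.
      by move=> s Ds; rewrite lee_fin h0.
    by apply/measurable_EFinP; exact: mh.
  under eq_eseriesr do rewrite xH.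
  by rewrite EFin_limn_series ?ltry// => j; rewrite mulr_ge0.
have domF s n : D s -> `|F n s| <= g s.
  move=> Ds; apply: le_trans (ler_norm_sum _ _ _) _.
  rewrite (eq_bigr (fun j => `|x j| * h j s)); last first.
    by move=> j _; rewrite normrM (ger0_norm (h0 j s Ds)).
  apply: (@nondecreasing_cvgn_le _ (series (fun j => `|x j| * h j s))); last exact: ch.
  by apply: nondecreasing_series => j _ _; rewrite mulr_ge0// h0.
have [] := @dominated_convergence _ _ _ mu D mD (fun n s => (F n s)%:E)
  (fun s => (limn (series (fun j => x j * h j s)))%:E) (EFin \o g).
- by move=> n; exact/measurable_EFinP.
- exact/measurable_EFinP.
- by apply: aeW => s Ds; apply/cvg_EFin; [exact: nearW|exact: cF].
- exact: ig.
- by apply: aeW => s n Ds; rewrite /= lee_fin domF.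
move=> iL _ cI; split => //; apply: (cvg_unique _ cI) => //.
have -> : (fun n => \int[mu]_(s in D) (F n s)%:E)%E = EFin \o series (fun j => x j * H j).
  apply/funext => n; rewrite /F /series/=.
  under eq_integral do rewrite -sumEFin.
  rewrite integral_sum//; last first.
    move=> j; have := integrableZl mD (x j) (ih j).
    by apply: eq_integrable => // s _; rewrite /= EFinM.
  rewrite -sumEFin; apply: eq_bigr => j _.
  by under eq_integral do rewrite EFinM; rewrite (integralZl mD (ih j)) EFinM -hH.
apply/cvg_EFin; first exact: nearW.
have E : (fun j => `|x j * H j|) = (fun j => `|x j| * H j).
  by apply/funext => j; rewrite normrM (ger0_norm (H0 j)).
by apply: normed_cvg; rewrite /normed_series_of/= E.
Unshelve. all: by end_near. Qed.

End SeriesIntegration.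

Section GaussianBessel.
Context {R : realType}.
Notation leb := (@lebesgue_measure R).

Lemma limn_seriesMl (a : R) (u : nat -> R) : cvgn (series u) ->
  limn (series (fun j => a * u j)) = a * limn (series u).
Proof.
move=> cu; apply/cvg_lim => //.
have -> : series (fun j => a * u j) = (fun n => a * series u n).
  by apply/funext => n; rewrite /series/= mulr_sumr.
exact: cvgMr.
Qed.

Lemma integral_gauss_pow (j : nat) (tau : R) : 0 < tau ->
  (\int[leb]_(s in `]0%R, +oo[) (s ^+ j * expR (- (s ^+ 2 * tau)))%:E)%E =
  (hGam j.+1 / 2 * (tau `^ (j.+1%:R / 2))^-1)%:E.
Proof.
move=> tau0; have := eGamma_square j tau0; rewrite eGammaE//.
set I := (\int[_]_(_ in _) _)%E => E.
have t0 : 0 < 2 * tau `^ (j.+1%:R / 2) by rewrite mulr_gt0 ?powR_gt0.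
have -> : hGam j.+1 / 2 * (tau `^ (j.+1%:R / 2))^-1 =
    (2 * tau `^ (j.+1%:R / 2))^-1 * hGam j.+1 by rewrite invfM; ring.
by rewrite EFinM E muleA -EFinM mulVf ?mul1e// gt_eqF.
Qed.

(** The Gaussian moment of order 2j + m - 1 carries exactly the Gamma value in the denominator of
    [gcoef]. After cancellation the exponential series at -v^2/(4 tau) remains. *)
Lemma gauss_hG (m : nat) (v tau : R) : (0 < m)%N -> 0 < tau ->
  let F := fun s : R => s ^+ m.-1 * hG m (- ((s * v) ^+ 2 / 4)) * expR (- (s ^+ 2 * tau)) in
  leb.-integrable `]0, +oo[ (EFin \o F) /\
  (\int[leb]_(s in `]0%R, +oo[) (F s)%:E)%E =
    (2^-1 * (tau `^ (m%:R / 2))^-1 * expR (- (v ^+ 2 / (4 * tau))))%:E.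
Proof.
move=> m0 tau0 F; case: m m0 @F => // m _ F.
pose h j (s : R) := s ^+ (j.*2 + m) * expR (- (s ^+ 2 * tau)).
pose x j : R := gcoef m.+1 j * (- (v ^+ 2 / 4)) ^+ j.
pose H j : R := hGam (j.*2 + m).+1 / 2 * (tau `^ ((j.*2 + m).+1%:R / 2))^-1.
have ch s : h ^~ s = fun j => (s ^+ m * expR (- (s ^+ 2 * tau))) * (s ^+ 2) ^+ j.
  by apply/funext => j; rewrite /h -exprM -mul2n exprD; ring.
have xh s : (fun j => x j * h j s) = (fun j => (s ^+ m * expR (- (s ^+ 2 * tau))) *
    (gcoef m.+1 j * (- ((s * v) ^+ 2 / 4)) ^+ j)).
  apply/funext => j; rewrite (congr1 (@^~ j) (ch s)) /x.
  have -> : - ((s * v) ^+ 2 / 4) = - (v ^+ 2 / 4) * s ^+ 2 by field.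
  by move: (- (v ^+ 2 / 4)) (s ^+ 2) => a b; rewrite exprMn; ring.
have xH j : x j * H j = 2^-1 * (tau `^ (m.+1%:R / 2))^-1 * exp_coeff (- (v ^+ 2 / (4 * tau))) j.
  rewrite /x /H exp_coeffE /gcoef addnS.
  have -> : (j.*2 + m).+1%:R / 2 = m.+1%:R / 2 + j%:R :> R.
    by rewrite -addnS natrD -muln2 natrM; field.
  rewrite powRD ?(gt_eqF tau0) ?implybT// powR_mulrn ?ltW//.
  have -> : - (v ^+ 2 / (4 * tau)) = - (v ^+ 2 / 4) * tau^-1 by field; rewrite gt_eqF.
  rewrite exprMn exprVn; field.
  by rewrite !gt_eqF ?hGam_gt0 ?exprn_gt0 ?powR_gt0 ?ltr0n ?fact_gt0.
have H0 j : 0 <= H j by rewrite mulr_ge0 ?divr_ge0 ?invr_ge0 ?powR_ge0 ?ltW ?hGam_gt0.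
have [] := @integral_series _ _ R leb `]0, +oo[%classic h x H.
- by [].
- move=> j; apply: measurable_continuous_oy => s s0.
  apply: hasD_continuous; apply: (dM (dX _ (did s))).
  exact: (dcomp (dexp _) (dN (dM (dX 2 (did s)) (dcst tau s)))).
- by move=> j s /=; rewrite in_itv/= andbT => s0; rewrite mulr_ge0 ?exprn_ge0 ?expR_ge0 ?ltW.
- by move=> j; exact: integral_gauss_pow.
- have -> : (fun j => `|x j| * H j) = (fun j => `|x j * H j|).
    by apply/funext => j; rewrite -{1}(ger0_norm (H0 j)) -normrM.
  have -> : (fun j => `|x j * H j|) = (fun j => 2^-1 * (tau `^ (m.+1%:R / 2))^-1 *
      exp_coeff (`|v ^+ 2 / (4 * tau)|) j).
    apply/funext => j; rewrite xH normrM ger0_norm; last first.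
      by rewrite mulr_ge0 ?invr_ge0 ?powR_ge0.
    by congr (_ * _); rewrite !exp_coeffE normrM normrX normrN ger0_norm ?invr_ge0.
  by apply: is_cvg_seriesZ; exact: is_cvg_series_exp_coeff.
- move=> s /=; rewrite in_itv/= andbT => s0.
  have -> : (fun j => `|x j| * h j s) = (fun j => (s ^+ m * expR (- (s ^+ 2 * tau))) *
     `|gcoef m.+1 j * (- ((s * v) ^+ 2 / 4)) ^+ j|).
    apply/funext => j; have h0 : 0 <= h j s.
      by rewrite mulr_ge0 ?exprn_ge0 ?expR_ge0 ?ltW.
    rewrite -[h j s]ger0_norm// -normrM (congr1 (@^~ j) (xh s)) normrM ger0_norm//.
    by rewrite mulr_ge0 ?exprn_ge0 ?expR_ge0 ?ltW.
  by apply: is_cvg_seriesZ; exact: cvg_hG_norm.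
have FE s : limn (series (fun j => x j * h j s)) = F s.
  rewrite xh limn_seriesMl; last exact: (@cvg_hG R m.+1).
  by rewrite /F /hG /pseries/=; ring.
have HE : limn (series (fun j => x j * H j)) =
    2^-1 * (tau `^ (m.+1%:R / 2))^-1 * expR (- (v ^+ 2 / (4 * tau))).
  by rewrite (eq_fun xH) limn_seriesMl; [|exact: is_cvg_series_exp_coeff].
by rewrite HE; under eq_integral do rewrite FE; under [X in EFin \o X]eq_fun do rewrite FE.
Qed.

Lemma besselJ_hG (m : nat) (x : R) : (0 < m)%N -> 0 < x ->
  (x / 2) `^ (- ((m%:R - 2) / 2)) * besselJ ((m%:R - 2) / 2) x = hG m (- (x ^+ 2 / 4)).
Proof.
move=> m0 x0; have x20 : 0 < x / 2 by rewrite divr_gt0.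
set nu := (m%:R - 2) / 2.
have -> : besselJ nu x = (x / 2) `^ nu * hG m (- (x ^+ 2 / 4)).
  have -> : hG m (- (x ^+ 2 / 4)) =
    limn (series (fun k => gcoef m k * (- (x ^+ 2 / 4)) ^+ k)) by [].
  rewrite /besselJ -limn_seriesMl; last exact: (@cvg_hG R m).
  congr (limn (series _)); apply/funext => k.
  rewrite /gcoef hGamE powRD ?(gt_eqF x20) ?implybT//.
  have -> : (k.*2 + m)%:R / 2 = k%:R + nu + 1 :> R.
    by rewrite /nu natrD -muln2 natrM; field.
  have -> : 2 * k%:R = (k.*2)%:R :> R by rewrite -mul2n natrM.
  rewrite powR_mulrn ?(ltW x20)// -mul2n exprM.
  have -> : - (x ^+ 2 / 4) = (-1) * (x / 2) ^+ 2 by field.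
  move: ((x / 2) ^+ 2) ((x / 2) `^ nu) (k`!%:R * _) => y z w.
  by rewrite exprMn; ring.
by rewrite mulrA -powRD ?addNr ?powRr0 ?mul1r// (gt_eqF x20) implybT.
Qed.

End GaussianBessel.

(** * The series of Bessel I from its Poisson integral *)

Section BesselI.
Context {R : realType}.
Notation leb := (@lebesgue_measure R).

Lemma itv01_bigcup : `]0 : R, 1[%classic =
  \bigcup_n `[(n.+3%:R^-1 : R), 1 - n.+3%:R^-1]%classic.
Proof.
apply/seteqP; split => x /=; last first.
  move=> [n _ /=]; rewrite !in_itv/= => /andP[lx xu].
  by rewrite (lt_le_trans _ lx) ?invr_gt0//= (le_lt_trans xu) ?gtrBl ?invr_gt0.
rewrite in_itv/= => /andP[x0 x1]; have x1' : 0 < 1 - x by rewrite subr_gt0.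
exists (maxn (Num.truncn x^-1) (Num.truncn (1 - x)^-1)) => //=; rewrite in_itv/=.
set N := maxn _ _.
have NE (y : R) : (Num.truncn y <= N)%N -> y <= N.+3%:R.
  move=> yN; rewrite ltW// (lt_le_trans (Num.Theory.truncnS_gt _))//.
  by rewrite ler_nat ltnS (leq_trans yN)// -addn2 leq_addr.
have h1 : x^-1 <= N.+3%:R by apply: NE; exact: leq_maxl.
have h2 : (1 - x)^-1 <= N.+3%:R by apply: NE; exact: leq_maxr.
apply/andP; split.
- by rewrite -[leRHS]invrK lef_pV2 ?posrE ?invr_gt0.
- by rewrite lerBrDl -lerBrDr -[leRHS]invrK lef_pV2 ?posrE ?invr_gt0.
Qed.

Lemma integral_itv01_scale (G : R -> R) (r : R) : 0 < r ->
  (forall y, 0 < y < r -> {for y, continuous G}) ->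
  (forall y, 0 < y < r -> 0 <= G y) ->
  (\int[leb]_(y in `]0%R, r[) (G y)%:E =
   \int[leb]_(h in `]0%R, 1%R[) (G (r * h) * r)%:E)%E.
Proof.
move=> r0 cG G0.
apply: (@ge0_substitution_exhaustion R (fun h => r * h) (fun=> r) G _ _
  (fun n => n.+3%:R^-1) (fun n => 1 - n.+3%:R^-1)) => //.
- apply/seteqP; split => [y /=|_ [h /= + <-]]; rewrite !in_itv/= => /andP[h0 h1].
    exists (y / r); last by rewrite mulrC divfK// gt_eqF.
    by rewrite /= in_itv/= divr_gt0//= ltr_pdivrMr// mul1r.
  by rewrite mulr_gt0//= gtr_pMr.
- exact: itv01_bigcup.
- move=> n; have : (n.+3%:R^-1 : R) <= 3^-1 by rewrite lef_pV2 ?posrE// ler_nat.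
  by move: (n.+3%:R^-1 : R) => y y3; lra.
- by move=> i j ij; rewrite lef_pV2 ?posrE// ler_nat !ltnS.
- by move=> i j ij; rewrite lerD2l lerN2 lef_pV2 ?posrE// ler_nat !ltnS.
- by move=> x _; apply: (deq (dM (dcst r x) (did x))); rewrite mul0r add0r mulr1.
- by move=> x _; exact: cst_continuous.
- by move=> x y _ _; rewrite ltr_pM2l.
- by move=> x _; exact: ltW.
Qed.

(** The Beta integral in the variable h = y/r. The kernel [q] is integrated over the wedge 0 < y < r
    in both orders; one order gives a product of two Gamma values, the other a single Gamma value
    times the wanted integral [W]. *)
Lemma beta_moment (n j : nat) : (0 < n)%N ->
  (\int[leb]_(h in `]0%R, 1%R[)
     ((1 - h ^+ 2) `^ (n%:R - 1 - 1 / 2) * h ^+ j.*2)%:E)%E =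
  (hGam n.*2.-1 * hGam j.*2.+1 / (2 * hGam (j + n).*2))%:E :> \bar R.
Proof.
move=> n0; have jnE : (j.*2 + n.*2.-1).+1 = (j + n).*2.
  by case: n n0 => // n' _; rewrite !doubleD doubleS /= !addnS.
have pE : n%:R - 1 - 1 / 2 = n.*2.-1%:R / 2 - 1 :> R.
  by case: n n0 {jnE} => // n' _; rewrite doubleS/= -!natr1 -muln2 natrM; field.
set p : R := n%:R - 1 - 1 / 2 in pE *; set W := (\int[_]_(_ in _) _)%E.
have n2 : (0 < n.*2.-1)%N by case: n n0 {jnE pE p W}.
have gn := @hGam_gt0 R _ n2.
have eg : eGamma (p + 1) = (hGam n.*2.-1)%:E :> \bar R.
  by rewrite -eGammaE// pE subrK.
have W0 : (0 <= W)%E.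
  apply: integral_ge0 => h /=; rewrite in_itv/= => /andP[h0 h1].
  by rewrite lee_fin mulr_ge0 ?powR_ge0// exprn_ge0// ltW.
pose D := [set z : R * R | 0 < z.1 < z.2].
pose q (z : R * R) : R := z.1 ^+ j.*2 * (z.2 ^+ 2 - z.1 ^+ 2) `^ p * (2 * z.2 * expR (- z.2 ^+ 2)).
pose k (z : R * R) : R := \1_D z * q z.
have mD : measurable D.
  have -> : D = (fun z : R * R => z.1) @^-1` `]0, +oo[%classic `&`
     (fun z : R * R => z.2 - z.1) @^-1` `]0, +oo[%classic.
    apply/seteqP; split => z; rewrite /D /= !in_itv/= !andbT subr_gt0.
      by move=> /andP[].
    by move=> [-> ->].
  apply: measurableI.
    by rewrite -[X in measurable X]setTI; exact: measurable_fst.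
  rewrite -[X in measurable X]setTI.
  by apply: (measurable_funB (@measurable_snd _ _ R R) (@measurable_fst _ _ R R)).
have mk : measurable_fun setT k.
  apply: measurable_funM; first exact: measurable_indic.
  apply: measurable_funM.
    apply: measurable_funM.
      by apply: measurable_funX; exact: measurable_fst.
    apply: (measurableT_comp (measurable_powR p)).
    apply: measurable_funB; apply: measurable_funX.
      exact: measurable_snd.
    exact: measurable_fst.
  apply: measurable_funM.
    by apply: measurable_funM; [exact: measurable_cst|exact: measurable_snd].
  apply: measurableT_comp => //; apply: measurableT_comp => //.
  by apply: measurable_funX; exact: measurable_snd.
have k0 z : 0 <= k z.
  rewrite /k indicE; case: (boolP (z \in D)) => [|_]; last by rewrite mul0r.
  rewrite inE /D /= => /andP[z1 z2]; rewrite mul1r /q !mulr_ge0 ?powR_ge0 ?expR_ge0//.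
    by rewrite exprn_ge0// ltW.
  by rewrite ltW// (lt_trans z1).
have mW1 : measurable_fun setT (fun h : R => (1 - h ^+ 2) `^ p * h ^+ j.*2).
  apply: measurable_funM; last exact: measurable_funX.
  apply: (measurableT_comp (measurable_powR p)).
  by apply: measurable_funB; [exact: measurable_cst|exact: measurable_funX].
have mEk : measurable_fun setT (EFin \o k) by exact/measurable_EFinP.
have := @fubini_tonelli _ _ _ _ R leb leb (EFin \o k) mEk (fun z => k0 z).
(* Inner integral over r > y: the substitution t = r^2 - y^2 gives Gamma(p + 1) exp(-y^2), and a
   Gaussian moment in y is left. *)
have -> : (\int[leb]_x \int[leb]_y (EFin \o k) (x, y))%E =
    (hGam n.*2.-1 * hGam j.*2.+1 / 2)%:E.
  rewrite -[RHS]/((_ * _)%:E).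
  have inner y : (\int[leb]_r (k (y, r))%:E)%E =
      ((fun y : R => (hGam n.*2.-1)%:E * (y ^+ j.*2 * expR (- (y ^+ 2 * 1)))%:E)%E \_ `]0%R, +oo[) y.
    rewrite patchE mem_setE in_itv/= andbT; have [y0|y0] := ltP 0 y; last first.
      apply: integral0_eq => r _; rewrite /k indicE memNset ?mul0r//.
      by rewrite /D /= => /andP[]; rewrite ltNge y0.
    have sub : eGamma (p + 1) = (\int[leb]_(r in `]y, +oo[)
        (gammaf (p + 1) (r ^+ 2 - y ^+ 2) * (2 * r))%:E)%E.
      rewrite /eGamma (@ge0_substitution_oy R (fun r => r ^+ 2 - y ^+ 2) (fun r => 2 * r)
        (gammaf (p + 1)) y)//.
      - apply: itvoy_imageE => [x yx|t t0].
          by rewrite subr_gt0 ltr_pXn2r// ?nnegrE ltW// (lt_trans y0).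
        have ty : 0 <= t + y ^+ 2 by rewrite addr_ge0 ?exprn_ge0 ?(ltW t0) ?(ltW y0).
        exists (Num.sqrt (t + y ^+ 2)); last by rewrite sqr_sqrtr// addrK.
        rewrite -(ltr_pXn2r (n := 2))// ?nnegrE ?(ltW y0) ?sqrtr_ge0//.
        by rewrite sqr_sqrtr// ltrDr.
      - move=> x _; apply: (deq (dB (dX 2 (did x)) (dcst (y ^+ 2) x))).
        by rewrite /= expr1 mulr1 subr0.
      - by move=> x _; exact: hasD_continuous (dM (dcst 2 x) (did x)).
      - by move=> x yx; rewrite mulr_gt0// (lt_trans y0).
      - by move=> t /=; rewrite in_itv/= andbT; exact: continuous_gammaf.
      - by move=> t _; exact: gammaf_ge0.
    rewrite -eg sub -[X in (X * _)%E]mule1 -muleA mul1e muleC -ge0_integralZl_EFin//; last 3 first.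
    - move=> r /=; rewrite in_itv/= andbT => yr.
      rewrite lee_fin; apply: mulr_ge0; first exact: gammaf_ge0.
      by rewrite mulr_ge0// ltW// (lt_trans y0).
    - apply/measurable_EFinP; apply: measurable_continuous_oy => r yr.
      have ry0 : 0 < r ^+ 2 - y ^+ 2.
        by rewrite subr_gt0 ltr_pXn2r// ?nnegrE ltW// (lt_trans y0).
      apply: continuousM; last exact: hasD_continuous (dM (dcst 2 r) (did r)).
      apply: (@continuous_comp _ _ _ (fun r : R => r ^+ 2 - y ^+ 2)).
        exact: hasD_continuous (dB (dX 2 (did r)) (dcst (y ^+ 2) r)).
      exact: continuous_gammaf.
    - by rewrite mulr_ge0 ?expR_ge0// exprn_ge0// ltW.
    rewrite [RHS]integral_mkcond; apply: eq_integral => r _.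
    rewrite patchE mem_setE in_itv/= andbT /k indicE.
    have [yr|yr] := ltP y r; last first.
      by rewrite memNset ?mul0r// /D /= => /andP[_]; rewrite ltNge yr.
    rewrite mem_set; last by rewrite /D /= y0.
    rewrite mul1r -EFinM; congr EFin; rewrite /q /gammaf addrK /= mulr1.
    have -> : expR (- r ^+ 2) = expR (- y ^+ 2) * expR (- (r ^+ 2 - y ^+ 2)).
      by rewrite -expRD; congr expR; ring.
    by ring.
  under eq_integral do rewrite inner.
  rewrite -integral_mkcond ge0_integralZl_EFin//; last 3 first.
  - move=> y /=; rewrite in_itv/= andbT => y0.
    by rewrite lee_fin mulr_ge0 ?expR_ge0// exprn_ge0// ltW.
  - apply/measurable_EFinP; apply: measurable_continuous_oy => y y0.
    apply: hasD_continuous; apply: (dM (dX _ (did y))).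
    exact: (dcomp (dexp _) (dN (dM (dX 2 (did y)) (dcst 1 y)))).
  - exact: ltW.
  by rewrite integral_gauss_pow// powR1 invr1 mulr1 -EFinM mulrA.
(* Inner integral over 0 < y < r: scaling y = r h separates [W] from a Gaussian moment in r. *)
have -> : (\int[leb]_y \int[leb]_x (EFin \o k) (x, y))%E = ((hGam (j + n).*2)%:E * W)%E.
  have inner r : (\int[leb]_y (k (y, r))%:E)%E =
      ((fun r : R => W * (2 * r ^+ (j.*2 + n.*2.-1) * expR (- (r ^+ 2 * 1)))%:E)%E \_ `]0%R, +oo[) r.
    rewrite patchE mem_setE in_itv/= andbT; have [r0|r0] := ltP 0 r; last first.
      apply: integral0_eq => y _; rewrite /k indicE memNset ?mul0r//.
      by rewrite /D /= => /andP[y0 yr]; have := lt_le_trans yr r0; rewrite ltNge (ltW y0).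
    have -> : (\int[leb]_y (k (y, r))%:E)%E = (\int[leb]_(y in `]0%R, r[) (q (y, r))%:E)%E.
      rewrite [RHS]integral_mkcond; apply: eq_integral => y _.
      rewrite patchE mem_setE in_itv/= /k indicE.
      case: (boolP (0 < y < r)) => yr; last by rewrite memNset ?mul0r//; exact/negP.
      by rewrite mem_set// mul1r.
    rewrite integral_itv01_scale//; last 2 first.
    - move=> y /andP[y0 yr]; have ry : 0 < r ^+ 2 - y ^+ 2.
        by rewrite subr_gt0 ltr_pXn2r// ?nnegrE ltW.
      have dp := dcomp (g := fun y : R => r ^+ 2 - y ^+ 2) (dpowR p ry) (dB (dcst (r ^+ 2) y) (dX 2 (did y))).
      exact: hasD_continuous (dM (dM (dX j.*2 (did y)) dp)
        (dcst (2 * r * expR (- r ^+ 2)) y)).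
    - move=> y /andP[y0 yr]; rewrite /q /= !mulr_ge0 ?powR_ge0 ?expR_ge0 ?exprn_ge0//; exact: ltW.
    rewrite muleC /W -ge0_integralZl_EFin//; last 3 first.
    - move=> h /=; rewrite in_itv/= => /andP[h0 h1].
      by rewrite lee_fin mulr_ge0 ?powR_ge0// exprn_ge0// ltW.
    - by apply/measurable_EFinP; apply: measurable_funTS.
    - by rewrite !mulr_ge0 ?exprn_ge0 ?expR_ge0// ltW.
    apply: eq_integral => h; rewrite inE/= in_itv/= => /andP[h0 h1].
    rewrite -EFinM; congr EFin; rewrite /q /= mulr1.
    have -> : r ^+ 2 - (r * h) ^+ 2 = r ^+ 2 * (1 - h ^+ 2) by ring.
    have h2 : 0 <= 1 - h ^+ 2 by rewrite subr_ge0 expr_le1// ltW.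
    rewrite powRM ?exprn_ge0 ?(ltW r0)// exprMn.
    have rp : (r ^+ 2) `^ p * r * r = r ^+ n.*2.-1.
      rewrite -(powR_mulrn 2 (ltW r0)) -powRrM -[X in _ * X * X](powRr1 (ltW r0)).
      rewrite -!powRD ?(gt_eqF r0) ?implybT// -powR_mulrn ?(ltW r0)//; congr (_ `^ _).
      by rewrite pE; field.
    by rewrite exprD -rp; ring.
  under eq_integral do rewrite inner.
  rewrite -integral_mkcond ge0_integralZl//; last 2 first.
  - apply/measurable_EFinP; apply: measurable_continuous_oy => r r0.
    apply: hasD_continuous; apply: (dM (dM (dcst 2 r) (dX _ (did r)))).
    exact: (dcomp (dexp _) (dN (dM (dX 2 (did r)) (dcst 1 r)))).
  - move=> r /=; rewrite in_itv/= andbT => r0.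
    by rewrite lee_fin !mulr_ge0 ?expR_ge0// exprn_ge0// ltW.
  rewrite muleC; congr (_ * _)%E.
  under eq_integral do rewrite -mulrA EFinM.
  rewrite ge0_integralZl_EFin//; last 2 first.
  - move=> r /=; rewrite in_itv/= andbT => r0.
    by rewrite lee_fin !mulr_ge0 ?expR_ge0// exprn_ge0// ltW.
  - apply/measurable_EFinP; apply: measurable_continuous_oy => r r0.
    apply: hasD_continuous; apply: (dM (dX _ (did r))).
    exact: (dcomp (dexp _) (dN (dM (dX 2 (did r)) (dcst 1 r)))).
  rewrite integral_gauss_pow// powR1 invr1 mulr1 -EFinM; congr EFin.
  rewrite mulrC divfK//; by rewrite jnE.
move=> E; have g0 : 0 < hGam (j + n).*2 :> R.
  by apply: hGam_gt0; rewrite double_gt0 addn_gt0 n0 orbT.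
have <- : ((hGam (j + n).*2)^-1%:E * ((hGam (j + n).*2)%:E * W) = W)%E.
  by rewrite muleA -EFinM mulVf ?mul1e// gt_eqF.
by rewrite -E -EFinM invfM; congr EFin; ring.
Qed.

End BesselI.

Section BesselI2.
Context {R : realType}.
Notation leb := (@lebesgue_measure R).

(** Half-integer case of the duplication formula. It trades the (2j)! of the cosh series for the 4^j
    j! needed by [gcoef] at x^2/4. *)
Lemma hGam_odd (j : nat) :
  hGam j.*2.+1 = Num.sqrt pi * (j.*2)`!%:R / (4 ^+ j * j`!%:R) :> R.
Proof.
elim: j => [|j IH]; first by rewrite hGam1 double0 fact0 expr0; field.
rewrite doubleS hGamS// IH !factS !natrM exprS.
have j0 : (j`!%:R : R) != 0 by rewrite pnatr_eq0 -lt0n fact_gt0.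
have p4 : (4 ^+ j : R) != 0 by rewrite expf_eq0 pnatr_eq0 andbF.
have -> : j.*2.+2%:R = 2 * (j.+1%:R) :> R by rewrite -natrM mul2n doubleS.
have j1 : (j.+1%:R : R) != 0 by rewrite pnatr_eq0.
by field; rewrite j0 p4 addrC natr1 j1.
Qed.

Lemma ge0_integral_reflect (f : R -> \bar R) (D : set R) : measurable D ->
  measurable_fun setT f -> (forall r, (0 <= f r)%E) ->
  (\int[leb]_(r in D) f r =
   \int[leb]_(r in (-%R : _ -> measurableTypeR R) @^-1` D) f (- r)%R)%E.
Proof.
move=> mD mf f0.
transitivity (\int[pushforward leb (-%R : _ -> measurableTypeR R)]_(r in D) f r)%E.
  by apply: eq_measure_integral => //= A mA AS; exact/esym/lebesgue_measureN.
by rewrite ge0_integral_pushforward//=; exact: measurable_funS mf.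
Qed.

(** Folding at 0 turns exp(-x h) into 2 cosh(x h), whose expansion has nonnegative terms and even
    powers only. *)
Lemma integral_sym_itv (f : R -> R) : measurable_fun setT f -> (forall x, 0 <= f x) ->
  (\int[leb]_(h in `[(- 1)%R, 1%R]) (f h)%:E =
   \int[leb]_(h in `]0%R, 1%R[) (f (- h) + f h)%:E)%E.
Proof.
move=> mf f0.
have mfT (D : set R) : measurable_fun D f by exact: measurable_funTS.
have mfN (D : set R) : measurable_fun D (fun x : R => f (- x)).
  by apply: measurable_funTS; apply: measurableT_comp.
have U : `[(- 1 : R), 1]%classic = `[(- 1 : R), 0[%classic `|` `[0 : R, 1]%classic.
  apply/seteqP; split => x /=; rewrite !in_itv/=.
    by move=> /andP[x1 x2]; have [x0|x0] := ltP x 0; [left|right]; rewrite ?x1 ?x2.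
  move=> [/andP[x1 x2]|/andP[x1 x2]].
    by rewrite x1/= ltW// (lt_trans x2).
  by rewrite x2 andbT (le_trans _ x1)// lerN10.
rewrite U ge0_integral_setU//=; last 3 first.
- by apply/measurable_EFinP; first [exact: mfT|exact: mfN].
- by move=> x _; rewrite lee_fin.
- apply/disj_setPS => x [] /=; rewrite !in_itv/= => /andP[_ x0] /andP[x1 _].
  by move: x0; rewrite ltNge x1.
have reflect : (\int[leb]_(h in `[(- 1)%R, 0%R[) (f h)%:E =
    \int[leb]_(h in `]0%R, 1%R]) (f (- h))%:E)%E.
  have -> : `]0 : R, 1]%classic = (-%R : _ -> measurableTypeR R) @^-1` `[(- 1 : R), 0[%classic.
    by apply/seteqP; split => x /=; rewrite !in_itv/= lerN2 oppr_lt0 andbC.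
  apply: (@ge0_integral_reflect (EFin \o f)) => //.
    by apply/measurable_EFinP.
rewrite reflect.
rewrite (@integral_itv_bndoo R 0 1 (fun h => (f (- h))%:E) false false); last first.
  by apply/measurable_EFinP; exact: mfN.
rewrite (@integral_itv_bndoo R 0 1 (fun h => (f h)%:E) true false); last first.
  by apply/measurable_EFinP; exact: mfT.
rewrite -ge0_integralD//=.
- by move=> x _; rewrite lee_fin.
- by apply/measurable_EFinP; first [exact: mfT|exact: mfN].
- by move=> x _; rewrite lee_fin.
- by apply/measurable_EFinP; first [exact: mfT|exact: mfN].
Qed.

Lemma cvg_cosh_series (y : R) :
  series (fun j => 2 * y ^+ j.*2 / (j.*2)`!%:R) @ \oo --> expR (- y) + expR y.
Proof.
have E n : series (fun j => 2 * y ^+ j.*2 / (j.*2)`!%:R) n =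
    series (exp_coeff (- y)) n.*2 + series (exp_coeff y) n.*2.
  elim: n => [|n IH]; first by rewrite /series/= !big_geq// addr0.
  have pS (u : nat -> R) N : series u N.+1 = series u N + u N.
    by rewrite /series/= big_nat_recr.
  rewrite doubleS !pS IH !exp_coeffE !exprS !factS -mul2n !exprM sqrrN.
  ring.
rewrite (funext E).
have c2 : n.*2 @[n --> \oo] --> \oo.
  move=> A [N _ NA]; exists N => // n /= Nn; apply: NA => /=.
  by rewrite (leq_trans Nn)// -addnn leq_addr.
by apply: cvgD; apply: (cvg_comp _ _ c2); exact: is_cvg_series_exp_coeff.
Qed.

(** The cosh series is integrated termwise against (1 - h^2)^p; [beta_moment] supplies the moments,
    and [hGam_odd] cancels the factorial (2j)!. *)
Lemma besselI_hG (n : nat) (x : R) : (0 < n)%N -> 0 < x ->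
  besselI (n%:R - 1) x = (x / 2) ^+ n.-1 * hG n.*2 (x ^+ 2 / 4).
Proof.
move=> n0 x0; rewrite /besselI; set p : R := n%:R - 1 - 1 / 2.
have mp : measurable_fun setT (fun h : R => (1 - h ^+ 2) `^ p).
  apply: (measurableT_comp (measurable_powR p)).
  by apply: measurable_funB; [exact: measurable_cst|exact: measurable_funX].
have gn : 0 < hGam n.*2.-1 :> R by apply: hGam_gt0; case: n n0 {p mp}.
have GE : Gamma (n%:R - 1 + 1 / 2) = hGam n.*2.-1 :> R.
  rewrite hGamE; congr Gamma; case: n n0 {p mp gn} => // n _.
  by rewrite doubleS/= -!natr1 -muln2 natrM; field.
have sp : 0 < Num.sqrt pi :> R by rewrite sqrtr_gt0 pi_gt0.
suff IE : (\int[leb]_(h in `[(- 1)%R, 1%R]) ((1 - h ^+ 2) `^ p * expR (- (x * h)))%:E)%E =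
    (hGam n.*2.-1 * Num.sqrt pi * hG n.*2 (x ^+ 2 / 4))%:E.
  rewrite /Rintegral IE/= GE; have x2 : 0 < x / 2 by rewrite divr_gt0.
  have -> : (x / 2) `^ (n%:R - 1) = (x / 2) ^+ n.-1.
    rewrite -powR_mulrn ?(ltW x2)//; congr (_ `^ _).
    by case: n n0 {p mp gn GE IE} => // n _; rewrite -natr1 addrK.
  by field; rewrite !gt_eqF.
rewrite integral_sym_itv; last 2 first.
- apply: measurable_funM => //; apply: measurableT_comp => //.
  by apply: measurableT_comp => //; exact: measurable_funM.
- by move=> h; rewrite mulr_ge0 ?powR_ge0 ?expR_ge0.
pose h j (y : R) := (1 - y ^+ 2) `^ p * y ^+ j.*2.
pose c j : R := 2 * x ^+ j.*2 / (j.*2)`!%:R.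
pose H j : R := hGam n.*2.-1 * hGam j.*2.+1 / (2 * hGam (j + n).*2).
have cH j : c j * H j = hGam n.*2.-1 * Num.sqrt pi * (gcoef n.*2 j * (x ^+ 2 / 4) ^+ j).
  rewrite /c /H hGam_odd /gcoef doubleD expr_div_n -mul2n exprM.
  have j0 : (j`!%:R : R) != 0 by rewrite pnatr_eq0 -lt0n fact_gt0.
  have j20 : ((2 * j)`!%:R : R) != 0 by rewrite pnatr_eq0 -lt0n fact_gt0.
  have p4 : (4 ^+ j : R) != 0 by rewrite expf_eq0 pnatr_eq0 andbF.
  have g0 : hGam (2 * j + n.*2) != 0 :> R.
    by rewrite gt_eqF// hGam_gt0// addn_gt0 double_gt0 n0 orbT.
  by field; rewrite j0 j20 p4 g0.
have c0 j : 0 <= c j by rewrite !mulr_ge0 ?invr_ge0 ?exprn_ge0// ltW.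
have hE y : (fun j => c j * h j y) = fun j => (1 - y ^+ 2) `^ p *
    (2 * (x * y) ^+ j.*2 / (j.*2)`!%:R).
  by apply/funext => j; rewrite /c /h exprMn; ring.
have ch y : series (fun j => c j * h j y) @ \oo -->
    (1 - y ^+ 2) `^ p * (expR (- (x * y)) + expR (x * y)).
  rewrite hE (_ : series _ = fun N => (1 - y ^+ 2) `^ p *
    series (fun j => 2 * (x * y) ^+ j.*2 / (j.*2)`!%:R) N).
    by apply: cvgMr; exact: cvg_cosh_series.
  by apply/funext => N; rewrite /series/= mulr_sumr.
have cn : (fun j => `|c j|) = c by apply/funext => j; rewrite ger0_norm.
have [] := @integral_series _ _ R leb `]0, 1[%classic h c H.
- by [].
- move=> j; apply: measurable_funTS.
  apply: (@measurable_funM _ _ R setT (fun y : R => (1 - y ^+ 2) `^ p) (fun y => y ^+ j.*2)).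
    exact: mp.
  exact: measurable_funX.
- move=> j y /=; rewrite in_itv/= => /andP[y0 _].
  by rewrite mulr_ge0 ?powR_ge0// exprn_ge0// ltW.
- by move=> j; exact: beta_moment.
- rewrite (_ : (fun j => _) = (fun j => hGam n.*2.-1 * Num.sqrt pi * (gcoef n.*2 j * (x ^+ 2 / 4) ^+ j))).
    by apply: is_cvg_seriesZ; apply: (@cvg_hG R); rewrite double_gt0.
  by apply/funext => j; rewrite ger0_norm.
- move=> y _; rewrite (_ : (fun j => _) = (fun j => c j * h j y)).
    by apply/cvg_ex; exists ((1 - y ^+ 2) `^ p * (expR (- (x * y)) + expR (x * y))).
  by apply/funext => j; rewrite ger0_norm.
move=> _; rewrite (funext cH) limn_seriesMl; last first.
  by apply: (@cvg_hG R); rewrite double_gt0.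
move=> <-; apply: eq_integral => y _; congr EFin.
apply/esym/cvg_lim => //; apply: cvg_trans (ch y) _.
by rewrite sqrrN mulrN opprK; have -> : forall a b c : R, a * b + a * c = a * (c + b) by move=> *; ring.
Qed.

End BesselI2.

(** * Infinite products and partial fractions *)

Section WallisProduct.
Context {R : realType}.
Notation leb := (@lebesgue_measure R).

(** Wallis integrals weighted by a solution of C'' = kappa C. Their two-step recurrence in N,
    divided by that of the case C = 1, produces the factors of Euler's products for sinh and sin. *)
Definition wallis (C : R -> R) (N : nat) : R :=
  \int[leb]_(y in `[0, pi / 2]) (cos y ^+ N * C y).

Lemma pihalf_gt0 : 0 < pi / 2 :> R.
Proof. by rewrite divr_gt0// pi_gt0. Qed.

Lemma continuous_integrable_pihalf (f : R -> R) : continuous f ->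
  leb.-integrable `[0, pi / 2] (EFin \o f).
Proof.
move=> cf; apply: continuous_compact_integrable; first exact: segment_compact.
by apply: continuous_subspaceT.
Qed.

Lemma Rintegral_FTC (f F : R -> R) : continuous f -> (forall y, hasD F y (f y)) ->
  \int[leb]_(y in `[0, pi / 2]) f y = F (pi / 2) - F 0.
Proof.
move=> cf dF; rewrite /Rintegral (@continuous_FTC2 R f F _ _ pihalf_gt0)//.
- by apply: continuous_subspaceT.
- split; first by move=> y _; exact: hasD_derivable (dF y).
  + by apply: cvg_at_right_filter; exact: hasD_continuous (dF 0).
  + by apply: cvg_at_left_filter; exact: hasD_continuous (dF (pi / 2)).
- by move=> y _; exact: hasD_derive1 (dF y).
Qed.

Lemma half_le_sin (y : R) : 0 <= y <= pi / 2 -> y / 2 <= sin y.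
Proof.
move=> /andP[y0 ypi]; have pi0 := @pi_gt0 R.
have c2 : 2^-1 <= cos (y / 2) ^+ 2.
  have : cos y = cos (y / 2) ^+ 2 *+ 2 - 1.
    by rewrite -cos_mulr2n; congr cos; rewrite mulr2n; field.
  have : 0 <= cos y by apply: cos_ge0_pihalf; rewrite ypi andbT; lra.
  move=> h e; rewrite e in h; move: (cos _ ^+ 2) h => z; rewrite mulr2n => h; lra.
have c0 : 0 <= cos (y / 2) by apply: cos_ge0_pihalf; apply/andP; split; lra.
have h : y / 2 * cos (y / 2) <= sin (y / 2) by apply: xcos_le_sin; apply/andP; split; lra.
have -> : sin y = 2 * (cos (y / 2) * sin (y / 2)).
  by rewrite mulr_natl -sin_mulr2n; congr sin; rewrite mulr2n; field.
apply: (@le_trans _ _ (2 * (cos (y / 2) * (y / 2 * cos (y / 2))))); last first.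
  by rewrite ler_pM2l// ler_wpM2l.
move: c2; move: (cos (y / 2)) => c; nra.
Qed.

Section Product.
Variables (C S : R -> R) (kappa K : R).
Hypotheses (k0 : kappa != 0) (dC : forall y, hasD C y (S y))
  (dS : forall y, hasD S y (kappa * C y)) (C0 : C 0 = 1) (S0 : S 0 = 0).
Hypothesis CK : forall y, 0 <= y <= pi / 2 -> `|kappa * C y| <= 2 * K.

Let cC : continuous C. Proof. by move=> y; exact: hasD_continuous (dC y). Qed.

(** The bound 2K on the second derivative is integrated twice from C(0) = 1, C'(0) = 0. The sign [s]
    covers the upper and the lower estimate together. *)
Let quad (s : R) : `|s| = 1 -> forall y, 0 <= y <= pi / 2 -> s * (C y - 1) <= K * y ^+ 2.
Proof.
move=> s1 y /andP[y0 ypi].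
have S_le z : 0 <= z -> z <= pi / 2 -> s * S z <= 2 * K * z.
  move=> z0 zpi.
  suff : s * S z - 2 * K * z <= s * S 0 - 2 * K * 0 by rewrite S0 !mulr0 subr0 subr_le0.
  apply: (@nonincreasing_of_derive R (fun z => s * S z - 2 * K * z)
     (fun z => s * (kappa * C z) - 2 * K)) => [//|x _|x xz].
    by apply: (deq (dB (dM (dcst s x) (dS x)) (dM (dcst (2 * K) x) (did x)))); ring.
  rewrite subr_le0 (le_trans (ler_norm _))// normrM s1 mul1r CK// (itvP xz)/=.
  by rewrite (le_trans _ zpi)// (itvP xz).
suff : s * (C y - 1) - K * y ^+ 2 <= s * (C 0 - 1) - K * 0 ^+ 2.
  by rewrite C0 subrr expr0n/= !mulr0 subr0 subr_le0.
apply: (@nonincreasing_of_derive R (fun y => s * (C y - 1) - K * y ^+ 2)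
     (fun y => s * S y - 2 * K * y)) => [//|x _|x xz].
  apply: (deq (dB (dM (dcst s x) (dB (dC x) (dcst 1 x))) (dM (dcst K x) (dX 2 (did x))))).
  by rewrite /= expr1; ring.
by rewrite subr_le0 S_le ?(itvP xz)// (le_trans _ ypi)// (itvP xz).
Qed.

Let C1_le y : 0 <= y <= pi / 2 -> `|C y - 1| <= 4 * K * sin y ^+ 2.
Proof.
move=> yy; have K0 : 0 <= K by have := CK yy; have := normr_ge0 (kappa * C y); lra.
have h : y ^+ 2 <= 4 * sin y ^+ 2.
  have := half_le_sin yy; move: (sin y) => z; case/andP: yy => y0 _; nra.
apply: (@le_trans _ _ (K * y ^+ 2)); last by rewrite [4 * K]mulrC -mulrA ler_wpM2l.
rewrite ler_norml lerNl -[X in X <= _]mulN1r -[X in _ && (X <= _)]mul1r.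
by apply/andP; split; apply: quad => //; rewrite ?normrN normr1.
Qed.

Lemma wallis_rec (D E : R -> R) (l : R) (n : nat) : (forall y, hasD D y (E y)) ->
  (forall y, hasD E y (l * D y)) -> E 0 = 0 ->
  (n.+2%:R ^+ 2 + l) * wallis D n.+2 = (n.+2%:R * n.+1%:R) * wallis D n.
Proof.
move=> dD dE E0.
have cD : continuous D by move=> y; exact: hasD_continuous (dD y).
have cI N : continuous (fun y => cos y ^+ N * D y).
  by move=> y; exact: hasD_continuous (dM (dX N (dcos y)) (dD y)).
pose f y := n.+2%:R * n.+1%:R * (cos y ^+ n * D y) - (n.+2%:R ^+ 2 + l) * (cos y ^+ n.+2 * D y).
have cf : continuous f.
  move=> y; apply: (hasD_continuous (dB (dM (dcst (n.+2%:R * n.+1%:R) y)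
    (dM (dX n (dcos y)) (dD y))) (dM (dcst (n.+2%:R ^+ 2 + l) y) (dM (dX n.+2 (dcos y)) (dD y))))).
(* The boundary terms of two integrations by parts: they vanish at pi/2 through cos, and at 0
   through sin 0 = E 0 = 0. *)
pose F y := - n.+2%:R * (cos y ^+ n.+1 * sin y) * D y - cos y ^+ n.+2 * E y.
have dF y : hasD F y (f y).
  apply: (deq (dB (dM (dM (dcst (- n.+2%:R) y) (dM (dX n.+1 (dcos y)) (dsin y))) (dD y))
     (dM (dX n.+2 (dcos y)) (dE y)))).
  rewrite /f /= !exprS; have := sin2cos2 y; rewrite !expr2 => s2.
  transitivity (n.+2%:R * n.+1%:R * cos y ^+ n * (sin y * sin y) * D y
     - n.+2%:R * (cos y * (cos y * cos y ^+ n)) * D y - cos y * (cos y * cos y ^+ n) * (l * D y)).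
    by ring.
  by rewrite s2 -!natr1; ring.
have := Rintegral_FTC cf dF; rewrite /f RintegralB//; last 2 first.
- by apply: continuous_integrable_pihalf => y; exact: hasD_continuous (dM (dcst _ y) (dM (dX n (dcos y)) (dD y))).
- by apply: continuous_integrable_pihalf => y; exact: hasD_continuous (dM (dcst _ y) (dM (dX n.+2 (dcos y)) (dD y))).
rewrite !RintegralZl//; try exact: continuous_integrable_pihalf.
rewrite /F sin0 cos_pihalf E0 !expr0n/= !(mulr0, mul0r) subrr => h.
by apply/eqP; rewrite eq_sym -subr_eq0 h.
Qed.

Let one := (fun=> 1 : R) : R -> R.
Let zero := (fun=> 0 : R) : R -> R.

Let one_rec n : n.+2%:R ^+ 2 * wallis one n.+2 = n.+2%:R * n.+1%:R * wallis one n.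
Proof.
rewrite -(@wallis_rec one zero 0)//; first by rewrite addr0.
- by move=> y; exact: dcst.
- by move=> y; rewrite mul0r; exact: dcst.
Qed.

Let c1 : continuous one. Proof. exact: cst_continuous. Qed.

Let one0 : wallis one 0 = pi / 2.
Proof.
have := Rintegral_FTC c1 did; rewrite subr0 => <-.
by rewrite /wallis; congr Rintegral; apply/funext => y; rewrite expr0 mulr1.
Qed.

Let one_gt0 n : 0 < wallis one n.*2.
Proof.
elim: n => [|n IH]; first by rewrite double0 one0 pihalf_gt0.
rewrite doubleS -(pmulr_rgt0 _ (_ : 0 < n.*2.+2%:R ^+ 2)) ?exprn_gt0//.
by rewrite one_rec !mulr_gt0.
Qed.

(** The weight cos^(2n) concentrates at 0, where C = 1. Quantitatively |C - 1| <= 4K sin^2, and the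
    average of sin^2 under that weight is 1/(2n + 2) by the recurrence for C = 1; the rate used
    below has a spare factor 2. *)
Let ratio_cvg : wallis C n.*2 / wallis one n.*2 @[n --> \oo] --> (1 : R).
Proof.
have cI N (D : R -> R) : continuous D -> continuous (fun y : R => cos y ^+ N * D y).
  move=> cD y; apply: cvgM; last exact: cD.
  exact: hasD_continuous (dX N (dcos y)).
have int (D : R -> R) N : continuous D -> leb.-integrable `[0, pi / 2] (EFin \o (fun y => cos y ^+ N * D y)).
  by move=> cD; apply: continuous_integrable_pihalf; exact: cI.
have K0 : 0 <= K.
  have := CK (_ : 0 <= 0 <= pi / 2); rewrite lexx ltW ?pihalf_gt0// => /(_ isT).
  by have := normr_ge0 (kappa * C 0); lra.
have le n : `|wallis C n.*2 / wallis one n.*2 - 1| <= 4 * K * n.+1%:R^-1.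
  have w0 := one_gt0 n.
  have -> : wallis C n.*2 / wallis one n.*2 - 1 =
      (wallis C n.*2 - wallis one n.*2) / wallis one n.*2.
    by rewrite mulrBl divff// gt_eqF.
  rewrite normrM (@gtr0_norm _ (_^-1)) ?invr_gt0// ler_pdivrMr//.
  have -> : wallis C n.*2 - wallis one n.*2 =
      \int[leb]_(y in `[0, pi / 2]) (cos y ^+ n.*2 * (C y - 1)).
    rewrite /wallis -RintegralB//; [|exact: int|exact: int].
    by congr Rintegral; apply/funext => y; rewrite mulrBr.
  have cC1 : continuous (fun y => C y - 1).
    by move=> y; exact: hasD_continuous (dB (dC y) (dcst 1 y)).
  apply: le_trans (le_normr_Rintegral _ _) _ => //; first exact: int.
  have -> : 4 * K / n.+1%:R * wallis one n.*2 =
      \int[leb]_(y in `[0, pi / 2]) (8 * K * (cos y ^+ n.*2 * one y - cos y ^+ n.*2.+2 * one y)).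
    rewrite RintegralZl//; last first.
      apply: continuous_integrable_pihalf => y; apply: cvgB; exact: cI.
    rewrite RintegralB//; [|exact: int|exact: int].
    rewrite -!/(wallis one _); have := one_rec n.*2; have -> : n.*2.+2%:R = 2 * n.+1%:R :> R.
      by rewrite -natrM mul2n doubleS.
    have -> : n.*2.+1%:R = 2 * n.+1%:R - 1 :> R.
      by rewrite -!natr1 -muln2 natrM; ring.
    have n0 : n.+1%:R != 0 :> R by rewrite pnatr_eq0.
    move: (wallis one n.*2.+2) (wallis one n.*2) => a b ab.
    have -> : a = (2 * n.+1%:R * (2 * n.+1%:R - 1)) * b / (2 * n.+1%:R) ^+ 2.
      by rewrite -ab mulrC mulKf// expf_neq0// mulf_neq0.
    by field.
  apply: le_Rintegral => //.
  - apply: continuous_integrable_pihalf => y; apply: (@continuous_comp _ _ _ (fun y => cos y ^+ n.*2 * (C y - 1)) (fun z => `|z|)).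
      exact: cI.
    exact: norm_continuous.
  - apply: continuous_integrable_pihalf => y; apply: cvgM; first exact: cvg_cst.
    by apply: cvgB; exact: cI.
  - move=> y /=; rewrite in_itv/= => yy; rewrite normrM ger0_norm ?exprn_even_ge0 ?odd_double//.
    have c0 : 0 <= cos y ^+ n.*2 by rewrite exprn_even_ge0// odd_double.
    have := C1_le yy; have -> : cos y ^+ n.*2.+2 = cos y ^+ n.*2 * cos y ^+ 2.
      by rewrite -exprD addn2.
    have s0 : 0 <= sin y ^+ 2 by rewrite exprn_even_ge0.
    rewrite cos2sin2 /one; move: c0 s0; move: (cos y ^+ n.*2) (sin y ^+ 2) `|C y - 1|.
    move=> z q w z0 q0 wle; apply: (le_trans (ler_wpM2l z0 wle)).
    have : 0 <= 4 * K * (z * q) by rewrite !mulr_ge0.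
    lra.
apply/cvgrPdist_le => e e0.
near=> n; rewrite distrC; apply: le_trans (le n) _.
rewrite ler_pdivrMr// -ler_pdivrMl//.
apply: (@le_trans _ _ n%:R); last by rewrite ler_nat.
by near: n; exact: nbhs_infty_ger.
Unshelve. all: by end_near. Qed.

(** [pE] is exact: the N-th partial product times the quotient of Wallis integrals is constant in N,
    and at N = 0 it is computed from the primitive S/kappa of C. The quotient tends to 1. *)
Lemma wallis_product :
  \prod_(k < N) (1 + kappa / (2 * k.+1%:R) ^+ 2) @[N --> \oo] -->
    S (pi / 2) / (kappa * (pi / 2)).
Proof.
have pE N : \prod_(k < N) (1 + kappa / (2 * k.+1%:R) ^+ 2) * (wallis C N.*2 / wallis one N.*2) =
    S (pi / 2) / (kappa * (pi / 2)).
  elim: N => [|N IH].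
    have e x : x != 0 -> S (pi / 2) / (kappa * x) = (kappa^-1 * S (pi / 2)) / x.
      by move=> x0; field; rewrite k0 x0.
    rewrite big_ord0 mul1r one0 e ?(gt_eqF pihalf_gt0)//; congr (_ / _).
    have dSk y : hasD (fun y => kappa^-1 * S y) y (C y).
      apply: (deq (dM (dcst kappa^-1 y) (dS y))); by rewrite mul0r add0r mulrA mulVf// mul1r.
    have := Rintegral_FTC cC dSk; rewrite S0 mulr0 subr0 => <-.
    by apply: eq_Rintegral => y _; rewrite expr0 mul1r.
  rewrite -IH big_ord_recr/= -mulrA; congr (_ * _).
  have n0 : (2 * N.+1%:R : R) != 0 by rewrite mulf_neq0// pnatr_eq0.
  have n2 : N.*2.+2%:R = 2 * N.+1%:R :> R by rewrite -natrM mul2n doubleS.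
  have := wallis_rec N.*2 dC dS S0; have := one_rec N.*2; have := one_gt0 N.
  have := one_gt0 N.+1; rewrite doubleS n2.
  set w := wallis C _; set w' := wallis C _; set o := wallis one _; set o' := wallis one _.
  move=> o0 o'0 Ho Hw.
  have Ho' : o' = (2 * N.+1%:R) ^+ 2 * o / (2 * N.+1%:R * N.*2.+1%:R).
    by rewrite Ho mulrC mulKf// mulf_neq0// pnatr_eq0.
  have Hw' : w' = ((2 * N.+1%:R) ^+ 2 + kappa) * w / (2 * N.+1%:R * N.*2.+1%:R).
    by rewrite Hw mulrC mulKf// mulf_neq0// pnatr_eq0.
  rewrite Hw' Ho'; have m0 : (N.*2.+1%:R : R) != 0 by rewrite pnatr_eq0.
  move: (2 * N.+1%:R : R) (N.*2.+1%:R : R) n0 m0 => a b a0 b0.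
  by field; rewrite a0 b0 (gt_eqF o0).
have nz : \forall N \near \oo, wallis C N.*2 / wallis one N.*2 != 0.
  have := ratio_cvg => /cvgr_neq0; apply; exact: oner_neq0.
have lim : S (pi / 2) / (kappa * (pi / 2)) / (wallis C n.*2 / wallis one n.*2) @[n --> \oo]
   --> S (pi / 2) / (kappa * (pi / 2)) / 1.
  by apply: cvgM; [exact: cvg_cst|apply: cvgV => //; exact: oner_neq0].
rewrite divr1 in lim; apply: cvg_trans lim; apply: near_eq_cvg.
near=> N; rewrite -(pE N) mulfK//; near: N; exact: nz.
Unshelve. all: by end_near. Qed.

End Product.
End WallisProduct.

(** * Euler products and the partial fractions of coth, cot and [mu] *)

Section PartialFractions.
Context {R : realType}.
Implicit Types (x y s : R).

Definition pole (k : nat) : R := (pi * k.+1%:R) ^+ 2.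

Lemma pole_gt0 k : 0 < pole k.
Proof. by rewrite exprn_gt0// mulr_gt0// pi_gt0. Qed.

Lemma pole_ge k : pi ^+ 2 <= pole k.
Proof.
rewrite /pole exprMn ler_peMr ?exprn_ge0 ?pi_ge0// exprn_ege1//.
by rewrite ler1n.
Qed.

Lemma sqr_lt_pole x k : 0 < x < pi -> x ^+ 2 < pole k.
Proof.
move=> /andP[x0 xpi]; apply: lt_le_trans (pole_ge k).
by rewrite ltr_pXn2r// ?nnegrE ?pi_ge0// ltW.
Qed.

Lemma dsinh x : hasD (@sinh R) x (cosh x).
Proof.
apply: (deq (dM (dB (dexp x) (dcomp (dexp _) (dN (did x)))) (dcst 2^-1 x))).
by rewrite /cosh mulr0 addr0 mulrN1 opprK.
Qed.

Lemma dcosh x : hasD (@cosh R) x (sinh x).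
Proof.
apply: (deq (dM (dD (dexp x) (dcomp (dexp _) (dN (did x)))) (dcst 2^-1 x))).
by rewrite /sinh mulr0 addr0 mulrN1.
Qed.

Lemma sinh_gt0 s : 0 < s -> 0 < sinh s.
Proof. by move=> s0; rewrite divr_gt0// subr_gt0 ltr_expR; lra. Qed.

Lemma cosh_gt0 s : 0 < cosh s.
Proof. by rewrite divr_gt0// addr_gt0// expR_gt0. Qed.

Lemma dscale (f : R -> R) a x b : hasD f (a * x) b -> hasD (fun y => f (a * y)) x (a * b).
Proof.
move=> fb; apply: (deq (dcomp (g := fun y => a * y) fb (dM (dcst a x) (did x)))).
by rewrite mul0r add0r mulr1 mulrC.
Qed.

Lemma sinh_product s : 0 < s ->
  \prod_(k < N) (1 + s ^+ 2 / pole k) @[N --> \oo] --> sinh s / s.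
Proof.
move=> s0; have pi0 := @pi_gt0 R; pose a := 2 * s / pi.
have a0 : 0 < a by rewrite divr_gt0// mulr_gt0.
have sa : a * (pi / 2) = s.
  by rewrite /a; move: (pi : R) pi0 => p p0; field; exact: lt0r_neq0.
have := @wallis_product R (fun y => cosh (a * y)) (fun y => a * sinh (a * y)) (a ^+ 2)
  (a ^+ 2 * expR s).
have -> : a * sinh (a * (pi / 2)) / (a ^+ 2 * (pi / 2)) = sinh s / s.
  by rewrite sa -{3}sa; move: (pi : R) pi0 => p p0; field; rewrite !gt_eqF.
have -> : (fun N => \prod_(k < N) (1 + a ^+ 2 / (2 * k.+1%:R) ^+ 2)) =
    (fun N => \prod_(k < N) (1 + s ^+ 2 / pole k)).
  apply/funext => N; apply: eq_bigr => k _; rewrite /pole /a.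
  have : (k.+1%:R : R) != 0 by rewrite pnatr_eq0.
  by move: (k.+1%:R : R) (pi : R) pi0 => K p p0 K0; field; rewrite K0 gt_eqF.
apply.
- by rewrite expf_neq0// gt_eqF.
- by move=> y; apply: dscale; exact: dcosh.
- move=> y; apply: (deq (dM (dcst a y) (dscale (dsinh (a * y))))); ring.
- by rewrite mulr0 /cosh oppr0 expR0; field.
- by rewrite mulr0 /sinh oppr0 subrr mul0r mulr0.
- move=> y /andP[y0 ypi]; rewrite ger0_norm; last by rewrite mulr_ge0 ?exprn_ge0 ?(ltW a0) ?(ltW (cosh_gt0 _)).
  rewrite [leRHS]mulrCA ler_pM2l ?exprn_gt0//.
  have ays : a * y <= s by rewrite -sa ler_pM2l.
  have e1 : expR (a * y) <= expR s by rewrite ler_expR.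
  have e2 : expR (- (a * y)) <= expR s.
    by rewrite ler_expR (le_trans _ ays)// ge0_cp// mulr_ge0// ltW.
  rewrite /cosh; have := expR_gt0 s; lra.
Qed.

Lemma sin_product x : 0 < x ->
  \prod_(k < N) (1 - x ^+ 2 / pole k) @[N --> \oo] --> sin x / x.
Proof.
move=> s0; have pi0 := @pi_gt0 R; pose a := 2 * x / pi.
have a0 : 0 < a by rewrite divr_gt0// mulr_gt0.
have sa : a * (pi / 2) = x.
  by rewrite /a; move: (pi : R) pi0 => p p0; field; exact: lt0r_neq0.
have := @wallis_product R (fun y => cos (a * y)) (fun y => - a * sin (a * y)) (- a ^+ 2)
  (a ^+ 2).
have -> : - a * sin (a * (pi / 2)) / (- a ^+ 2 * (pi / 2)) = sin x / x.
  by rewrite sa -{3}sa; move: (pi : R) pi0 => p p0; field; rewrite !gt_eqF.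
have -> : (fun N => \prod_(k < N) (1 + - a ^+ 2 / (2 * k.+1%:R) ^+ 2)) =
    (fun N => \prod_(k < N) (1 - x ^+ 2 / pole k)).
  apply/funext => N; apply: eq_bigr => k _; rewrite /pole /a.
  have : (k.+1%:R : R) != 0 by rewrite pnatr_eq0.
  by move: (k.+1%:R : R) (pi : R) pi0 => K p p0 K0; field; rewrite K0 gt_eqF.
apply.
- by rewrite oppr_eq0 expf_neq0// gt_eqF.
- by move=> y; apply: (deq (dscale (dcos (a * y)))); ring.
- move=> y; apply: (deq (dM (dcst (- a) y) (dscale (dsin (a * y))))); ring.
- by rewrite mulr0 cos0.
- by rewrite mulr0 sin0 mulr0.
- move=> y _; rewrite normrM normrN (ger0_norm (exprn_ge0 _ (ltW a0))) mulrC.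
  rewrite ler_pM2r ?exprn_gt0// (le_trans (cos_max _))//.
  by rewrite ler1n.
Qed.

(** [L] is the derivative of G with respect to x^2. The lemma yields one test point on each side of
    x for the squeeze in [convex_slope_cvg]. *)
Lemma derive_quotient_near (G : R -> R) (x l r L e : R) : l < x < r -> 0 < x -> 0 < e ->
  hasD G x (2 * x * L) -> 0 <= l ->
  (exists2 y, x < y < r & `|(G y - G x) / (y ^+ 2 - x ^+ 2) - L| <= e) /\
  (exists2 y, l < y < x & `|(G y - G x) / (y ^+ 2 - x ^+ 2) - L| <= e).
Proof.
move=> /andP[lx xr] x0 e0 [dG GE] l0.
have /is_derive1_caratheodory[g [gE cg gx]] : is_derive x (1 : R) G (2 * x * L) by split.
have cq : {for x, continuous (fun y => g y / (y + x))}.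
  apply: continuousM => //; apply: continuousV; first by rewrite gt_eqF ?addr_gt0.
  exact: hasD_continuous (dD (did x) (dcst x x)).
have Lx : g x / (x + x) = L.
  have -> : x + x = 2 * x by ring.
  by rewrite gx mulrAC divff ?mul1r// mulf_neq0// gt_eqF.
move: cq => /cvgrPdist_le /(_ e e0); rewrite Lx => -[d /= d0 hd].
have quot y : 0 < y -> y != x -> `|x - y| < d ->
    `|(G y - G x) / (y ^+ 2 - x ^+ 2) - L| <= e.
  move=> y0 yx yd; rewrite distrC; have -> : (G y - G x) / (y ^+ 2 - x ^+ 2) = g y / (y + x).
    by rewrite gE subr_sqr; field; rewrite subr_eq0 yx gt_eqF ?addr_gt0.
  exact: hd.
split.
- pose t := Num.min (d / 2) ((r - x) / 2).
  have t0 : 0 < t by rewrite lt_min !divr_gt0// subr_gt0.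
  have td : t <= d / 2 by rewrite ge_min lexx.
  have tr : t <= (r - x) / 2 by rewrite ge_min lexx orbT.
  exists (x + t); first by apply/andP; split; lra.
  apply: quot; [lra|by rewrite gt_eqF// ltrDl|].
  by rewrite opprD addNKr normrN gtr0_norm//; lra.
- pose t := Num.min (d / 2) ((x - l) / 2).
  have t0 : 0 < t by rewrite lt_min !divr_gt0// subr_gt0.
  have td : t <= d / 2 by rewrite ge_min lexx.
  have tr : t <= (x - l) / 2 by rewrite ge_min lexx orbT.
  exists (x - t); first by apply/andP; split; lra.
  apply: quot; [lra|by rewrite lt_eqF// gtrBl|].
  by rewrite opprB addrCA subrr addr0 gtr0_norm//; lra.
Qed.

(** Termwise differentiation without uniform convergence. Each [g k] lies above its tangent of slope
    [d k] in the variable y^2, so the sum of slopes is squeezed between secant slopes of the partial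
    sums on both sides of x, and these converge to secant slopes of [G]. *)
Lemma convex_slope_cvg (g : nat -> R -> R) (d : nat -> R) (G : R -> R) (x l r L : R) :
  0 <= l -> l < x < r ->
  (forall k y, l < y < r -> d k * (y ^+ 2 - x ^+ 2) <= g k y - g k x) ->
  (forall y, l < y < r -> \sum_(k < N) g k y @[N --> \oo] --> G y) ->
  hasD G x (2 * x * L) ->
  \sum_(k < N) d k @[N --> \oo] --> L.
Proof.
move=> l0 lxr slope cG dG; have /andP[lx xr] := lxr; have x0 := le_lt_trans l0 lx.
have slopeN N y : l < y < r -> (\sum_(k < N) d k) * (y ^+ 2 - x ^+ 2) <=
    \sum_(k < N) g k y - \sum_(k < N) g k x.
  by move=> ly; rewrite mulr_suml -sumrB; apply: ler_sum => k _; exact: slope.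
have cGx y : l < y < r ->
    (\sum_(k < N) g k y - \sum_(k < N) g k x) / (y ^+ 2 - x ^+ 2) @[N --> \oo] -->
    (G y - G x) / (y ^+ 2 - x ^+ 2).
  by move=> ly; apply: cvgM; [apply: cvgB; exact: cG|exact: cvg_cst].
apply/cvgrPdist_le => e e0; have e20 : 0 < e / 2 by rewrite divr_gt0.
have [[y /andP[xy yr] hy] [z /andP[lz zx] hz]] := derive_quotient_near lxr x0 e20 dG l0.
have yl : l < y < r by rewrite yr (lt_trans lx).
have zl : l < z < r by rewrite lz (lt_trans zx).
have yx : 0 < y ^+ 2 - x ^+ 2 by rewrite subr_gt0 ltr_pXn2r// ?nnegrE; lra.
have zx2 : 0 < x ^+ 2 - z ^+ 2 by rewrite subr_gt0 ltr_pXn2r// ?nnegrE; lra.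
have /cvgrPdist_le/(_ _ e20) ny := cGx y yl.
have /cvgrPdist_le/(_ _ e20) nz := cGx z zl.
near=> N.
have my : `|(G y - G x) / (y ^+ 2 - x ^+ 2) -
  (\sum_(k < N) g k y - \sum_(k < N) g k x) / (y ^+ 2 - x ^+ 2)| <= e / 2 by near: N.
have mz : `|(G z - G x) / (z ^+ 2 - x ^+ 2) -
  (\sum_(k < N) g k z - \sum_(k < N) g k x) / (z ^+ 2 - x ^+ 2)| <= e / 2 by near: N.
have up : \sum_(k < N) d k <= (\sum_(k < N) g k y - \sum_(k < N) g k x) / (y ^+ 2 - x ^+ 2).
  by rewrite ler_pdivlMr// slopeN.
have lo : (\sum_(k < N) g k z - \sum_(k < N) g k x) / (z ^+ 2 - x ^+ 2) <= \sum_(k < N) d k.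
  by rewrite ler_ndivrMr ?slopeN// -oppr_gt0 opprB.
move: my mz hy hz up lo; rewrite !ler_norml.
move: ((_ - _) / (y ^+ 2 - _)) ((_ - _) / (z ^+ 2 - _)) ((G y - G x) / _) ((G z - G x) / _).
move: (\sum_(k < N) d k) => A B C D E.
move=> /andP[? ?] /andP[? ?] /andP[? ?] /andP[? ?] ? ?.
by apply/andP; split; lra.
Unshelve. all: by end_near. Qed.

Lemma ln_prod_cvg (u : nat -> R) (l : R) : (forall k, 0 < u k) -> 0 < l ->
  \prod_(k < N) u k @[N --> \oo] --> l -> \sum_(k < N) ln (u k) @[N --> \oo] --> ln l.
Proof.
move=> u0 l0 cu.
have -> : (fun N => \sum_(k < N) ln (u k)) = (fun N => ln (\prod_(k < N) u k)).
  apply/funext; elim => [|N IH]; first by rewrite !big_ord0 ln1.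
  by rewrite !big_ord_recr/= IH lnM ?posrE// prodr_gt0.
by apply: continuous_cvg cu; exact: continuous_ln.
Qed.

Lemma ln_ratio_le (a b : R) : 0 < a -> 0 < b -> ln b - ln a <= (b - a) / a.
Proof.
move=> a0 b0; rewrite -ln_div ?posrE//.
have -> : b / a = 1 + (b - a) / a by field; rewrite gt_eqF.
by apply: le_ln1Dx; rewrite mulrBl divff ?gt_eqF// ltrDr divr_gt0.
Qed.

(** Logarithmic derivative of the sinh product with respect to s^2. The signs are reversed because
    -ln(1 + y^2/c) is the convex function of y^2. *)
Lemma coth_sum s : 0 < s ->
  \sum_(k < N) (pole k + s ^+ 2)^-1 @[N --> \oo] --> (s * coth s - 1) / (2 * s ^+ 2).
Proof.
move=> s0; have ss := sinh_gt0 s0.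
pose g k y : R := - ln (1 + y ^+ 2 / pole k).
pose G y : R := - ln (sinh y / y).
have p1 k y : 0 < 1 + y ^+ 2 / pole k.
  by rewrite ltr_pwDl// divr_ge0 ?exprn_even_ge0// ltW ?pole_gt0.
suff : \sum_(k < N) - (pole k + s ^+ 2)^-1 @[N --> \oo] --> - ((s * coth s - 1) / (2 * s ^+ 2)).
  move=> h; rewrite -[X in _ --> X]opprK.
  have -> : (fun N => \sum_(k < N) (pole k + s ^+ 2)^-1) =
      (fun N => - \sum_(k < N) - (pole k + s ^+ 2)^-1).
    by apply/funext => N; rewrite sumrN opprK.
  exact: cvgN.
apply: (@convex_slope_cvg g (fun k => - (pole k + s ^+ 2)^-1) G s 0 (s + 1)) => //.
- by rewrite s0/= ltrDl.
- move=> k y _; have := ln_ratio_le (p1 k s) (p1 k y); rewrite /g.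
  have c0 := pole_gt0 k; have cs : 0 < pole k + s ^+ 2 by rewrite addr_gt0// exprn_gt0.
  have -> : (1 + y ^+ 2 / pole k - (1 + s ^+ 2 / pole k)) / (1 + s ^+ 2 / pole k) =
      (pole k + s ^+ 2)^-1 * (y ^+ 2 - s ^+ 2).
    by move: (pole k) c0 cs => c c0 cs; field; rewrite !gt_eqF.
  by rewrite mulNr; move: (_ * _) (ln _) (ln _) => A B C; lra.
- move=> y /andP[y0 _]; rewrite /g /G; under eq_fun do rewrite sumrN; apply: cvgN.
  apply: (@ln_prod_cvg (fun k => 1 + y ^+ 2 / pole k)); [by move=> k; exact: p1|by rewrite divr_gt0 ?sinh_gt0|exact: sinh_product].
- have d0 : 0 < sinh s / s by rewrite divr_gt0.
  apply: (deq (dN (dcomp (g := fun y => sinh y / y) (dln d0) (dM (dsinh s) (dV (lt0r_neq0 s0) (did s)))))).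
  by rewrite /coth; field; rewrite !gt_eqF.
Unshelve. all: by end_near. Qed.

Lemma cot_sum x : 0 < x < pi ->
  \sum_(k < N) (pole k - x ^+ 2)^-1 @[N --> \oo] -->
    (1 - x * cos x / sin x) / (2 * x ^+ 2).
Proof.
move=> xpi; have /andP[x0 _] := xpi; have sx := sin_gt0_pi xpi.
pose g k y : R := - ln (1 - y ^+ 2 / pole k).
pose G y : R := - ln (sin y / y).
have p1 k y : 0 < y < pi -> 0 < 1 - y ^+ 2 / pole k.
  by move=> ypi; rewrite subr_gt0 ltr_pdivrMr ?pole_gt0// mul1r sqr_lt_pole.
apply: (@convex_slope_cvg g (fun k => (pole k - x ^+ 2)^-1) G x 0 pi) => //.
- move=> k y ypi; have := ln_ratio_le (p1 k x xpi) (p1 k y ypi); rewrite /g.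
  have c0 := pole_gt0 k; have cs : 0 < pole k - x ^+ 2 by rewrite subr_gt0 sqr_lt_pole.
  have -> : (1 - y ^+ 2 / pole k - (1 - x ^+ 2 / pole k)) / (1 - x ^+ 2 / pole k) =
      - ((pole k - x ^+ 2)^-1 * (y ^+ 2 - x ^+ 2)).
    by move: (pole k) c0 cs => c c0 cs; field; rewrite !gt_eqF.
  by move: (_ * _) (ln _) (ln _) => A B C; lra.
- move=> y ypi; have /andP[y0 _] := ypi.
  rewrite /g /G; under eq_fun do rewrite sumrN; apply: cvgN.
  apply: (@ln_prod_cvg (fun k => 1 - y ^+ 2 / pole k)); [by move=> k; exact: p1| |exact: sin_product].
  by rewrite divr_gt0 ?sin_gt0_pi.
- have d0 : 0 < sin x / x by rewrite divr_gt0.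
  apply: (deq (dN (dcomp (g := fun y => sin y / y) (dln d0) (dM (dsin x) (dV (lt0r_neq0 x0) (did x)))))).
  by field; rewrite !gt_eqF.
Qed.

(** One more differentiation in x^2, applied to x^2 times [cot_sum]. The term c/(c - x^2)^2 is, up
    to the factor u/2, the mean of the compound Poisson part of one variable tilted by x^2; at
    mu(theta) = 4v/u the total is v/(2 theta). *)
Lemma mu_sum x : 0 < x < pi ->
  \sum_(k < N) (pole k / (pole k - x ^+ 2) ^+ 2) @[N --> \oo] --> mu x / (4 * x).
Proof.
move=> xpi; have /andP[x0 _] := xpi; have sx := sin_gt0_pi xpi.
pose g k y : R := y ^+ 2 / (pole k - y ^+ 2).
pose G y : R := (1 - y * cos y / sin y) / 2.
apply: (@convex_slope_cvg g (fun k => pole k / (pole k - x ^+ 2) ^+ 2) G x 0 pi) => //.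
- move=> k y ypi; have c0 := pole_gt0 k.
  have cx : 0 < pole k - x ^+ 2 by rewrite subr_gt0 sqr_lt_pole.
  have cy : 0 < pole k - y ^+ 2 by rewrite subr_gt0 sqr_lt_pole.
  rewrite -subr_ge0 /g.
  have -> : y ^+ 2 / (pole k - y ^+ 2) - x ^+ 2 / (pole k - x ^+ 2) -
     pole k / (pole k - x ^+ 2) ^+ 2 * (y ^+ 2 - x ^+ 2) =
     pole k * (y ^+ 2 - x ^+ 2) ^+ 2 / ((pole k - x ^+ 2) ^+ 2 * (pole k - y ^+ 2)).
    by field; rewrite !gt_eqF.
  by apply: divr_ge0; apply: mulr_ge0; rewrite ?exprn_even_ge0 ?(ltW c0) ?(ltW cy).
- move=> y ypi; have /andP[y0 _] := ypi.
  have -> : G y = y ^+ 2 * ((1 - y * cos y / sin y) / (2 * y ^+ 2)).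
    by rewrite /G; field; rewrite !gt_eqF ?sin_gt0_pi.
  rewrite /g; under eq_fun do rewrite -mulr_sumr.
  by apply: cvgMr; exact: cot_sum.
- apply: (deq (dM (dB (dcst 1 x) (dM (dM (did x) (dcos x)) (dV (lt0r_neq0 sx) (dsin x)))) (dcst 2^-1 x))).
  have -> : mu x = (x - sin x * cos x) / sin x ^+ 2.
    have -> : mu x = (2 * x - 2 * (cos x * sin x)) / (2 * sin x ^+ 2).
      have s2 : sin (2 * x) = 2 * (cos x * sin x) by rewrite !mulr_natl sin_mulr2n.
      by rewrite /mu s2.
    by move: (sin x) (cos x) sx => S C S0; field; rewrite gt_eqF.
  have c2 := cos2sin2 x.
  move: (sin x) (cos x) sx c2 => S C S0 C2.
  transitivity ((- C * S + x * (S ^+ 2 + C ^+ 2)) / (2 * S ^+ 2)).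
    by field; rewrite gt_eqF.
  by rewrite C2; field; rewrite !gt_eqF.
Qed.

End PartialFractions.

(** * Subordination of the heat kernel *)

Section ProductMeasure.
Context d1 d2 (T1 : measurableType d1) (T2 : measurableType d2) (R : realType).
Variable m1 : {sigma_finite_measure set T1 -> \bar R}.
Variable m2 : {sigma_finite_measure set T2 -> \bar R}.

Lemma sigma_finite_product : sigma_finite setT (m1 \x m2)%E.
Proof.
have [F FT mF] := sigma_finiteT m1; have [G GT mG] := sigma_finiteT m2.
exists (fun k => let p := odflt (0, 0)%N (unpickle k) in F p.1 `*` G p.2).
  apply/seteqP; split => // -[x y] _.
  have [i _ Fi] : (\bigcup_k F k) x by rewrite -FT.
  have [j _ Gj] : (\bigcup_k G k) y by rewrite -GT.
  by exists (pickle (i, j)) => //=; rewrite pickleK.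
move=> k; set p := odflt _ _; have [mFp Fp] := mF p.1; have [mGp Gp] := mG p.2.
split; first exact: measurableX.
by rewrite product_measure1E// lte_mul_pinfty// ge0_fin_numE.
Qed.

(** The packing lets [law_exists] add one variable at a time and apply Fubini to iterated
    products. *)
Definition prod_sigma_finite : {sigma_finite_measure set (T1 * T2)%type -> \bar R} :=
  HB.pack (m1 \x m2)%E (Measure_isSigmaFinite.Build _ _ _ (m1 \x m2)%E sigma_finite_product).
End ProductMeasure.

(** * The law attached to one pole, and finite sums of such variables *)

Section Density.
Context {R : realType}.
Notation leb := (@lebesgue_measure R).
Variable n : nat.
Hypothesis n0 : (0 < n)%N.

(* Density of a compound Poisson sum (rate u / 2) of exponential variables of
   rate c plus an independent Gamma(n, c) variable. *)
Definition dens (u c t : R) : R :=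
  expR (- (u / 2)) * c ^+ n * t ^+ n.-1 * expR (- (c * t)) * hG n.*2 (u * c * t / 2).

(** The moment generating function of [dens u c] at l < c. It is used at l = -s^2 for the heat
    kernel and at l = theta^2 for the tilt. *)
Definition lap (u c l : R) : R := expR (u / 2 * (l / (c - l))) * (c / (c - l)) ^+ n.

Lemma lap_gt0 u c l : 0 < c -> l < c -> 0 < lap u c l.
Proof.
by move=> c0 lc; rewrite mulr_gt0 ?expR_gt0// exprn_gt0// divr_gt0// subr_gt0.
Qed.

Lemma integral_pow_exp (N : nat) (mu : R) : 0 < mu ->
  (\int[leb]_(t in `]0%R, +oo[) (t ^+ N * expR (- (mu * t)))%:E)%E =
  (N`!%:R / mu ^+ N.+1)%:E.
Proof.
move=> mu0; have := eGamma_scale N.+1%:R mu0.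
have -> : eGamma N.+1%:R = (N`!%:R)%:E :> \bar R.
  have -> : (N`!%:R : R) = hGam N.+1.*2 by rewrite hGam_fact.
  have -> : N.+1%:R = N.+1.*2%:R / 2 :> R by rewrite -muln2 natrM mulfK.
  exact: eGammaE.
rewrite powR_mulrn ?(ltW mu0)// => E.
have m0 : 0 < mu ^+ N.+1 by rewrite exprn_gt0.
rewrite mulrC EFinM E muleA -EFinM mulVf ?gt_eqF// mul1e.
apply: eq_integral => t; rewrite inE/= in_itv/= andbT => t0.
by rewrite -natr1 addrK powR_mulrn// ltW.
Qed.

Lemma dens_ge0 u c t : 0 <= u -> 0 < c -> 0 <= t -> 0 <= dens u c t.
Proof.
move=> u0 c0 t0; have cc := ltW c0.
rewrite /dens !mulr_ge0 ?expR_ge0 ?exprn_ge0// ltW// hG_gt0 ?double_gt0//.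
by rewrite divr_ge0// !mulr_ge0.
Qed.

Lemma continuous_dens u c : continuous (dens u c).
Proof.
move=> t; apply: (hasD_continuous (dM (dM (dM (dcst _ t) (dX n.-1 (did t)))
  (dcomp (g := fun t => - (c * t)) (dexp _) (dN (dM (dcst c t) (did t)))))
  (dcomp (g := fun t => u * c * t / 2) (dhG _ (_ : 0 < n.*2)%N)
    (dM (dM (dcst (u * c) t) (did t)) (dcst 2^-1 t))))).
by rewrite double_gt0.
Qed.

(** Expanding [hG] exhibits a Poisson mixture of Gamma laws of order j + n. The factorial (j + n -
    1)! cancels against [gcoef] and an exponential series remains. *)
Lemma dens_laplace u c l : 0 <= u -> 0 < c -> l < c ->
  (\int[leb]_(t in `]0%R, +oo[) (dens u c t * expR (l * t))%:E)%E = (lap u c l)%:E.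
Proof.
move=> u0 c0 lc; have cl : 0 < c - l by rewrite subr_gt0.
pose h j (t : R) := t ^+ (j + n.-1) * expR (- ((c - l) * t)).
pose x j : R := expR (- (u / 2)) * c ^+ n * (gcoef n.*2 j * (u * c / 2) ^+ j).
pose H j : R := (j + n.-1)`!%:R / (c - l) ^+ (j + n.-1).+1.
have jn j : (j + n.-1).+1 = (j + n)%N by rewrite -addnS prednK.
have xH j : x j * H j = expR (- (u / 2)) * (c / (c - l)) ^+ n *
    exp_coeff (u / 2 * (c / (c - l))) j.
  have hg : hGam (j.*2 + n.*2) = (j + n.-1)`!%:R :> R.
    by rewrite -doubleD -jn hGam_fact.
  rewrite /x /H /gcoef exp_coeffE hg jn.
  have -> : u / 2 * (c / (c - l)) = (u * c / 2) / (c - l).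
    by field; rewrite gt_eqF.
  rewrite !expr_div_n exprD.
  have f1 : ((j + n.-1)`!%:R : R) != 0 by rewrite pnatr_eq0 -lt0n fact_gt0.
  have f2 : (j`!%:R : R) != 0 by rewrite pnatr_eq0 -lt0n fact_gt0.
  have f3 k : (c - l) ^+ k != 0 by rewrite expf_neq0// gt_eqF.
  have f4 : (2 ^+ j : R) != 0 by rewrite expf_neq0.
  move: ((j + n.-1)`!%:R : R) (j`!%:R : R) (2 ^+ j : R) f1 f2 f4 => A B D A0 B0 D0.
  move: ((c - l) ^+ j) ((c - l) ^+ n) (f3 j) (f3 n) ((u * c) ^+ j) => I J I0 J0 C.
  by field; rewrite A0 B0 D0 I0 J0.
have x0 j : 0 <= x j.
  have g0 : (0 : R) < gcoef n.*2 j by apply: gcoef_gt0; rewrite double_gt0.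
  by rewrite !mulr_ge0 ?expR_ge0 ?exprn_ge0 ?(ltW c0) ?(ltW g0)// divr_ge0// mulr_ge0// ltW.
have ch t : 0 < t -> series (fun j => x j * h j t) @ \oo --> dens u c t * expR (l * t).
  move=> t0; pose K := expR (- (u / 2)) * c ^+ n * t ^+ n.-1 * expR (- ((c - l) * t)).
  have -> : (fun j => x j * h j t) = fun j => K * (gcoef n.*2 j * (u * c * t / 2) ^+ j).
    apply/funext => j; rewrite /x /h /K exprD.
    have -> : u * c * t / 2 = (u * c / 2) * t by ring.
    by move: (u * c / 2) => y; rewrite exprMn; ring.
  have -> : dens u c t * expR (l * t) = K * hG n.*2 (u * c * t / 2).
    have -> : K = expR (- (u / 2)) * c ^+ n * t ^+ n.-1 * (expR (- (c * t)) * expR (l * t)).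
      by rewrite -expRD /K; congr (_ * expR _); ring.
    by rewrite /dens; ring.
  rewrite (_ : series _ = fun N => K * pseries (gcoef n.*2) (u * c * t / 2) N).
    by apply: cvgMr; apply: cvg_hG; rewrite double_gt0.
  by apply/funext => N; rewrite /pseries /series/= mulr_sumr.
have h0 j t : 0 < t -> 0 <= h j t.
  by move=> t0; rewrite mulr_ge0 ?expR_ge0// exprn_ge0// ltW.
have H0 j : 0 <= H j by rewrite divr_ge0// exprn_ge0// ltW.
have [] := @integral_series _ _ R leb `]0, +oo[%classic h x H.
- by [].
- move=> j; apply: measurable_continuous_oy => t t0.
  exact: hasD_continuous (dM (dX _ (did t))
    (dcomp (g := fun t => - ((c - l) * t)) (dexp _) (dN (dM (dcst (c - l) t) (did t))))).
- by move=> j t /=; rewrite in_itv/= andbT; exact: h0.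
- by move=> j; exact: integral_pow_exp.
- rewrite (_ : (fun j => _) = (fun j => expR (- (u / 2)) * (c / (c - l)) ^+ n *
    exp_coeff (u / 2 * (c / (c - l))) j)).
    by apply: is_cvg_seriesZ; exact: is_cvg_series_exp_coeff.
  by apply/funext => j; rewrite ger0_norm.
- move=> t /=; rewrite in_itv/= andbT => t0.
  rewrite (_ : (fun j => _) = (fun j => x j * h j t)).
    by apply/cvg_ex; eexists; exact: ch t0.
  by apply/funext => j; rewrite ger0_norm.
move=> _; rewrite (funext xH) limn_seriesMl; last exact: is_cvg_series_exp_coeff.
have -> : lap u c l = expR (- (u / 2)) * (c / (c - l)) ^+ n * expR (u / 2 * (c / (c - l))).
  by rewrite [RHS]mulrAC -expRD /lap; congr (expR _ * _); field; rewrite gt_eqF.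
move=> <-; apply: eq_integral => t; rewrite inE/= in_itv/= andbT => t0.
by congr EFin; apply/esym/cvg_lim => //; exact: ch.
Qed.

(* A weight w and a nonnegative variable Z on some sigma-finite measure space;
   with expectation E[F] = \int w F, this models the remainder of the
   infinite sum of independent variables behind the heat kernel. *)
Lemma law_exists (u : R) (K N : nat) : 0 <= u ->
  exists (d : measure_display) (T : measurableType d)
    (P : {sigma_finite_measure set T -> \bar R}) (w Z : T -> R),
    [/\ measurable_fun setT w, measurable_fun setT Z,
        (forall x, 0 <= w x) , (forall x, 0 <= Z x) &
        forall l, l < pole K ->
          (\int[P]_x (w x * expR (l * Z x))%:E)%E =
          (\prod_(k < N) lap u (pole (K + k)) l)%:E].
Proof.
move=> u0; elim: N => [|N [d [T [P [w [Z [mw mZ w0 Z0 wZ]]]]]]].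
  exists _, (measurableTypeR R), (@dirac _ (measurableTypeR R) 0 R), (fun=> 1), (fun=> 0); split => //.
  move=> l _; rewrite big_ord0; under eq_integral do rewrite mulr0 expR0 mulr1.
  by rewrite integral_cst//= diracT mule1.
pose c : R := pole (K + N); have c0 : 0 < c by exact: pole_gt0.
pose f := (dens u c) \_ `]0, +oo[.
have mf : measurable_fun setT f.
  apply/(measurable_restrictT (dens u c)) => //; apply: measurable_funTS.
  by apply: continuous_measurable_fun; exact: continuous_dens.
have f0 t : 0 <= f t.
  rewrite /f patchE; case: ifPn => // /set_mem /=; rewrite in_itv/= andbT => t0.
  by apply: dens_ge0 => //; exact: ltW.
pose w' (z : T * measurableTypeR R) : R := w z.1 * f z.2.
(* The maximum makes [Z'] nonnegative everywhere; it changes nothing where the weight is nonzero,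
   since [f] vanishes off the positive axis. *)
pose Z' (z : T * measurableTypeR R) : R := Z z.1 + Num.max z.2 0.
have mw' : measurable_fun setT w'.
  by apply: measurable_funM; apply: measurableT_comp => //.
have mZ' : measurable_fun setT Z'.
  apply: measurable_funD; first exact: measurableT_comp.
  by apply: measurable_maxr.
exists _, (T * measurableTypeR R)%type,
  (prod_sigma_finite P leb), w', Z'; split => //.
- by move=> z; rewrite mulr_ge0.
- by move=> z; rewrite addr_ge0// le_max lexx orbT.
move=> l lK; have lc : l < c.
  apply: (lt_le_trans lK); rewrite ler_pXn2r// ?nnegrE ?mulr_ge0 ?pi_ge0//.
  by rewrite ler_pM2l ?pi_gt0// ler_nat ltnS leq_addr.
have m1 : measurable_fun setT (EFin \o (fun z => w' z * expR (l * Z' z))).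
  apply/measurable_EFinP; apply: measurable_funM => //.
  by apply: measurableT_comp => //; exact: measurable_funM.
transitivity (\int[(P \x leb)%E]_z (w' z * expR (l * Z' z))%:E)%E => //.
rewrite (@fubini_tonelli1 _ _ _ _ R P leb _ m1); last first.
  by move=> z; rewrite /= lee_fin mulr_ge0 ?expR_ge0// mulr_ge0.
rewrite big_ord_recr/= -/c EFinM -wZ// -ge0_integralZr//; last 3 first.
- by apply/measurable_EFinP; apply: measurable_funM => //; apply: measurableT_comp => //; exact: measurable_funM.
- by move=> x _; rewrite lee_fin mulr_ge0 ?expR_ge0.
- by rewrite lee_fin ltW// lap_gt0.
apply: eq_integral => x _; rewrite /fubini_F/=.
rewrite -dens_laplace// -ge0_integralZl_EFin//; last 3 first.
- move=> t /=; rewrite in_itv/= andbT => t0.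
  by rewrite lee_fin mulr_ge0 ?expR_ge0// dens_ge0// ltW.
- apply/measurable_EFinP; apply: measurable_continuous_oy => t t0.
  apply: continuousM; first exact: continuous_dens.
  exact: hasD_continuous (dcomp (g := fun t => l * t) (dexp _) (dM (dcst l t) (did t))).
- by rewrite mulr_ge0 ?expR_ge0.
rewrite [RHS]integral_mkcond; apply: eq_integral => t _.
rewrite /w' /Z' /f /= !patchE; case: ifPn => [|_]; last by rewrite mulr0 mul0r.
move=> /set_mem /=; rewrite in_itv/= andbT => t0.
rewrite (max_idPl (ltW t0)) mulrDr expRD -EFinM; congr EFin; ring.
Qed.

End Density.

Section HeatLimit.
Context {R : realType}.
Notation leb := (@lebesgue_measure R).
Variables (n m : nat) (u v : R).
Hypotheses (n0 : (0 < n)%N) (m0 : (0 < m)%N) (u0 : 0 < u) (v0 : 0 < v).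

(** The truncation to N poles of exp(-(u/4) s coth s) (s/sinh s)^n. The constant factor comes from s
    coth s = 1 + 2 times the sum of s^2/(c_k + s^2). *)
Definition phiN (N : nat) (s : R) : R :=
  expR (- (u / 4)) * \prod_(k < N) lap n u (pole k) (- s ^+ 2).

Let pos_gt (k : nat) (s : R) : 0 < pole k + s ^+ 2.
Proof. by rewrite ltr_pwDl ?pole_gt0// exprn_even_ge0. Qed.

Let lapE (k : nat) (s : R) : lap n u (pole k) (- s ^+ 2) =
  expR (- (u / 2) * (s ^+ 2 / (pole k + s ^+ 2))) * (1 + s ^+ 2 / pole k) ^- n.
Proof.
rewrite /lap opprK; congr (expR _ * _).
  by field; rewrite gt_eqF.
rewrite -exprVn; congr (_ ^+ _); have c0 := @pole_gt0 R k; have cs := pos_gt k s.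
by move: (pole k) c0 cs => c c0 cs; field; rewrite !gt_eqF.
Qed.

Let lap_pos (k : nat) (s : R) : 0 < lap n u (pole k) (- s ^+ 2).
Proof.
by rewrite lap_gt0 ?pole_gt0// (@le_lt_trans _ _ 0) ?pole_gt0// oppr_le0 exprn_even_ge0.
Qed.

Let lap_le (k : nat) (s : R) : lap n u (pole k) (- s ^+ 2) <= pole k / (pole k + s ^+ 2).
Proof.
have c0 := @pole_gt0 R k; have cs := pos_gt k s.
have e1 : expR (- (u / 2) * (s ^+ 2 / (pole k + s ^+ 2))) <= 1.
  by rewrite -expR0 ler_expR mulNr oppr_le0 mulr_ge0 ?divr_ge0 ?exprn_even_ge0// ltW.
have q : pole k / (pole k + s ^+ 2) <= 1.
  by rewrite ler_pdivrMr// mul1r lerDl exprn_even_ge0.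
have q0 : 0 < pole k / (pole k + s ^+ 2) by rewrite divr_gt0.
rewrite /lap opprK; have -> : u / 2 * (- s ^+ 2 / (pole k + s ^+ 2)) =
  - (u / 2) * (s ^+ 2 / (pole k + s ^+ 2)) by ring.
apply: (@le_trans _ _ (1 * (pole k / (pole k + s ^+ 2)) ^+ n)).
  by rewrite ler_wpM2r// exprn_ge0// ltW.
rewrite mul1r; case: n n0 => // n' _; rewrite exprS ler_piMr ?(ltW q0)//.
by rewrite exprn_ile1// ltW.
Qed.

Lemma phiN_gt0 N s : 0 < phiN N s.
Proof. by rewrite mulr_gt0 ?expR_gt0// prodr_gt0. Qed.

Lemma phiN_cvg s : 0 < s ->
  phiN N s @[N --> \oo] --> expR (- (u / 4 * s * coth s)) * (s / sinh s) ^+ n.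
Proof.
move=> s0; have ss := sinh_gt0 s0.
have -> : phiN ^~ s = fun N => expR (- (u / 4)) *
   (expR (- (u / 2) * (s ^+ 2 * \sum_(k < N) (pole k + s ^+ 2)^-1)) *
    (\prod_(k < N) (1 + s ^+ 2 / pole k)) ^- n).
  apply/funext => N; rewrite /phiN; congr (_ * _).
  under eq_bigr do rewrite lapE.
  rewrite big_split/= -expR_sum -!mulr_sumr prodfV prodrXl; congr (expR _ * _).
have -> : expR (- (u / 4 * s * coth s)) * (s / sinh s) ^+ n =
   expR (- (u / 4)) * (expR (- (u / 2) * (s ^+ 2 * ((s * coth s - 1) / (2 * s ^+ 2)))) *
     (sinh s / s) ^- n).
  have -> : s / sinh s = (sinh s / s)^-1 by rewrite [RHS]invf_div.
  rewrite mulrA -expRD -exprVn; congr (expR _ * _).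
  by field; rewrite gt_eqF.
have H1 : expR (- (u / 2) * (s ^+ 2 * \sum_(k < N) (pole k + s ^+ 2)^-1)) @[N --> \oo]
    --> expR (- (u / 2) * (s ^+ 2 * ((s * coth s - 1) / (2 * s ^+ 2)))).
  apply: continuous_cvg; first exact: continuous_expR.
  by apply: cvgMr; apply: cvgMr; exact: coth_sum.
have H2 : (\prod_(k < N) (1 + s ^+ 2 / pole k)) ^- n @[N --> \oo] --> (sinh s / s) ^- n.
  apply: cvgV; first by rewrite expf_neq0// gt_eqF// divr_gt0.
  exact: (cvg_comp _ (fun x : R => x ^+ n) (sinh_product s0) (@exprn_continuous _ n _)).
by apply: cvgMr; apply: cvgM.
Qed.

(** Only the first m factors are kept, the others being at most 1. Each contributes a decay 1/(1 +
    s^2), enough to absorb s^(m-1) and leave an integrable bound independent of N. *)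
Lemma phiN_le N s : (m <= N)%N ->
  `|s ^+ m.-1 * phiN N s| <= (pole m) ^+ m * (1 + s ^+ 2)^-1.
Proof.
move=> mN; have s2 : 0 <= s ^+ 2 by rewrite exprn_even_ge0.
have s1 : 0 < 1 + s ^+ 2 by rewrite ltr_pwDl.
have pm1 : 1 <= pole m :> R.
  apply: le_trans (pole_ge m); rewrite exprn_ege1//.
  by rewrite (le_trans _ (pi_ge2 R))// ler1n.
have prodle : phiN N s <= (pole m / (1 + s ^+ 2)) ^+ m.
  rewrite /phiN -(subnKC mN) big_split_ord/=.
  apply: (@le_trans _ _ (1 * ((\prod_(i < m) (pole m / (1 + s ^+ 2))) * 1))).
    apply: ler_pM.
    - exact: expR_ge0.
    - by rewrite mulr_ge0 ?prodr_ge0// => k _; exact: ltW.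
    - by rewrite -expR0 ler_expR oppr_le0 divr_ge0// ltW.
    apply: ler_pM.
    - by rewrite prodr_ge0// => k _; exact: ltW.
    - by rewrite prodr_ge0// => k _; exact: ltW.
    - apply: ler_prod => k _; rewrite (ltW (lap_pos _ _))/=.
      apply: le_trans (lap_le k s) _; have c0 := @pole_gt0 R k.
      have cm : pole k <= pole m :> R.
        rewrite ler_pXn2r// ?nnegrE ?mulr_ge0 ?pi_ge0//.
        by rewrite ler_pM2l ?pi_gt0// ler_nat ltnS ltnW.
      rewrite ler_pdivrMr// mulrAC ler_pdivlMr//.
      move: (pole k) (pole m) c0 cm pm1 => c C c0 cC C1; nra.
    - rewrite -[leRHS](@big1_eq _ _ *%R _ (index_enum 'I_(N - m)) xpredT).
      apply: ler_prod => k _; rewrite (ltW (lap_pos _ _))/=.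
      apply: le_trans (lap_le _ s) _; rewrite ler_pdivrMr// mul1r.
      by rewrite lerDl.
  by rewrite mul1r mulr1 prodr_const card_ord.
rewrite normrM normrX (gtr0_norm (phiN_gt0 N s)).
apply: le_trans (ler_wpM2l _ prodle) _; first by rewrite exprn_ge0.
have key : `|s| ^+ m.-1 * (1 + s ^+ 2)^-1 ^+ m <= (1 + s ^+ 2)^-1.
  case: m m0 => // m' _ /=; rewrite exprS exprVn mulrCA -[leRHS]mulr1.
  rewrite ler_wpM2l ?invr_ge0 ?(ltW s1)// ler_pdivrMr ?exprn_gt0// mul1r.
  apply: lerXn2r; rewrite ?nnegrE ?(ltW s1)//.
  have := sqr_ge0 (`|s| - 1); rewrite -(real_normK (num_real s)).
  have := normr_ge0 s; move: `|s| => z; nra.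
rewrite exprMn mulrCA; apply: ler_wpM2l => //.
by rewrite exprn_ge0// (le_trans _ pm1).
Qed.

End HeatLimit.

Section Subordination.
Context {R : realType}.
Notation leb := (@lebesgue_measure R).
Variables (n m : nat) (u v : R).
Hypotheses (n0 : (0 < n)%N) (m0 : (0 < m)%N) (u0 : 0 < u) (v0 : 0 < v).

Lemma dlap c l : l < c -> exists d, hasD (lap n u c) l d.
Proof.
move=> lc; have cl : c - l != 0 by rewrite subr_eq0 gt_eqF.
have dcl := dV (f := fun l : R => c - l) cl (dB (dcst c l) (did l)).
eexists; exact: (dM (dcomp (g := fun l : R => u / 2 * (l / (c - l))) (dexp _)
   (dM (dcst (u / 2) l) (dM (did l) dcl))) (dX n (dM (dcst c l) dcl))).
Qed.

Lemma continuous_phiN N : continuous (phiN n u N).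
Proof.
move=> s; have cp k : {for s, continuous (fun s : R => lap n u (pole k) (- s ^+ 2))}.
  have sk : - s ^+ 2 < pole k by rewrite (@le_lt_trans _ _ 0) ?pole_gt0// oppr_le0 exprn_even_ge0.
  have [d dl] := @dlap (pole k) (- s ^+ 2) sk.
  exact: hasD_continuous (dcomp (g := fun s : R => - s ^+ 2) dl (dN (dX 2 (did s)))).
apply: cvgM; first exact: cvg_cst.
elim: N => [|N IH].
  rewrite big_ord0; under eq_fun do rewrite big_ord0; exact: cvg_cst.
rewrite big_ord_recr; under eq_fun do rewrite big_ord_recr; apply: cvgM => //.
exact: cp.
Qed.

Definition besselfun (s : R) : R := s ^+ m.-1 * hG m (- ((s * v) ^+ 2 / 4)).

Lemma continuous_besselfun : continuous besselfun.
Proof.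
move=> s; exact: hasD_continuous (dM (dX m.-1 (did s)) (dcomp (g := fun s : R => - ((s * v) ^+ 2 / 4))
  (dhG _ m0) (dN (dM (dX 2 (dM (did s) (dcst v s))) (dcst 4^-1 s))))).
Qed.

Definition pN (N : nat) : R := \int[leb]_(s in `]0, +oo[) (besselfun s * phiN n u N s).

Lemma integrable_oneDsqrV : leb.-integrable `]0, +oo[ (EFin \o (fun s : R => (1 + s ^+ 2)^-1)).
Proof.
have c s : continuous_at s (fun s : R => (1 + s ^+ 2)^-1).
  have s1 : 1 + s ^+ 2 != 0 by rewrite gt_eqF// ltr_pwDl// exprn_even_ge0.
  exact: hasD_continuous (dV (f := fun s : R => 1 + s ^+ 2) s1 (dD (dcst 1 s) (dX 2 (did s)))).
have mf : measurable_fun `](0 : R), +oo[ (fun s : R => (1 + s ^+ 2)^-1).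
  by apply: measurable_continuous_oy => s _; exact: c.
apply/integrableP; split; first exact/measurable_EFinP.
rewrite (_ : (\int[leb]_(s in _) _)%E = \int[leb]_(s in `[0%R, +oo[) (oneDsqr s)^-1%:E)%E.
  by rewrite integral0y_oneDsqr ltry.
rewrite -integral_itv_obnd_cbnd; last exact/measurable_EFinP.
apply: eq_integral => s _ /=; rewrite ger0_norm// invr_ge0 ltW// ltr_pwDl//.
exact: exprn_even_ge0.
Qed.

Lemma besselfun_phiN_le N s : (m <= N)%N ->
  `|besselfun s * phiN n u N s| <= (hGam m)^-1 * pole m ^+ m * (1 + s ^+ 2)^-1.
Proof.
move=> mN; rewrite /besselfun mulrAC normrM mulrC -mulrA.
apply: ler_pM => //; last exact: phiN_le.
by apply: hG_neg_bound => //; rewrite divr_ge0// exprn_even_ge0.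
Qed.

Lemma integrable_dominating : leb.-integrable `]0, +oo[
  (EFin \o (fun s : R => (hGam m)^-1 * pole m ^+ m * (1 + s ^+ 2)^-1)).
Proof.
have := @integrableZl _ _ _ leb `](0 : R), +oo[%classic (measurable_itv _) ((hGam m)^-1 * pole m ^+ m) _ integrable_oneDsqrV.
by apply: eq_integrable => // s _; rewrite /= EFinM.
Qed.

Lemma heat_p_cvg :
  2 / (4 * pi) `^ (n%:R + m%:R / 2) * pN N @[N --> \oo] --> heat_p n m u v.
Proof.
rewrite /heat_p; apply: cvgMr.
pose f s := besselfun s * (expR (- (u / 4 * s * coth s)) * (s / sinh s) ^+ n).
rewrite (_ : Rintegral _ _ _ = \int[leb]_(s in `]0, +oo[) f s); last first.
  apply: eq_Rintegral => s; rewrite inE/= in_itv/= andbT => s0.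
  rewrite -mulrA besselJ_hG ?mulr_gt0// /f /besselfun; ring.
pose fN N s := besselfun s * phiN n u N s.
have mfN N : measurable_fun `](0 : R), +oo[ (fN N).
  apply: measurable_continuous_oy => s _; apply: cvgM; first exact: continuous_besselfun.
  exact: continuous_phiN.
have cf s : 0 < s -> fN N s @[N --> \oo] --> f s.
  by move=> s0; apply: cvgMr; exact: phiN_cvg.
have mf : measurable_fun `](0 : R), +oo[ f.
  refine (measurable_fun_cvg (h := fN) (f := f) mfN _) => s /=.
  by rewrite in_itv/= andbT; exact: cf.
(* The majorant is valid only from N = m on, hence the shift by m. *)
have [] := @dominated_convergence _ _ _ leb `]0, +oo[%classic _ (fun N s => (fN (m + N)%N s)%:E)
  (EFin \o f) _ _ _ _ integrable_dominating.
- by [].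
- by move=> N; apply/measurable_EFinP; exact: mfN.
- by apply/measurable_EFinP; exact: mf.
- apply: aeW => s /=; rewrite in_itv/= andbT => s0.
  apply/cvg_EFin; first exact: nearW.
  have := cf s s0; rewrite -(cvg_shiftn m); apply: cvg_trans; apply: near_eq_cvg.
  by near=> N; rewrite /= addnC.
- apply: aeW => s N /= _; rewrite lee_fin; apply: besselfun_phiN_le; exact: leq_addr.
move=> intf _ cI; rewrite -(cvg_shiftn m).
have -> : (fun N => pN (N + m)) = fun N => fine (\int[leb]_(s in `]0%R, +oo[) (fN (m + N)%N s)%:E)%E.
  by apply/funext => N; rewrite addnC.
apply: fine_cvg; rewrite /Rintegral fineK//; exact: integrable_fin_num.
Unshelve. all: by end_near. Qed.

Section Formula.
Context (d : measure_display) (T : measurableType d)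
    (P : {sigma_finite_measure set T -> \bar R}) (w Z : T -> R) (N : nat).
Hypotheses (mw : measurable_fun setT w) (mZ : measurable_fun setT Z)
  (w0 : forall x, 0 <= w x) (Z0 : forall x, 0 <= Z x).
Hypothesis wZ : forall l, l < pole 1 -> (\int[P]_x (w x * expR (l * Z x))%:E)%E =
          (\prod_(k < N) lap n u (pole (1 + k)) l)%:E.

Definition kern (tau : R) : R := (tau `^ (m%:R / 2))^-1 * expR (- (v ^+ 2 / (4 * tau))).

(** Fubini between s and the probability space. Integrating over the space first gives the Laplace
    transform, hence [pN]; integrating over s first gives [kern] by [gauss_hG]. Only the variable at
    pole 0 appears through its density; the factors 2 and exp(u/4) undo the constants of [gauss_hG]
    and [phiN]. *)
Lemma pN_formula : (m <= N.+1)%N ->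
  measurable_fun setT (fun x => (w x)%:E * \int[leb]_(t in `]0%R, +oo[)
     (dens n u (pole 0) t * kern (t + Z x))%:E)%E /\
  (\int[P]_x ((w x)%:E * \int[leb]_(t in `]0%R, +oo[)
     (dens n u (pole 0) t * kern (t + Z x))%:E))%E =
  (2 * expR (u / 4) * pN N.+1)%:E.
Proof.
move=> mN; pose c : R := pole 0; have c0 : 0 < c by exact: pole_gt0.
pose f := (dens n u c) \_ `]0, +oo[.
have mf : measurable_fun setT f.
  apply/(measurable_restrictT (dens n u c)) => //; apply: measurable_funTS.
  by apply: continuous_measurable_fun; exact: continuous_dens.
have f0 t : 0 <= f t.
  rewrite /f patchE; case: ifPn => // /set_mem /=; rewrite in_itv/= andbT => t0.
  by apply: dens_ge0 => //; exact: ltW.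
pose W (z : T * measurableTypeR R) : R := w z.1 * f z.2.
pose tau (z : T * measurableTypeR R) : R := z.2 + Z z.1.
have mW : measurable_fun setT W.
  by apply: measurable_funM; apply: measurableT_comp => //.
have W0 z : 0 <= W z by rewrite mulr_ge0.
have mtau : measurable_fun setT tau.
  by apply: measurable_funD => //; exact: measurableT_comp.
pose F := besselfun \_ `]0, +oo[.
have mF : measurable_fun setT F.
  apply/(measurable_restrictT besselfun) => //; apply: measurable_funTS.
  by apply: continuous_measurable_fun; exact: continuous_besselfun.
pose g (y : (T * measurableTypeR R) * measurableTypeR R) : R :=
  F y.2 * (W y.1 * expR (- y.2 ^+ 2 * tau y.1)).
have mg : measurable_fun setT g.
  apply: measurable_funM; first exact: measurableT_comp.
  apply: measurable_funM; first exact: measurableT_comp.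
  apply: measurableT_comp => //; apply: measurable_funM; last exact: measurableT_comp.
  by apply: measurableT_comp => //; exact: measurable_funX.
have mEg : measurable_fun setT (EFin \o g) by exact/measurable_EFinP.
pose Q := prod_sigma_finite P leb.
have lapW s : (\int[Q]_z (W z * expR (- s ^+ 2 * tau z))%:E)%E = (expR (u / 4) * phiN n u N.+1 s)%:E.
  have s2 k : - s ^+ 2 < pole k by rewrite (@le_lt_trans _ _ 0) ?pole_gt0// oppr_le0 exprn_even_ge0.
  have m1 : measurable_fun setT (EFin \o (fun z => W z * expR (- s ^+ 2 * tau z))).
    apply/measurable_EFinP; apply: measurable_funM => //.
    by apply: measurableT_comp => //; exact: measurable_funM.
  transitivity (\int[(P \x leb)%E]_z (W z * expR (- s ^+ 2 * tau z))%:E)%E => //.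
  rewrite (@fubini_tonelli1 _ _ _ _ R P leb _ m1); last first.
    by move=> z; rewrite /= lee_fin mulr_ge0 ?expR_ge0.
  have -> : expR (u / 4) * phiN n u N.+1 s = (\prod_(k < N) lap n u (pole (1 + k)) (- s ^+ 2)) * lap n u c (- s ^+ 2).
    by rewrite /phiN big_ord_recl mulrA -expRD subrr expR0 mul1r mulrC.
  rewrite EFinM -wZ ?s2// -ge0_integralZr//; last 3 first.
  - by apply/measurable_EFinP; apply: measurable_funM => //; apply: measurableT_comp => //; exact: measurable_funM.
  - by move=> x _; rewrite lee_fin mulr_ge0 ?expR_ge0.
  - by rewrite lee_fin ltW// lap_gt0// s2.
  apply: eq_integral => x _; rewrite /fubini_F/=.
  rewrite -dens_laplace ?(ltW u0) ?s2// -ge0_integralZl_EFin//; last 3 first.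
  - move=> t /=; rewrite in_itv/= andbT => t0.
    by rewrite lee_fin mulr_ge0 ?expR_ge0// dens_ge0// ltW.
  - apply/measurable_EFinP; apply: measurable_continuous_oy => t t0.
    apply: continuousM; first exact: continuous_dens.
    exact: hasD_continuous (dcomp (g := fun t : R => - s ^+ 2 * t) (dexp _) (dM (dcst (- s ^+ 2) t) (did t))).
  - by rewrite mulr_ge0 ?expR_ge0.
  rewrite [RHS]integral_mkcond; apply: eq_integral => t _.
  rewrite /W /tau /f /= !patchE; case: ifPn => [|_]; last by rewrite mulr0 mul0r.
  by move=> _; rewrite mulrDr expRD -EFinM; congr EFin; ring.
have iW s : Q.-integrable setT (EFin \o (fun z => W z * expR (- s ^+ 2 * tau z))).
  apply/integrableP; split.
    apply/measurable_EFinP; apply: measurable_funM => //.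
    by apply: measurableT_comp => //; exact: measurable_funM.
  rewrite (eq_integral (fun z => (W z * expR (- s ^+ 2 * tau z))%:E)) ?lapW ?ltry//.
  by move=> z _; rewrite /= ger0_norm// mulr_ge0 ?expR_ge0.
have gI s : (\int[Q]_x (EFin \o g) (x, s))%E = (F s * (expR (u / 4) * phiN n u N.+1 s))%:E.
  by rewrite EFinM -lapW -(integralZl _ (iW s)).
have gaI s : (\int[Q]_x `|(EFin \o g) (x, s)|)%E = `|F s * (expR (u / 4) * phiN n u N.+1 s)|%:E.
  have p0 : 0 <= expR (u / 4) * phiN n u N.+1 s by rewrite mulr_ge0 ?expR_ge0// ltW// phiN_gt0.
  rewrite normrM (ger0_norm p0) EFinM -lapW -(integralZl _ (iW s))//.
  by apply: eq_integral => z _; rewrite /= normrM [X in _ * X]ger0_norm ?mulr_ge0 ?expR_ge0.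
have iF : leb.-integrable `]0, +oo[ (EFin \o (fun s => besselfun s * (expR (u / 4) * phiN n u N.+1 s))).
  have := @integrableZl _ _ _ leb `](0 : R), +oo[%classic (measurable_itv _) (expR (u / 4)) _ integrable_dominating.
  apply: le_integrable => //.
    apply/measurable_EFinP; apply: measurable_continuous_oy => y _.
    apply: cvgM; first exact: continuous_besselfun.
    by apply: cvgM; [exact: cvg_cst|exact: continuous_phiN].
  move=> s _; rewrite /= lee_fin mulrCA normrM [leRHS]normrM ler_wpM2l//.
  by rewrite (le_trans (besselfun_phiN_le s mN))// ler_norm.
have FE s : (F s * (expR (u / 4) * phiN n u N.+1 s))%:E =
    ((fun s => (besselfun s * (expR (u / 4) * phiN n u N.+1 s))%:E) \_ `]0%R, +oo[) s.
  by rewrite /F !patchE; case: ifPn => // _; rewrite mul0r.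
have Eg : (\int[leb]_y \int[Q]_x `|(EFin \o g) (x, y)|)%E =
    (\int[leb]_(s in `]0%R, +oo[) `|(besselfun s * (expR (u / 4) * phiN n u N.+1 s))%:E|)%E.
  rewrite [RHS]integral_mkcond; apply: eq_integral => s _.
  rewrite gaI -abse_EFin FE !patchE; case: ifPn => // _; exact: abse0.
(* The Bessel factor changes sign, so integrability is required; the absolute value is integrated
   over the space first, which reduces it to the bound on [besselfun] times [phiN]. *)
have ig : (Q \x leb)%E.-integrable setT (EFin \o g).
  apply/(integrable21ltyP Q leb mEg); rewrite Eg.
  by have /integrableP[] := iF.
have FB := @Fubini _ _ _ _ R Q leb (EFin \o g) ig.
have Rr : (\int[leb]_y \int[Q]_x (EFin \o g) (x, y))%E = (expR (u / 4) * pN N.+1)%:E.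
  rewrite (eq_integral _ _ (fun s _ => etrans (gI s) (FE s))) -integral_mkcond.
  have iF1 : leb.-integrable `]0, +oo[ (EFin \o (fun s => besselfun s * phiN n u N.+1 s)).
    have := @integrableZl _ _ _ leb `](0 : R), +oo[%classic (measurable_itv _) (expR (- (u / 4))) _ iF.
    apply: eq_integrable => // s _; rewrite /= -EFinM; congr EFin.
    by rewrite mulrCA [X in _ * X]mulrA -expRD addNr expR0 mul1r.
  rewrite EFinM /pN /Rintegral fineK; last exact: integrable_fin_num.
  rewrite -(integralZl _ iF1)//; apply: eq_integral => s _.
  by rewrite /= -EFinM mulrCA.
pose kern' t := t `^ (- (m%:R / 2)) * expR (- (v ^+ 2 / 4 * t `^ (-1))).
have mk : measurable_fun setT kern'.
  apply: measurable_funM; first exact: measurable_powR.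
  apply: measurableT_comp => //; apply: measurableT_comp => //.
  by apply: measurable_funM => //; exact: measurable_powR.
have k0 t : 0 <= kern' t by rewrite mulr_ge0 ?expR_ge0// powR_ge0.
have kE t : 0 < t -> kern' t = kern t.
  move=> t0; rewrite /kern' /kern powRN powR_inv1 ?(ltW t0)//.
  by congr (_ * expR (- _)); rewrite invfM; ring.
have inn z : (\int[leb]_y (EFin \o g) (z, y))%E = (2^-1 * (W z * kern' (tau z)))%:E.
  (* Where the weight vanishes, [tau z] may fail to be positive and [gauss_hG] does not apply; both
     sides are then 0. *)
  have [Wz|Wz] := eqVneq (W z) 0.
    rewrite Wz mul0r mulr0 (eq_integral (cst 0%E)) ?integral0// => y _.
    by rewrite /g /= Wz mul0r mulr0.
  have tz : 0 < tau z.
    move: Wz; rewrite /W /tau /f patchE; case: ifPn => [|_]; last by rewrite mulr0 eqxx.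
    by move/set_mem; rewrite /= in_itv/= andbT => t0 _; rewrite ltr_pwDl.
  pose Gz s := s ^+ m.-1 * hG m (- ((s * v) ^+ 2 / 4)) * expR (- (s ^+ 2 * tau z)).
  have [ii ie] : leb.-integrable `]0, +oo[ (EFin \o Gz) /\
      (\int[leb]_(s in `]0%R, +oo[) (EFin \o Gz) s)%E =
      (2^-1 / tau z `^ (m%:R / 2) * expR (- (v ^+ 2 / (4 * tau z))))%:E by exact: gauss_hG.
  transitivity ((W z)%:E * \int[leb]_(s in `]0%R, +oo[) (EFin \o Gz) s)%E; last first.
    rewrite [X in (_ * X)%E]ie -EFinM kE// /kern; congr EFin.
    by rewrite [RHS]mulrCA !mulrA.
  rewrite -(integralZl _ ii); last (by []); rewrite [RHS]integral_mkcond; apply: eq_integral => y _.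
  rewrite [RHS]patchE /g /= /F patchE; case: ifPn => _; last by rewrite mul0r.
  by rewrite -EFinM /besselfun mulNr mulrCA.
have mWk : measurable_fun setT (EFin \o (fun z => W z * kern' (tau z))).
  by apply/measurable_EFinP; apply: measurable_funM => //; exact: measurableT_comp.
have Wk0 z : (0 <= (EFin \o (fun z => W z * kern' (tau z))%R) z)%E by rewrite lee_fin mulr_ge0.
have fubE x : fubini_F leb (EFin \o (fun z => W z * kern' (tau z))%R) x =
    ((w x)%:E * \int[leb]_(t in `]0%R, +oo[) (dens n u (pole 0) t * kern (t + Z x))%:E)%E.
  rewrite /fubini_F/= -ge0_integralZl_EFin//; last 2 first.
  - move=> t /=; rewrite in_itv/= andbT => t0; have tz : 0 < t + Z x by rewrite ltr_pwDl.
    by rewrite lee_fin mulr_ge0 ?dens_ge0 -?kE// ltW.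
  - apply/measurable_EFinP; apply: measurable_funM.
      by apply: measurable_continuous_oy => t t0; exact: continuous_dens.
    refine (eq_measurable_fun (fun t : measurableTypeR R => kern' (t + Z x)) _ _).
      by move=> t; rewrite inE /= in_itv/= andbT => t0; rewrite -kE// ltr_pwDl.
    apply: measurable_funTS; apply: measurableT_comp => //; exact: measurable_funD.
  rewrite [RHS]integral_mkcond; apply: eq_integral => t _.
  rewrite [RHS]patchE /W /tau /f /= patchE; case: ifPn => [|_]; last by rewrite mulr0 mul0r.
  move/set_mem; rewrite /= in_itv/= andbT => t0.
  rewrite kE ?ltr_pwDl// -EFinM. congr EFin; exact/esym/mulrA.
have L : (\int[Q]_x \int[leb]_y (EFin \o g) (x, y))%E =
   (2^-1%:E * \int[P]_x ((w x)%:E * \int[leb]_(t in `]0%R, +oo[) (dens n u (pole 0) t * kern (t + Z x))%:E))%E.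
  transitivity (\int[Q]_z (2^-1%:E * (W z * kern' (tau z))%:E))%E.
    by apply: eq_integral => z _; rewrite inn EFinM.
  transitivity (2^-1%:E * \int[Q]_z (W z * kern' (tau z))%:E)%E.
    apply: (@ge0_integralZl_EFin _ _ _ Q setT measurableT (EFin \o (fun z => W z * kern' (tau z))%R)) => //.
  congr (_ * _)%E.
  transitivity (\int[(P \x leb)%E]_z (EFin \o (fun z => W z * kern' (tau z))%R) z)%E => //.
  rewrite (@fubini_tonelli1 _ _ _ _ R P leb _ mWk)//.
  by apply: eq_integral => x _; rewrite fubE.
split.
  by rewrite -(funext fubE); exact: (@measurable_fun_fubini_tonelli_F _ _ _ _ R leb _ mWk Wk0).
move: FB; rewrite L Rr => H.
transitivity (2%:E * (2^-1%:E * \int[P]_x ((w x)%:E * \int[leb]_(t in `]0%R, +oo[) (dens n u (pole 0) t * kern (t + Z x))%:E)))%E.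
  by rewrite muleA -EFinM divff// mul1e.
by rewrite H -EFinM mulrA.
Qed.

End Formula.
End Subordination.

(** * The saddle point *)

Section Theta.
Context {R : realType}.
Implicit Types w u v : R.

Lemma muE w : sin w != 0 -> mu w = (w - sin w * cos w) / sin w ^+ 2.
Proof.
move=> sw; rewrite /mu (_ : 2 * w = w + w); last by ring.
rewrite sinD; move: (sin w) sw (cos w) => s s0 c; field; exact: s0.
Qed.

Lemma mu_le0 w : - pi < w -> w <= 0 -> mu w <= 0.
Proof.
move=> piw w0; have d0 : 0 <= (2 * sin w ^+ 2)^-1 by rewrite invr_ge0 mulr_ge0// exprn_even_ge0.
rewrite /mu mulr_le0_ge0//.
have w2 : 0 <= - (2 * w) by lra.
by have := sin_lex w2; rewrite sinN lerN2 subr_le0.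
Qed.

(** From w cos w <= sin w one gets w - sin w cos w <= w sin^2 w. As pi/2 < 2, values of [mu] above 2
    are not attained here. *)
Lemma mu_le_pihalf w : 0 < w -> w <= pi / 2 -> mu w <= w.
Proof.
move=> w0 wpi; have s0 : 0 < sin w.
  by apply: sin_gt0_pi; rewrite w0 (le_lt_trans wpi)// ltr_pdivrMr// ltr_pMr ?pi_gt0 ?ltr1n.
have c0 : 0 <= cos w.
  by apply: cos_ge0_pihalf; rewrite wpi (le_trans _ (ltW w0))// oppr_le0 divr_ge0// pi_ge0.
have /(@xcos_le_sin R) xs : 0 <= w <= pi.
  by rewrite (ltW w0) (le_trans wpi)// ler_pdivrMr// ler_pMr ?pi_gt0 ?ler1n.
rewrite muE ?gt_eqF// ler_pdivrMr ?exprn_gt0// sin2cos2 mulrBr mulr1 lerD2l lerN2.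
by rewrite expr2 mulrA mulrC [leRHS]mulrC ler_wpM2l.
Qed.

(** Existence of a preimage makes the partial inverse a right inverse at y. Its value is then
    located by excluding ]-pi, pi/2], so that injectivity of [mu] is never invoked. *)
Lemma mu_inv_range (y : R) : 2 < y -> pi / 2 < mu_inv y < pi /\ mu (mu_inv y) = y.
Proof.
move=> y2; have pi0 := @pi_gt0 R.
(* The equation [mu w = y] cleared of its denominator, so that it stays continuous at pi, where [mu]
   blows up. *)
pose F w := w - sin w * cos w - y * sin w ^+ 2.
have cF : {within `[pi / 2, pi], continuous F}.
  apply: continuous_subspaceT => w.
  exact: hasD_continuous (dB (dB (did w) (dM (dsin w) (dcos w))) (dM (dcst y w) (dX 2 (dsin w)))).
have pile : pi / 2 <= pi :> R by rewrite ler_pdivrMr// ler_pMr ?ler1n.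
have pi4 : pi / 2 < 2 :> R by have /andP[] := @pihalf_02 R.
have F1 : F (pi / 2) <= 0 by rewrite /F sin_pihalf cos_pihalf; lra.
have F2 : 0 < F pi by rewrite /F sinpi; lra.
have [|c] := IVT (v := 0) pile cF.
  by rewrite ge_min F1 le_max (ltW F2) orbT.
rewrite in_itv /= => /andP[c1 c2] Fc.
have {}c2 : c < pi by rewrite lt_neqAle c2 andbT; apply/eqP => ce; move: F2; rewrite -ce Fc ltxx.
have s0 : 0 < sin c by apply: sin_gt0_pi; rewrite c2 andbT; lra.
have yA : (mu @` `]- pi, pi[) y.
  exists c; first by rewrite /= in_itv/= c2 andbT; lra.
  have s2 : sin c ^+ 2 != 0 by rewrite expf_neq0 ?gt_eqF.
  rewrite muE ?gt_eqF//; apply: (canLR (mulfK s2)).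
  by apply/eqP; rewrite -subr_eq0; apply/eqP.
have muy : mu (mu_inv y) = y by apply: pinvK; rewrite inE.
have : `]- pi, pi[%classic (mu_inv y).
  apply: (@surjpinv_image_sub _ _ (fun=> 0) `]- pi, pi[%classic (mu @` `]- pi, pi[) mu) => //.
  by exists y.
rewrite /= in_itv/= => /andP[w1 w2]; split=> //; rewrite w2 andbT ltNge; apply/negP => w3.
have [w4|w4] := leP (mu_inv y) 0.
  by have := mu_le0 w1 w4; rewrite muy; lra.
by have := mu_le_pihalf w4 w3; rewrite muy; lra.
Qed.

(** The last two bounds express u ~ v epsilon^2. In (theta - sin theta cos theta) u = 4 v sin^2
    theta the bracket lies between 1 and 5, and sin theta = sin epsilon lies between epsilon/2 and
    epsilon. *)
Lemma theta_spec u v : 0 < u -> u <= v ->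
  [/\ pi / 2 < theta u v < pi, mu (theta u v) = 4 * v / u,
      u <= 4 * v * epsilon u v ^+ 2 & v * epsilon u v ^+ 2 <= 5 * u].
Proof.
move=> u0 uv; have y2 : 2 < 4 * v / u by rewrite ltr_pdivlMr//; lra.
have [] := mu_inv_range y2; rewrite -/(theta u v) /epsilon.
set w := theta u v => /andP[w1 w2] muw; rewrite w1 w2.
have pi2 := @pi_ge2 R; have /andP[_ pi4] := @pihalf_02 R.
have e0 : 0 < pi - w by rewrite subr_gt0.
have sE : sin (pi - w) = sin w by rewrite sinB sinpi cospi mul0r sub0r mulN1r opprK.
have s1 : (pi - w) / 2 <= sin w.
  by rewrite -sE half_le_sin// (ltW e0)/=; lra.
have s2 : sin w <= pi - w by rewrite -sE sin_lex// ltW.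
have s0 : 0 < sin w by lra.
have c0 : cos w <= 0.
  by rewrite -[w](subKr pi) cosB cospi sinpi mul0r addr0 mulN1r oppr_le0 cos_ge0_pihalf//; lra.
have c1 := cos_geN1 w; have sl1 := sin_le1 w.
have sn : sin w != 0 by rewrite gt_eqF.
have un : u != 0 by rewrite gt_eqF.
have /eqP := muw; rewrite [X in X == _ -> _]muE// eqr_div ?expf_neq0// => /eqP H.
have sc : - 1 <= sin w * cos w <= 0.
  by rewrite mulr_ge0_le0 ?(ltW s0)// andbT; nra.
suff [A B] : u <= 4 * v * (pi - w) ^+ 2 /\ v * (pi - w) ^+ 2 <= 5 * u by split.
move: w1 w2 e0 s1 s2 s0 sc {muw sn sE} H pi2 pi4 => {c0 c1 sl1}.
move: (pi : R) (sin w) (cos w) => p s c w1 w2 e0 s1 s2 s0 /andP[sc1 sc2] H pi2 pi4.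
have e2 : (p - w) ^+ 2 / 4 <= s ^+ 2 by rewrite (_ : _ / 4 = ((p - w) / 2) ^+ 2); [rewrite lerXn2r ?nnegrE//; lra|field].
have e3 : s ^+ 2 <= (p - w) ^+ 2 by rewrite lerXn2r ?nnegrE//; lra.
have v0 : 0 < v by lra.
have h1 : 1 * u <= (w - s * c) * u by rewrite ler_wpM2r ?(ltW u0)//; lra.
have h2 : (w - s * c) * u <= 5 * u by rewrite ler_wpM2r ?(ltW u0)//; lra.
have h3 := ler_wpM2l (ltW v0) e2; have h4 := ler_wpM2l (ltW v0) e3.
split; lra.
Qed.

End Theta.

(** * The exact Gaussian integral over the normalised time r *)

Section InverseGaussian.
Context {R : realType}.
Notation leb := (@lebesgue_measure R).
Implicit Types r A : R.

(* The map r |-> sqrt r - 1/sqrt r has derivative [igw] and square [igy], which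
   makes the integral of [igw] against exp (- A igy) Gaussian. *)
Definition igw r := ((Num.sqrt r)^-1 + (r * Num.sqrt r)^-1) / 2.
Definition igy r := (r - 1) ^+ 2 / r.

Lemma igw_gt0 r : 0 < r -> 0 < igw r.
Proof. by move=> r0; rewrite divr_gt0// addr_gt0// invr_gt0 ?mulr_gt0 ?sqrtr_gt0. Qed.

Lemma igy_ge0 r : 0 < r -> 0 <= igy r.
Proof. by move=> r0; rewrite divr_ge0 ?(ltW r0)// exprn_even_ge0. Qed.

Lemma igy_sqrt r : 0 < r -> (Num.sqrt r - (Num.sqrt r)^-1) ^+ 2 = igy r.
Proof.
move=> r0; have s0 : Num.sqrt r != 0 by rewrite gt_eqF ?sqrtr_gt0.
rewrite /igy -{3 4}(sqr_sqrtr (ltW r0)); move: (Num.sqrt r) s0 => s s0; field; exact: s0.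
Qed.

Lemma dsqrtB r : 0 < r -> hasD (fun r => Num.sqrt r - (Num.sqrt r)^-1) r (igw r).
Proof.
move=> r0; have s0 : Num.sqrt r != 0 by rewrite gt_eqF ?sqrtr_gt0.
apply: (deq (dB (dsqrt r0) (dV (f := fun r : R => Num.sqrt r) s0 (dsqrt r0)))).
rewrite /igw -{5}(sqr_sqrtr (ltW r0)); move: (Num.sqrt r) s0 => s s0; field; exact: s0.
Qed.

Lemma continuous_igw r : 0 < r -> {for r, continuous igw}.
Proof.
move=> r0; have s0 : Num.sqrt r != 0 by rewrite gt_eqF ?sqrtr_gt0.
have rs0 : r * Num.sqrt r != 0 by rewrite mulf_neq0// gt_eqF.
exact: hasD_continuous (dM (dD (dV (f := fun r : R => Num.sqrt r) s0 (dsqrt r0))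
  (dV (f := fun r : R => r * Num.sqrt r) rs0 (dM (did r) (dsqrt r0)))) (dcst 2^-1 r)).
Qed.

Lemma continuous_igy r : 0 < r -> {for r, continuous igy}.
Proof.
move=> r0; have rn : r != 0 by rewrite gt_eqF.
exact: hasD_continuous (dM (dX 2 (dB (did r) (dcst 1 r))) (dV (f := fun r : R => r) rn (did r))).
Qed.

Lemma continuous_igexp A r : 0 < r -> {for r, continuous (fun r => expR (- (A * igy r)))}.
Proof.
move=> r0; apply: (@continuous_comp _ _ _ (fun r => - (A * igy r)) (@expR R)); last exact: continuous_expR.
by apply: continuousN; apply: continuousM; [exact: cvg_cst|exact: continuous_igy].
Qed.

Lemma measurable_ig A : measurable_fun `](0 : R), +oo[ (fun r => igw r * expR (- (A * igy r))).
Proof.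
apply: measurable_continuous_oy => r r0.
by apply: continuousM; [exact: continuous_igw|exact: continuous_igexp].
Qed.

Lemma ig_integral A : 0 < A ->
  (\int[leb]_(r in `]0%R, +oo[) (igw r * expR (- (A * igy r)))%:E)%E = (Num.sqrt (pi / A))%:E.
Proof.
move=> A0; have sA : 0 < Num.sqrt A by rewrite sqrtr_gt0.
pose F r := Num.sqrt A * (Num.sqrt r - (Num.sqrt r)^-1).
have J : setT = F @` `]0, +oo[%classic.
  apply/seteqP; split=> // y _; pose t := y / Num.sqrt A.
  (* The positive root of s - 1/s = t; the preimage is r = s^2. *)
  pose s := (t + Num.sqrt (t ^+ 2 + 4)) / 2.
  have t4 : 0 < t ^+ 2 + 4 by rewrite ltr_wpDl ?exprn_even_ge0.
  have q2 := sqr_sqrtr (ltW t4).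
  have q0 := sqrtr_ge0 (t ^+ 2 + 4).
  have s0 : 0 < s by rewrite divr_gt0//; nra.
  exists (s ^+ 2); first by rewrite /= in_itv/= andbT exprn_gt0.
  rewrite /F sqrtr_sqr (gtr0_norm s0).
  have -> : s - s^-1 = t.
    apply: (mulIf (lt0r_neq0 s0)); rewrite mulrBl mulVf ?gt_eqF// /s.
    move: q2; move: (Num.sqrt _) => q q2; apply/eqP; rewrite -subr_eq0.
    rewrite (_ : _ - _ = (q ^+ 2 - (t ^+ 2 + 4)) / 4); last by field.
    by rewrite q2 subrr mul0r.
  by rewrite mulrC divfK ?gt_eqF.
have := ge0_substitution_oy (F := F) (f := fun r => Num.sqrt A * igw r) (G := gauss_fun) (l := 0) J.
move=> H.
have HH : (\int[leb]_(y in setT) (gauss_fun y)%:E =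
   (Num.sqrt A)%:E * \int[leb]_(r in `]0%R, +oo[) (igw r * expR (- (A * igy r)))%:E)%E.
  rewrite H; first last.
  - by move=> y _; exact: gauss_fun_ge0.
  - by move=> y _; exact: continuous_gauss_fun.
  - by move=> x x0; rewrite mulr_gt0// igw_gt0.
  - by move=> x x0; apply: continuousM; [exact: cvg_cst|exact: continuous_igw].
  - move=> x x0; apply: (deq (dM (dcst (Num.sqrt A) x) (dsqrtB x0))).
    by rewrite mul0r add0r.
  rewrite -ge0_integralZl_EFin ?(ltW sA)//; last 2 first.
  - move=> r /=; rewrite in_itv/= andbT => r0.
    by rewrite lee_fin mulr_ge0 ?expR_ge0// ltW// igw_gt0.
  - by apply/measurable_EFinP; exact: measurable_ig.
  apply: eq_integral => r; rewrite inE/= in_itv/= andbT => r0.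
  rewrite /gauss_fun /F exprMn igy_sqrt// (sqr_sqrtr (ltW A0)) -EFinM.
  by congr EFin; ring.
move: HH; rewrite integralT_gauss sqrtrM ?pi_ge0// sqrtrV ?(ltW A0)// => HH.
rewrite mulrC EFinM HH muleA -EFinM mulVf ?gt_eqF// mul1e; exact: erefl.
Qed.

(** A quarter of the exponent absorbs the affine factor, since y <= (4/A) exp(A y/4), and a half
    absorbs exp(y), since A >= 2. What remains is the exact integral at A/4, twice the one at A. *)
Lemma ig_error A al be : 2 <= A -> 0 <= al -> 0 <= be ->
  (\int[leb]_(r in `]0%R, +oo[)
     (igw r * (expR (igy r) * (al * igy r + be)) * expR (- (A * igy r)))%:E <=
   (2 * (4 * al / A + be) * Num.sqrt (pi / A))%:E)%E.
Proof.
move=> A2 al0 be0; have A0 : 0 < A by lra.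
have k0 : 0 <= 4 * al / A + be by rewrite addr_ge0// divr_ge0 ?(ltW A0)// mulr_ge0.
have -> : 2 * (4 * al / A + be) * Num.sqrt (pi / A) = (4 * al / A + be) * Num.sqrt (pi / (A / 4)).
  have -> : pi / (A / 4) = 2 ^+ 2 * (pi / A) by move: (pi : R) => p; field; rewrite gt_eqF.
  by rewrite (@sqrtrM _ (2 ^+ 2))// sqrtr_sqr ger0_norm//; ring.
rewrite EFinM -ig_integral; last by lra.
rewrite -ge0_integralZl_EFin//; last 2 first.
- move=> r /=; rewrite in_itv/= andbT => r0.
  by rewrite lee_fin mulr_ge0 ?expR_ge0// ltW// igw_gt0.
- by apply/measurable_EFinP; exact: measurable_ig.
apply: ge0_le_integral => //.
- move=> r /=; rewrite in_itv/= andbT => r0.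
  rewrite lee_fin mulr_ge0 ?expR_ge0// mulr_ge0 ?(ltW (igw_gt0 r0))//.
  by rewrite mulr_ge0 ?expR_ge0// addr_ge0// mulr_ge0// igy_ge0.
- apply/measurable_EFinP; apply: measurable_continuous_oy => r r0.
  apply: continuousM; last exact: continuous_igexp.
  apply: continuousM; first exact: continuous_igw.
  apply: continuousM.
    by apply: (@continuous_comp _ _ _ igy (@expR R)); [exact: continuous_igy|exact: continuous_expR].
  apply: continuousD; last exact: cvg_cst.
  by apply: continuousM; [exact: cvg_cst|exact: continuous_igy].
- by apply/measurable_EFinP; apply: measurable_funM => //; exact: measurable_ig.
move=> r /=; rewrite in_itv/= andbT => r0; rewrite -EFinM lee_fin.
rewrite [leRHS]mulrCA -[leLHS]mulrA ler_wpM2l ?(ltW (igw_gt0 r0))//.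
have y0 := igy_ge0 r0; set y := igy r in y0 *.
have ey : y <= 4 / A * expR (A / 4 * y).
  have := expR_ge1Dx (A / 4 * y) => h.
  rewrite mulrAC ler_pdivlMr//; nra.
have e1 : 1 <= expR (A / 4 * y).
  have := expR_ge1Dx (A / 4 * y); apply: le_trans; rewrite lerDl mulr_ge0//; lra.
have : al * y + be <= (4 * al / A + be) * expR (A / 4 * y).
  rewrite mulrDl lerD ?ler_peMr//.
  by rewrite (_ : 4 * al / A * _ = al * (4 / A * expR (A / 4 * y))); [rewrite ler_wpM2l|ring].
move=> /(ler_wpM2l (expR_ge0 y)) /(ler_wpM2r (expR_ge0 (- (A * y)))) /le_trans; apply.
rewrite mulrCA -[leLHS]mulrA ler_wpM2l// -!expRD ler_expR; nra.
Qed.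

End InverseGaussian.

(** * Multiplicative closeness to 1 *)

Section Close.
Context {R : realType}.
Implicit Types S T x y : R.

(** Being symmetric under inversion, this relation passes to products and quotients by adding
    exponents of S, so the error of a long product is one power of (1 - d)^(-1). *)
Definition clo S x := S^-1 <= x <= S.

Lemma clo_gt0 S x : 0 < S -> clo S x -> 0 < x.
Proof. by move=> S0 /andP[+ _]; apply: lt_le_trans; rewrite invr_gt0. Qed.

Lemma clo1 S : 1 <= S -> clo S 1.
Proof. by move=> S1; rewrite /clo invf_le1 ?S1// (lt_le_trans _ S1). Qed.

Lemma clo_le S T x : 0 < S -> S <= T -> clo S x -> clo T x.
Proof.
move=> S0 ST /andP[x1 x2]; rewrite /clo (le_trans x2 ST) andbT (le_trans _ x1)//.
by rewrite lef_pV2// posrE// (lt_le_trans S0).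
Qed.

Lemma cloM S T x y : 0 < S -> 0 < T -> clo S x -> clo T y -> clo (S * T) (x * y).
Proof.
move=> S0 T0 sx ty; have x0 := clo_gt0 S0 sx; have y0 := clo_gt0 T0 ty.
move: sx ty => /andP[x1 x2] /andP[y1 y2]; rewrite /clo invfM.
by rewrite !ler_pM ?invr_ge0// ltW.
Qed.

Lemma cloX S x k : 0 < S -> clo S x -> clo (S ^+ k) (x ^+ k).
Proof.
move=> S0 sx; elim: k => [|k IH]; first by rewrite !expr0; exact: clo1.
by rewrite !exprS cloM ?exprn_gt0.
Qed.

Lemma cloV S x : 0 < S -> clo S x -> clo S x^-1.
Proof.
move=> S0 sx; have x0 := clo_gt0 S0 sx; move: sx => /andP[x1 x2].
by rewrite /clo lef_pV2 ?posrE// x2 /= -[leRHS]invrK lef_pV2 ?posrE// invr_gt0.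
Qed.

Lemma cloXle S x j k : 1 <= S -> (j <= k)%N -> clo (S ^+ j) x -> clo (S ^+ k) x.
Proof.
move=> S1 jk; apply: clo_le; first by rewrite exprn_gt0// (lt_le_trans _ S1).
exact: ler_weXn2l.
Qed.

Lemma cloXM S x y j k : 1 <= S -> clo (S ^+ j) x -> clo (S ^+ k) y -> clo (S ^+ (j + k)) (x * y).
Proof. by move=> S1; rewrite exprD; apply: cloM; rewrite exprn_gt0// (lt_le_trans _ S1). Qed.

Lemma cloP S x e k : 1 <= S -> clo S x -> `|e| <= k%:R -> clo (S ^+ k) (x `^ e).
Proof.
move=> S1 sx ek; have S0 : 0 < S by rewrite (lt_le_trans _ S1).
have H c z : 0 <= c -> c <= k%:R -> clo S z -> clo (S ^+ k) (z `^ c).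
  move=> c0 ck sz; have z0 := clo_gt0 S0 sz; move: sz => /andP[z1 z2].
  have Sc : S `^ c <= S ^+ k by rewrite -powR_mulrn ?(ltW S0)// ler_powR.
  have Sc0 : 0 < S `^ c by rewrite powR_gt0.
  apply/andP; split; last by rewrite (le_trans _ Sc)// ge0_ler_powR// nnegrE ltW.
  rewrite (@le_trans _ _ (S `^ c)^-1)//; first by rewrite lef_pV2 ?posrE// exprn_gt0.
  by rewrite -powR_inv1 ?powR_ge0// -powRrM mulrN1 -mulN1r powRrM powR_inv1 ?(ltW S0)// ge0_ler_powR// nnegrE ?invr_ge0 ltW.
have [e0|e0] := leP 0 e; first by apply: H => //; rewrite -(ger0_norm e0).
rewrite -[e]opprK powRN; apply: cloV; first by rewrite exprn_gt0.
by apply: H => //; [lra|rewrite -(ltr0_norm e0)].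
Qed.

Lemma clo_mid S x y : 1 <= S -> clo S x -> clo S y -> clo S ((x + y) / 2).
Proof. by move=> S1 /andP[a b] /andP[c d]; apply/andP; split; lra. Qed.

Lemma clo_exists (rho : R) K : 0 < rho -> exists d, [/\ 0 < d, d < 1 & (1 - d)^-1 ^+ K <= 1 + rho].
Proof.
(* Bernoulli gives (1 - d)^K >= 1 - K d, and this d makes the right side at least 1 - rho/(1 + rho)
   = 1/(1 + rho). *)
move=> r0; pose d := rho / (K.+1%:R * (1 + rho)).
have K0 : 0 < K.+1%:R :> R by rewrite ltr0n.
have d0 : 0 < d by rewrite divr_gt0// mulr_gt0//; lra.
have Kd : K.+1%:R * d = rho / (1 + rho).
  by rewrite /d; field; rewrite !gt_eqF//; lra.
have d1 : d < 1.
  have : 1 * d <= K.+1%:R * d by rewrite ler_wpM2r ?(ltW d0)// ler1n.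
  rewrite Kd mul1r => /le_lt_trans; apply; rewrite ltr_pdivrMr; lra.
have B j : 1 - j%:R * d <= (1 - d) ^+ j.
  elim: j => [|j IH]; first by rewrite expr0 mul0r subr0.
  rewrite exprS; have := ler_wpM2l (_ : 0 <= 1 - d) IH => /(_ ltac:(lra)).
  apply: le_trans; rewrite -natr1; have : 0 <= j%:R * d ^+ 2 by rewrite mulr_ge0// exprn_even_ge0.
  by rewrite expr2; lra.
exists d; split=> //; rewrite exprVn invf_ple ?posrE ?exprn_gt0//; [|lra|lra].
apply: le_trans (B K); have : K%:R * d <= K.+1%:R * d by rewrite ler_wpM2r ?(ltW d0)// ler_nat.
rewrite Kd; have -> : (1 + rho)^-1 = 1 - rho / (1 + rho) by field; rewrite gt_eqF//; lra.
lra.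
Qed.

Lemma clo_sub (d x : R) : 0 < d -> d < 1 -> `|x - 1| <= d -> clo (1 - d)^-1 x.
Proof.
move=> d0 d1; rewrite ler_norml => /andP[a b]; rewrite /clo invrK; apply/andP; split; first by lra.
rewrite (@le_trans _ _ (1 + d))//; first by lra.
by rewrite -[leRHS]mul1r ler_pdivlMr; [nra|lra].
Qed.

End Close.

(** * The tilted density near its centre *)

Section TiltedDensity.
Context {R : realType}.
Implicit Types a y p X : R.

(** The tilted density of the variable at pole 0 in the variable y = b t, up to constants
    ([dens_gden]); [a] is the tilted mean of its compound Poisson part. *)
Definition gden n a y : R := expR (- (a + y)) * y ^+ n.-1 * hG n.*2 (a * y).

Lemma gden_gt0 n a y : (0 < n)%N -> 0 < a -> 0 < y -> 0 < gden n a y.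
Proof.
move=> n0 a0 y0; rewrite !mulr_gt0 ?expR_gt0 ?exprn_gt0// hG_gt0 ?double_gt0//.
by rewrite ltW// mulr_gt0.
Qed.

(** With y = a p^2 the Bessel argument is 2 sqrt(a y) = 2 a p, and moving exp(2 a p) into [hPhi]
    completes the square a (1 - p)^2. *)
Lemma gden_ratio n a p : (0 < n)%N -> 0 < a -> 0 < p ->
  gden n a (a * p ^+ 2) / gden n a a =
  expR (- (a * (1 - p) ^+ 2)) * (p ^+ 2) ^+ n.-1 * (hPhi n.*2 (2 * a * p) / hPhi n.*2 (2 * a)).
Proof.
move=> n0 a0 p0; have n20 : (0 < n.*2)%N by rewrite double_gt0.
have E q : 0 < q -> gden n a (a * q ^+ 2) =
    expR (- (a * (1 - q) ^+ 2)) * (a * q ^+ 2) ^+ n.-1 * hPhi n.*2 (2 * a * q).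
  move=> q0; rewrite /gden /hPhi (_ : (2 * a * q) ^+ 2 / 4 = a * (a * q ^+ 2)); last by field.
  rewrite (_ : - (a + a * q ^+ 2) = - (a * (1 - q) ^+ 2) + - (2 * a * q)); last by ring.
  by rewrite expRD -!mulrA; congr (_ * _); rewrite mulrCA.
have E1 := E 1 ltr01; rewrite expr1n mulr1 subrr expr0n /= mulr0 oppr0 expR0 mul1r mulr1 in E1.
rewrite E// E1 exprMn; have an : a ^+ n.-1 != 0 by rewrite expf_neq0// gt_eqF.
have hn : hPhi n.*2 (2 * a) != 0 by rewrite gt_eqF// hPhi_gt0.
move: (hPhi n.*2 (2 * a)) hn (hPhi n.*2 (2 * a * p)) (expR _) ((p ^+ 2) ^+ n.-1) (a ^+ n.-1) an.
by move=> h hn h' e P A An; field; rewrite An hn.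
Qed.

Lemma sqrt_ex a y : 0 < a -> 0 < y -> exists2 p, 0 < p & y = a * p ^+ 2.
Proof.
move=> a0 y0; exists (Num.sqrt (y / a)); first by rewrite sqrtr_gt0 divr_gt0.
by rewrite sqr_sqrtr ?divr_ge0 ?ltW// mulrC divfK// gt_eqF.
Qed.

Lemma hPhi_mul_ge k X p : (0 < k)%N -> 0 < X -> 1 <= p ->
  hPhi k X <= p ^+ k * hPhi k (X * p).
Proof.
move=> k0 X0 p1; have XX : X <= X * p by rewrite ler_peMr// ltW.
by have := hPhi_ge k0 (ltW X0) XX; rewrite (@exprMn _ _ X p) -[leRHS]mulrA ler_pM2l// exprn_gt0.
Qed.

Lemma hPhi_mul_le k X p : (0 < k)%N -> 0 < X -> 0 <= p -> p <= 1 ->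
  p ^+ k * hPhi k (X * p) <= hPhi k X.
Proof.
move=> k0 X0 p0 p1; have XX : X * p <= X by rewrite ler_piMr// ltW.
have := hPhi_ge k0 (mulr_ge0 (ltW X0) p0) XX.
by rewrite (@exprMn _ _ X p) -[leLHS]mulrA ler_pM2l// exprn_gt0.
Qed.

(** The exponent 3n collects 1 from the Gaussian factor, where a kap^2 <= 1 is used, n - 1 from the
    power and 2n from [hPhi]. *)
Lemma gden_local n a kap d y : (0 < n)%N -> 0 < a -> 0 < kap -> kap <= 1 -> a * kap ^+ 2 <= 1 ->
  0 < d -> d < 1 -> `|y - a| <= d * a * kap ->
  0 < y /\ clo ((1 - d)^-1 ^+ (3 * n)) (gden n a y / gden n a a).
Proof.
move=> n0 a0 k0 k1 ak d0 d1 ya; have S1 : 1 <= (1 - d)^-1 by rewrite invf_ge1; lra.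
have y0 : 0 < y.
  by move: ya; rewrite ler_norml => /andP[h _]; have : d * a * kap < a; [rewrite -mulrA mulrCA gtr_pMr// ; nra|lra].
split=> //; have [p p0 yE] := sqrt_ex a0 y0; rewrite yE gden_ratio//.
have P1 : `|p ^+ 2 - 1| <= d * kap.
  have : `|a * (p ^+ 2 - 1)| <= a * (d * kap) by rewrite mulrBr mulr1 -yE mulrA [a * d]mulrC.
  by rewrite normrM (gtr0_norm a0) ler_pM2l.
have p1 : `|p - 1| <= d * kap.
  apply: le_trans P1; rewrite (_ : p ^+ 2 - 1 = (p - 1) * (p + 1)); last by ring.
  by rewrite normrM ler_peMr// ger0_norm; lra.
have dk : d * kap <= d by rewrite ler_piMr// ltW.
have cp : clo (1 - d)^-1 p by apply: clo_sub => //; exact: le_trans p1 dk.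
have cP : clo (1 - d)^-1 (p ^+ 2) by apply: clo_sub => //; exact: le_trans P1 dk.
have S0 : 0 < (1 - d)^-1 by rewrite (lt_le_trans _ S1).
have ce : clo ((1 - d)^-1 ^+ 1) (expR (- (a * (1 - p) ^+ 2))).
  rewrite expr1 /clo invrK; apply/andP; split.
    apply: le_trans (expR_ge1Dx _); rewrite lerD2l lerN2.
    have : (1 - p) ^+ 2 <= (d * kap) ^+ 2.
      by rewrite -(@real_normK _ (1 - p)) ?num_real// distrC lerXn2r ?nnegrE ?mulr_ge0 ?(ltW d0) ?(ltW k0).
    move=> /(ler_wpM2l (ltW a0)) /le_trans; apply.
    rewrite exprMn mulrCA; apply: (@le_trans _ _ (d ^+ 2 * 1)).
      by rewrite ler_wpM2l// exprn_even_ge0.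
    by rewrite mulr1 expr2 ler_piMr; lra.
  apply: le_trans S1; rewrite -expR0 ler_expR oppr_le0 mulr_ge0 ?(ltW a0)//.
  exact: exprn_even_ge0.
have n20 : (0 < n.*2)%N by rewrite double_gt0.
have ch : clo ((1 - d)^-1 ^+ n.*2) (hPhi n.*2 (2 * a * p) / hPhi n.*2 (2 * a)).
  have a20 : 0 < 2 * a by rewrite mulr_gt0.
  have h1 := hPhi_gt0 (2 * a) n20; have h2 := hPhi_gt0 (2 * a * p) n20.
  have /andP[q1 q2] := cloX n.*2 S0 cp; have pn := exprn_gt0 n.*2 p0.
  have Sn := ler_weXn2l S1 (leq0n n.*2); rewrite expr0 in Sn.
  have Sn0 : 0 < (1 - d)^-1 ^+ n.*2 by rewrite exprn_gt0.
  have [pl|pl] := leP 1 p.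
    have le1 : 2 * a <= 2 * a * p by rewrite ler_peMr// mulr_ge0// ltW.
    have := hPhi_le n20 (_ : 0 <= 2 * a) le1 => /(_ ltac:(lra)) A.
    have B := hPhi_mul_ge n20 a20 pl.
    apply/andP; split; last by rewrite (le_trans _ Sn)// ler_pdivrMr// mul1r.
    by rewrite ler_pdivlMr// ler_pdivrMl// (le_trans B)// ler_wpM2r// ltW.
  have le1 : 2 * a * p <= 2 * a by exact: ler_piMr (ltW a20) (ltW pl).
  have p20 : 0 <= 2 * a * p by rewrite !mulr_ge0 ?ltW.
  have A := hPhi_le n20 p20 le1; have B := hPhi_mul_le n20 a20 (ltW p0) (ltW pl).
  apply/andP; split; first by rewrite (@le_trans _ _ 1)// ?invf_le1// ler_pdivlMr// mul1r.
  by rewrite ler_pdivrMr// -ler_pdivrMl// (le_trans _ B)// ler_wpM2r// ltW.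
apply: (cloXle S1 _ (cloXM S1 (cloXM S1 ce (cloX n.-1 S0 cP)) ch)).
by move: n0; clear; lia.
Qed.

Lemma expr_le_expR (x : R) k : 0 <= x -> x ^+ k <= k`!%:R * expR x.
Proof.
move=> x0; case: k => [|k]; first by rewrite expr0 mul1r; have := expR_ge1Dx x; lra.
have h := expR_ge1Dxn k x0; rewrite -ler_pdivrMl ?ltr0n ?fact_gt0// mulrC; lra.
Qed.

(** The quotient of [hPhi] is harmless for p >= 1/2 and for bounded a. For p < 1/2 and large a it
    may grow like a^k, which the Gaussian factor exp(-a/4) compensates. The constant adds the bounds
    of the separate cases. *)
Lemma gden_global n : (0 < n)%N -> exists2 C : R, 0 < C &
  forall a y, 0 < a -> 0 < y -> gden n a y / gden n a a <= C * (1 + y / a) ^+ n.-1.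
Proof.
move=> n0; have n20 : (0 < n.*2)%N by rewrite double_gt0.
(* [M] bounds (2a)^k exp(-a/4): write 2a = 8 (a/4) and use x^k <= k! exp(x). *)
set k := n.*2 in n20 *; pose M : R := (8 ^+ k) * k`!%:R.
have M1 : 1 <= M by rewrite mulr_ege1 ?exprn_ege1 ?ler1n ?fact_gt0.
pose C0 : R := hPhi k 0 / hPhi k 1.
have h0 : 0 < hPhi k 0 :> R by exact: hPhi_gt0.
have h1 : 0 < hPhi k 1 :> R by exact: hPhi_gt0.
have C00 : 0 < C0 by rewrite divr_gt0.
exists (1 + 2 ^+ k + C0 * M).
  by rewrite !addr_gt0// ?exprn_gt0// mulr_gt0//; lra.
move=> a y a0 y0; have [p p0 ->] := sqrt_ex a0 y0; rewrite gden_ratio//.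
have -> : a * p ^+ 2 / a = p ^+ 2 by rewrite mulrAC divff ?mul1r// gt_eqF.
have CM : 0 < C0 * M by rewrite mulr_gt0//; lra.
have k2 : 0 < 2 ^+ k :> R by rewrite exprn_gt0.
have pp : (p ^+ 2) ^+ n.-1 <= (1 + p ^+ 2) ^+ n.-1.
  by rewrite lerXn2r ?nnegrE ?addr_ge0 ?exprn_ge0 ?(ltW p0)// lerDr.
have pp0 : 0 <= (p ^+ 2) ^+ n.-1 by rewrite !exprn_ge0 ?ltW.
set e := expR _; set h := hPhi _ _ / _; have h2 : 0 < hPhi k (2 * a) by exact: hPhi_gt0.
have h3 : 0 < hPhi k (2 * a * p) by exact: hPhi_gt0.
have a20 : 0 < 2 * a by rewrite mulr_gt0.
have eh : e * h <= 1 + 2 ^+ k + C0 * M.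
  have e1 : e <= 1.
    by rewrite -[leRHS]expR0 ler_expR oppr_le0 mulr_ge0 ?(ltW a0)// exprn_even_ge0.
  have e0 : 0 < e by exact: expR_gt0.
  have hh : 0 < h by rewrite divr_gt0.
  have ehh : e * h <= h by rewrite ler_piMl// ltW.
  have [pl|pl] := leP 1 p.
    have le1 : 2 * a <= 2 * a * p by rewrite ler_peMr// mulr_ge0// ltW.
    have := hPhi_le n20 (_ : 0 <= 2 * a) le1 => /(_ ltac:(lra)) A.
    have : h <= 1 by rewrite ler_pdivrMr// mul1r.
    lra.
  have le1 : 2 * a * p <= 2 * a by exact: ler_piMr (ltW a20) (ltW pl).
  have p20 : 0 <= 2 * a * p by rewrite !mulr_ge0 ?ltW.
  have [ph|ph] := leP 2^-1 p.
    have B := hPhi_mul_le n20 a20 (ltW p0) (ltW pl).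
    have : h <= 2 ^+ k.
      rewrite ler_pdivrMr// -ler_pdivrMl// (le_trans _ B)// ler_wpM2r ?(ltW h3)//.
      by rewrite -exprVn lerXn2r ?nnegrE ?invr_ge0// ltW.
    lra.
  have eE : e <= expR (- (a / 4)).
    rewrite ler_expR lerN2 ler_wpM2l ?(ltW a0)//.
    by rewrite (_ : 4^-1 = 2^-1 ^+ 2 :> R); [rewrite lerXn2r ?nnegrE ?invr_ge0//; lra|field].
  have A1 : hPhi k (2 * a * p) <= hPhi k 0 by exact: hPhi_le.
  have [al|al] := leP (2 * a) 1.
    have : h <= C0.
      rewrite ler_pM ?invr_ge0 ?(ltW h3) ?(ltW h2)// lef_pV2 ?posrE//.
      by apply: hPhi_le => //; lra.
    have : C0 * 1 <= C0 * M by rewrite ler_wpM2l// ltW.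
    lra.
  have := hPhi_ge n20 (ler01 : 0 <= 1 :> R) (ltW al); rewrite expr1n mul1r => A2.
  have a4 : 0 <= a / 4 by lra.
  have := expr_le_expR k a4; rewrite (_ : a / 4 = 2 * a / 8); last by field.
  rewrite expr_div_n ler_pdivrMr ?exprn_gt0// => A3.
  have : e * h <= C0 * M.
    apply: (@le_trans _ _ (expR (- (2 * a / 8)) * (hPhi k 0 / (hPhi k 1 / (2 * a) ^+ k)))).
      rewrite (_ : 2 * a / 8 = a / 4); last by field.
      have a2k : 0 < (2 * a) ^+ k by rewrite exprn_gt0// mulr_gt0.
      rewrite ler_pM ?(ltW e0) ?(ltW hh)// ler_pM ?invr_ge0 ?(ltW h3) ?(ltW h2)//.
      by rewrite lef_pV2 ?posrE// ?divr_gt0// ler_pdivrMr// mulrC.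
    rewrite invf_div mulrCA mulrA [X in _ <= X](_ : _ = hPhi k 0 / hPhi k 1 * M)//.
    rewrite [leLHS](_ : _ = hPhi k 0 / hPhi k 1 * (expR (- (2 * a / 8)) * (2 * a) ^+ k)); last by field; rewrite gt_eqF.
    rewrite ler_wpM2l ?(ltW C00)// expRN ler_pdivrMl ?expR_gt0// (le_trans A3)//.
    by rewrite /M [8 ^+ k * _]mulrC mulrA [expR _ * _]mulrC.
  lra.
rewrite mulrAC ler_pM// mulr_ge0 ?expR_ge0//; rewrite divr_ge0// ltW//.
Qed.

End TiltedDensity.

(** * Concentration of the remaining variables *)

Section Gaps.
Context {R : realType}.
Implicit Types (k N : nat) (q h : R).

(** The tilt theta^2 approaches [pole 0] from below, so its distance to every other pole is bounded
    below by these numbers, uniformly. *)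
Definition gap k : R := pole k.+1 - pole 0.

Lemma gapE k : gap k = pi ^+ 2 * (k.+1%:R * k.+3%:R).
Proof. by rewrite /gap /pole -!natr1; ring. Qed.

Lemma pi2_ge4 : 4 <= pi ^+ 2 :> R.
Proof. by rewrite (_ : 4 = 2 ^+ 2); [rewrite lerXn2r ?nnegrE ?pi_ge0 ?pi_ge2|ring]. Qed.

Lemma gap_ge k : 12 <= gap k.
Proof.
rewrite gapE (_ : 12 = 4 * (1 * 3) :> R); last by ring.
by apply: ler_pM => //; [exact: pi2_ge4|rewrite ler_pM ?ler1n ?ler_nat].
Qed.

Lemma gap_gt0 k : 0 < gap k.
Proof. by have := gap_ge k; lra. Qed.

Lemma pole_le_gap k : pole k.+1 <= 2 * gap k.
Proof.
rewrite gapE /pole exprMn [leRHS]mulrCA ler_wpM2l ?exprn_even_ge0// -!natrX -!natrM ler_nat; nia.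
Qed.

(** Comparison with the telescoping series of 1/((k+1)(k+2)). *)
Lemma sum_gap_le N : \sum_(k < N) (gap k)^-1 <= 1.
Proof.
have : \sum_(k < N) (gap k)^-1 <= 1 - N.+1%:R^-1.
  elim: N => [|N IH]; first by rewrite big_ord0 invr1 subrr.
  have S : (gap N)^-1 <= N.+1%:R^-1 - N.+2%:R^-1.
    rewrite gapE.
    have -> : N.+1%:R^-1 - N.+2%:R^-1 = (N.+1%:R * N.+2%:R)^-1 :> R.
      by rewrite -[N.+2%:R]natr1 invfM; have := ltr0Sn R N; move: (N.+1%:R) => x x0; field; rewrite !gt_eqF//; lra.
    rewrite lef_pV2 ?posrE ?mulr_gt0 ?exprn_gt0 ?pi_gt0 ?ltr0n//.
    rewrite -[leLHS]mul1r ler_pM ?mulr_ge0//; first by have := pi2_ge4; lra.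
    by rewrite ler_wpM2l// ler_nat.
  rewrite big_ord_recr /= (le_trans (lerD IH S))//.
  by rewrite addrA subrK.
move/le_trans; apply; rewrite lerBlDr lerDl invr_ge0//.
Qed.

Variables (n : nat) (u : R).
Hypotheses (u0 : 0 <= u).

(* The tilted mean of the sum of the variables attached to the poles 1, ..., N. *)
Definition tmean N q : R := u / 2 * \sum_(k < N) pole k.+1 / (pole k.+1 - q) ^+ 2.

Lemma tmean_le N q : q <= pole 0 -> tmean N q <= u.
Proof.
move=> q0; rewrite /tmean [leRHS](_ : _ = u / 2 * 2); last by field.
rewrite ler_wpM2l ?divr_ge0//.
apply: (@le_trans _ _ (\sum_(k < N) 2 * (gap k)^-1)).
  apply: ler_sum => k _; have g0 := gap_gt0 k; have pg := pole_le_gap k.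
  have cq : gap k <= pole k.+1 - q by rewrite /gap; lra.
  apply: (@le_trans _ _ (2 * gap k / gap k ^+ 2)).
    rewrite ler_pM ?invr_ge0 ?exprn_even_ge0 ?(ltW (pole_gt0 _))//.
    have cq0 := lt_le_trans g0 cq.
    by rewrite lef_pV2 ?posrE ?exprn_gt0// lerXn2r ?nnegrE ?(ltW g0) ?(ltW cq0).
  by rewrite le_eqVlt; apply/orP; left; apply/eqP; field; rewrite gt_eqF.
by rewrite -mulr_sumr ler_piMr// sum_gap_le.
Qed.

(** The exponent l/(c - l) is expanded to first order at q with its exact remainder; the factor from
    the Gamma law is bounded by 1 + x <= exp(x). *)
Lemma lap_ratio_le c q h : 0 < c -> q < c -> q + h < c ->
  lap n u c (q + h) / lap n u c q <=
  expR (h * (u / 2 * (c / (c - q) ^+ 2)) + u / 2 * (c * h ^+ 2 / ((c - q) ^+ 2 * (c - q - h)))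
   + n%:R * (h / (c - q - h))).
Proof.
move=> c0 qc qhc; have d0 : 0 < c - q by lra.
have d1 : 0 < c - q - h by lra.
have E : lap n u c (q + h) / lap n u c q =
  expR (h * (u / 2 * (c / (c - q) ^+ 2)) + u / 2 * (c * h ^+ 2 / ((c - q) ^+ 2 * (c - q - h)))) *
  (1 + h / (c - q - h)) ^+ n.
  rewrite /lap opprD addrA invfM mulrACA -expRN -expRD -exprVn -exprMn.
  congr (expR _ * _ ^+ _); field; rewrite !gt_eqF//.
rewrite E [leRHS]expRD ler_wpM2l ?expR_ge0// (mulrC n%:R) expRM_natr lerXn2r ?nnegrE ?expR_ge0 ?expR_ge1Dx//.
by rewrite (_ : 1 + _ = (c - q) / (c - q - h)); [rewrite divr_ge0// ltW|field; rewrite gt_eqF].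
Qed.

(** For each pole the second-order remainder is at most 1/gap, because u h^2 <= 1, and the Gamma
    part at most 2n/gap, because |h| <= 1. Summing with [sum_gap_le] gives 1 + 2n for every N. *)
Lemma prod_lap_ratio_le N q h : q <= pole 0 -> `|h| <= 1 -> u * h ^+ 2 <= 1 ->
  \prod_(k < N) lap n u (pole k.+1) (q + h) <=
  expR (h * tmean N q + 1 + 2 * n%:R) * \prod_(k < N) lap n u (pole k.+1) q.
Proof.
move=> q0; rewrite ler_norml => /andP[h1 h2] uh.
have P k : 0 < pole k.+1 :> R by exact: pole_gt0.
have Q k : q < pole k.+1 by have := gap_ge k; rewrite /gap; lra.
have QH k : q + h < pole k.+1 by have := gap_ge k; rewrite /gap; lra.
have L k : 0 < lap n u (pole k.+1) q by exact: lap_gt0.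
have step k : lap n u (pole k.+1) (q + h) <=
    expR (h * (u / 2 * (pole k.+1 / (pole k.+1 - q) ^+ 2)) + (1 + 2 * n%:R) * (gap k)^-1) * lap n u (pole k.+1) q.
  rewrite -ler_pdivrMr// (le_trans (lap_ratio_le (P k) (Q k) (QH k)))// ler_expR.
  have := gap_ge k; have := pole_le_gap k; have := P k; rewrite /gap.
  move: (pole k.+1) (pole 0) q0 => c p q0 c0 pg g.
  set D := c - p in pg g *; have cq : D <= c - q by rewrite /D; lra.
  have D0 : 0 < D by lra.
  have ch : D / 2 <= c - q - h by lra.
  rewrite -addrA lerD2l mulrDl mul1r lerD//.
    apply: (@le_trans _ _ (1 / 2 * (2 * D / (D ^+ 2 * (D / 2))))); last first.
      rewrite [leLHS](_ : _ = 2 / D * D^-1); last by field; rewrite gt_eqF.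
      by rewrite ler_piMl ?invr_ge0 ?(ltW D0)// ler_pdivrMr//; lra.
    rewrite [leLHS](_ : _ = (u * h ^+ 2) / 2 * (c / ((c - q) ^+ 2 * (c - q - h)))); last first.
      by field; rewrite !gt_eqF//; lra.
    have A0 : 0 < D ^+ 2 * (D / 2) by apply: mulr_gt0; [exact: exprn_gt0|lra].
    have B0 : D ^+ 2 * (D / 2) <= (c - q) ^+ 2 * (c - q - h).
      apply: ler_pM; [exact: exprn_even_ge0|lra| |exact: ch].
      by rewrite lerXn2r ?nnegrE//; lra.
    have B1 := lt_le_trans A0 B0.
    have uh0 : 0 <= u * h ^+ 2 / 2 by rewrite divr_ge0// mulr_ge0// exprn_even_ge0.
    apply: ler_pM => //; [by rewrite divr_ge0 ?ltW|lra|].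
    by apply: ler_pM; rewrite ?invr_ge0 ?(ltW c0) ?(ltW B1)// lef_pV2.
  rewrite mulrAC [leRHS]mulrC ler_wpM2l//.
  rewrite ler_pdivrMr; last by lra.
  rewrite mulrAC ler_pdivlMr//; nra.
apply: (@le_trans _ _ (\prod_(k < N) (expR (h * (u / 2 * (pole k.+1 / (pole k.+1 - q) ^+ 2)) + (1 + 2 * n%:R) * (gap k)^-1) * lap n u (pole k.+1) q))).
  by apply: ler_prod => k _; rewrite step andbT ltW// lap_gt0.
rewrite big_split /= ler_wpM2r//; first by apply: prodr_ge0 => k _; exact: ltW.
rewrite -expR_sum ler_expR big_split /= -!mulr_sumr -addrA lerD//.
by rewrite ler_piMr// ?addr_ge0// ?mulr_ge0// sum_gap_le.
Qed.

End Gaps.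

Section Pointwise.
Context {R : realType}.
Implicit Types a r z : R.

Lemma powR_half m r : 0 < r -> r `^ (m%:R / 2) = Num.sqrt r ^+ m.
Proof.
by move=> r0; rewrite mulrC powRrM powR12_sqrt ?(ltW r0)// powR_mulrn// sqrtr_ge0.
Qed.

Lemma clo_sqrt (S r : R) : 1 <= S -> clo S r -> clo S (Num.sqrt r).
Proof.
move=> S1 sr; have S0 : 0 < S by rewrite (lt_le_trans _ S1).
have r0 := clo_gt0 S0 sr.
by rewrite -powR12_sqrt ?(ltW r0)// -[S]expr1; apply: cloP; rewrite // ger0_norm ?invr_ge0// invf_le1 ?ler1n.
Qed.

(** Both r^(-m/2) and [igw] equal 1 at r = 1; this is the sense in which the weight may be
    exchanged. *)
Lemma igw_local m (S r : R) : 1 <= S -> clo S r ->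
  clo (S ^+ (m + 2)) ((r `^ (m%:R / 2))^-1 / igw r).
Proof.
move=> S1 sr; have S0 : 0 < S by rewrite (lt_le_trans _ S1).
have r0 := clo_gt0 S0 sr; have sq := clo_sqrt S1 sr; rewrite powR_half//.
have Sn k : 0 < S ^+ k by rewrite exprn_gt0.
apply: cloXM => //; first by apply: cloV => //; exact: cloX.
have S2 : 1 <= S ^+ 2 by rewrite exprn_ege1.
have rs : clo (S ^+ 2) (r * Num.sqrt r) by rewrite expr2; exact: cloM.
have ss : clo (S ^+ 2) (Num.sqrt r) by apply: (cloXle (j := 1)).
by apply: cloV => //; apply: clo_mid => //; exact: cloV.
Qed.

(** Since igy r = r - 2 + 1/r, its exponential dominates every power at 0 and at infinity; exp(4)
    comes from (1 + r) + (1 + 1/r) = 4 + igy r. *)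
Lemma powR_le_ig m n : (0 < m)%N -> exists2 C : R, 0 < C & forall r, 0 < r ->
  (r `^ (m%:R / 2))^-1 * (1 + 2 * r) ^+ n <= C * (igw r * expR (igy r)).
Proof.
move=> m0; pose F : R := (m.-1`!)%:R * (2 ^+ n * n`!%:R).
have F0 : 0 < F by rewrite !mulr_gt0 ?exprn_gt0// ltr0n fact_gt0.
exists (2 * F * expR 4); first by rewrite !mulr_gt0 ?expR_gt0.
move=> r r0; rewrite powR_half//; have s0 : 0 < Num.sqrt r by rewrite sqrtr_gt0.
have ss := sqr_sqrtr (ltW r0); set s := Num.sqrt r in s0 ss *.
have r1 : 0 <= 1 + r^-1 by rewrite addr_ge0// invr_ge0 ltW.
have sV : s^-1 <= 1 + r^-1.
  rewrite -ss; have : 0 <= (s^-1 - 2^-1) ^+ 2 by rewrite exprn_even_ge0.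
  rewrite -exprVn sqrrB; lra.
have A1 : (s ^+ m)^-1 <= s^-1 * (m.-1`!%:R * expR (1 + r^-1)).
  rewrite -exprVn -(prednK m0) exprS ler_wpM2l ?invr_ge0 ?(ltW s0)//=.
  apply: le_trans (expr_le_expR _ r1).
  by rewrite lerXn2r ?nnegrE ?invr_ge0 ?(ltW s0).
have A2 : (1 + 2 * r) ^+ n <= 2 ^+ n * n`!%:R * expR (1 + r).
  have r2 : 0 <= 1 + r by lra.
  rewrite -mulrA; apply: le_trans (ler_wpM2l _ (expr_le_expR n r2)) => //.
  by rewrite -exprMn lerXn2r ?nnegrE//; lra.
have iw : s^-1 <= 2 * igw r.
  by rewrite /igw -/s mulrC divfK// lerDl invr_ge0 mulr_ge0 ?ltW.
have e4 : expR (1 + r^-1) * expR (1 + r) = expR 4 * expR (igy r).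
  by rewrite -!expRD; congr expR; rewrite /igy; field; rewrite gt_eqF.
have p1 : 0 <= (1 + 2 * r) ^+ n by rewrite exprn_ge0//; lra.
have i0 : 0 <= (s ^+ m)^-1 by rewrite invr_ge0 exprn_ge0// ltW.
apply: (le_trans (ler_pM i0 p1 A1 A2)).
rewrite [leLHS](_ : _ = s^-1 * (F * (expR (1 + r^-1) * expR (1 + r)))); last by rewrite /F; ring.
rewrite e4 [leRHS](_ : _ = 2 * igw r * (F * (expR 4 * expR (igy r)))); last by ring.
by rewrite ler_wpM2r// !mulr_ge0 ?expR_ge0// ltW.
Qed.

(* The tilted density of the first variable divided by its value at the centre [a],
   as a function of the normalised time [r]. *)
Definition Hfun n m a b tau0 z r : R :=
  if 0 < b * (tau0 * r - z) then
    (r `^ (m%:R / 2))^-1 * (gden n a (b * (tau0 * r - z)) / gden n a a) else 0.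

(** At r = 1, z = z0 the density is evaluated at its centre. When both r and z are near,
    [gden_local] gives relative accuracy rho; otherwise one of the two terms in [D] is at least of
    order 1 and dominates the crude global bound, as in Chebyshev's inequality. *)
Lemma Hfun_approx n m (rho : R) : (0 < n)%N -> (0 < m)%N -> 0 < rho -> rho < 1 ->
  exists2 C : R, 0 < C &
  forall a kap b tau0 z0 r z, 0 < a -> 0 < kap -> kap <= 1 -> a * kap ^+ 2 <= 1 ->
    0 < b -> 0 < tau0 -> a = b * (tau0 - z0) -> b * tau0 <= 2 * a -> 0 <= z -> 0 < r ->
    let D := igw r * (expR (igy r) *
       (C / kap ^+ 2 * igy r + C * ((z - z0) ^+ 2 * (b / (a * kap)) ^+ 2))) in
    Hfun n m a b tau0 z r <= (1 + rho) * igw r + D /\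
    (1 - rho) * igw r <= Hfun n m a b tau0 z r + D.
Proof.
move=> n0 m0 r0 r1.
have [d [d0 d1 dK]] := @clo_exists R rho (m + 2 + 3 * n) r0.
have S1 : 1 <= (1 - d)^-1 by rewrite invf_ge1; lra.
have [Cg Cg0 HCg] := @gden_global R n n0.
have [Ci Ci0 HCi] := @powR_le_ig m n.-1 m0.
(* The added 1 makes [D] exceed [igw r] as well, as the lower bound requires when [Hfun] is small or
   0. *)
pose Cf := Cg * Ci + 1; have Cf0 : 0 < Cf by rewrite addr_gt0// mulr_gt0.
exists (Cf * (64 / d ^+ 2)); first by rewrite mulr_gt0// divr_gt0// exprn_gt0.
move=> a kap b tau0 z0 r z a0 k0 k1 ak b0 t0 aE bt z_0 rr0; cbv zeta.
set D := (X in _ + X); have w0 := igw_gt0 rr0; have y0 := igy_ge0 rr0.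
have D0 : 0 <= D.
  have CC0 : 0 < Cf * (64 / d ^+ 2) by rewrite mulr_gt0// divr_gt0// exprn_gt0.
  rewrite /D; apply: (mulr_ge0 (ltW w0)); apply: (mulr_ge0 (expR_ge0 _)); apply: addr_ge0.
    by apply: (mulr_ge0 _ y0); rewrite divr_ge0 ?exprn_even_ge0// ltW.
  by apply: (mulr_ge0 (ltW CC0)); rewrite mulr_ge0// exprn_even_ge0.
set Y := b * (tau0 * r - z); have YE : Y - a = b * tau0 * (r - 1) - b * (z - z0).
  by rewrite /Y aE; ring.
have dk : d / 4 * kap <= d / 4 by rewrite ler_piMr//; lra.
have d2 : 0 < d ^+ 2 by rewrite exprn_gt0.
have kn := lt0r_neq0 k0; have dn := lt0r_neq0 d0.
have far : 1 <= 64 / d ^+ 2 / kap ^+ 2 * igy r + 64 / d ^+ 2 * ((z - z0) ^+ 2 * (b / (a * kap)) ^+ 2) ->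
    Hfun n m a b tau0 z r <= (1 + rho) * igw r + D /\
    (1 - rho) * igw r <= Hfun n m a b tau0 z r + D.
  move=> h; set q := igw r * expR (igy r); have q0 : 0 < q by rewrite mulr_gt0 ?expR_gt0.
  have DE : Cf * q <= D.
    rewrite /D [leRHS](_ : _ = Cf * q * (64 / d ^+ 2 / kap ^+ 2 * igy r + 64 / d ^+ 2 * ((z - z0) ^+ 2 * (b / (a * kap)) ^+ 2))).
      by rewrite ler_peMr// mulr_ge0 ?ltW.
    by rewrite /q; ring.
  have Hq : Hfun n m a b tau0 z r <= (Cg * Ci) * q.
    rewrite /Hfun -/Y; case: ifPn => [Y0|_]; last exact: (mulr_ge0 (ltW (mulr_gt0 Cg0 Ci0)) (ltW q0)).
    rewrite -mulrA; apply: le_trans (ler_wpM2l (ltW Cg0) (HCi r rr0)).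
    rewrite [leRHS]mulrCA ler_wpM2l ?invr_ge0 ?powR_ge0//.
    apply: (le_trans (HCg a Y a0 Y0)); rewrite ler_wpM2l ?(ltW Cg0)//.
    have Yr : Y / a <= 2 * r.
      rewrite ler_pdivrMr// (@le_trans _ _ (b * tau0 * r))//.
        by rewrite /Y mulrBr mulrA gerDl oppr_le0 mulr_ge0// ltW.
      by rewrite [leRHS]mulrAC ler_wpM2r// ltW.
    have Ya : 0 < Y / a by rewrite divr_gt0.
    by rewrite lerXn2r ?nnegrE ?lerD2l//; lra.
  have H0 : 0 <= Hfun n m a b tau0 z r.
    rewrite /Hfun -/Y; case: ifPn => // Y0.
    by rewrite mulr_ge0 ?invr_ge0 ?powR_ge0// divr_ge0// ltW// gden_gt0.
  have qw : igw r <= q by rewrite ler_peMr ?(ltW w0)//; have := expR_ge1Dx (igy r); lra.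
  have rw : 0 < rho * igw r by rewrite mulr_gt0.
  have CC : Cf * q = Cg * Ci * q + q by rewrite /Cf mulrDl mul1r.
  have CG0 : 0 < Cg * Ci * q := mulr_gt0 (mulr_gt0 Cg0 Ci0) q0.
  by split; rewrite ?mulrDl ?mulrBl mul1r; lra.
have z2 : 0 <= (z - z0) ^+ 2 * (b / (a * kap)) ^+ 2 by rewrite mulr_ge0// exprn_even_ge0.
have c1 : 0 <= 64 / d ^+ 2 by rewrite divr_ge0// ltW.
(* As b tau0 <= 2a, an offset d kap/4 in r moves y by at most d a kap/2; the threshold for z below
   uses the other half of the window of [gden_local]. *)
have [rn|rf] := leP `|r - 1| (d / 4 * kap); last first.
  apply: far; rewrite (@le_trans _ _ (64 / d ^+ 2 / kap ^+ 2 * igy r))//; last by rewrite lerDl mulr_ge0.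
  have : (d / 8 * kap) ^+ 2 <= igy r.
    rewrite /igy ler_pdivlMr//; have [r4|r4] := leP r 4.
      have : (d / 4 * kap) ^+ 2 <= (r - 1) ^+ 2.
        rewrite -(@real_normK _ (r - 1)) ?num_real// lerXn2r ?nnegrE ?(ltW rf)//.
        by rewrite mulr_ge0 ?divr_ge0// ltW.
      have : (d / 8 * kap) ^+ 2 * r <= (d / 8 * kap) ^+ 2 * 4 by rewrite ler_wpM2l ?exprn_even_ge0.
      by rewrite (_ : (d / 8 * kap) ^+ 2 * 4 = (d / 4 * kap) ^+ 2 / 1); [rewrite divr1; lra|field].
    have h1 : (d / 8 * kap) ^+ 2 <= 1.
      rewrite expr_le1// ?mulr_ge0 ?divr_ge0 ?(ltW d0) ?(ltW k0)//.
      by rewrite mulr_ile1 ?divr_ge0 ?(ltW d0) ?(ltW k0)//; lra.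
    apply: (@le_trans _ _ (1 * r)); first by rewrite ler_wpM2r// ltW.
    by rewrite mul1r expr2; nra.
  have c2 : 0 <= 64 / d ^+ 2 / kap ^+ 2 by rewrite divr_ge0// exprn_even_ge0.
  move=> /(ler_wpM2l c2); apply: le_trans.
  rewrite le_eqVlt; apply/orP; left; apply/eqP; field; rewrite kn dn//.
have [zn|zf] := leP (b * `|z - z0|) (d / 2 * a * kap); last first.
  apply: far; rewrite (@le_trans _ _ (64 / d ^+ 2 * ((z - z0) ^+ 2 * (b / (a * kap)) ^+ 2)))//; last first.
    by rewrite lerDr mulr_ge0// divr_ge0// exprn_even_ge0.
  have ak0 : 0 < a * kap by rewrite mulr_gt0.
  have : d / 2 <= `|z - z0| * (b / (a * kap)).
    by rewrite mulrA ler_pdivlMr// mulrA [_ * b]mulrC ltW.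
  move=> h; have : (d / 2) ^+ 2 <= (`|z - z0| * (b / (a * kap))) ^+ 2.
    by rewrite lerXn2r ?nnegrE//; lra.
  rewrite [(`|_| * _) ^+ _]exprMn real_normK ?num_real// => /(ler_wpM2l c1); apply: le_trans.
  by rewrite (_ : _ * _ = 16); [rewrite ler1n|field].
have : `|Y - a| <= d * a * kap.
  rewrite YE; apply: (le_trans (ler_normB _ _)).
  rewrite !normrM (gtr0_norm b0) (gtr0_norm t0).
  have : b * tau0 * `|r - 1| <= 2 * a * (d / 4 * kap) by rewrite ler_pM// mulr_ge0// ltW.
  lra.
move=> /(gden_local n0 a0 k0 k1 ak d0 d1)[Y0 cY].
have cr : clo (1 - d)^-1 r by apply: clo_sub => //; lra.
have /andP[] := cloXM S1 (igw_local m S1 cr) cY.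
rewrite /Hfun -/Y Y0.
set H := (r `^ (m%:R / 2))^-1 * (gden n a Y / gden n a a); set K := (1 - d)^-1 ^+ _ in dK *.
have -> : (r `^ (m%:R / 2))^-1 / igw r * (gden n a Y / gden n a a) = H / igw r by rewrite /H mulrAC.
have K0 : 0 < K by rewrite exprn_gt0// (lt_le_trans _ S1).
rewrite ler_pdivlMr// ler_pdivrMr// => H1 H2; split.
  by rewrite (le_trans H2)// ler_wpDr// ler_wpM2r// ltW.
rewrite ler_wpDr// (le_trans _ H1)// ler_wpM2r ?(ltW w0)//.
rewrite -[leLHS]invrK lef_pV2 ?posrE ?invr_gt0//; last lra.
apply: (le_trans dK); rewrite -[leRHS]mul1r ler_pdivlMr//; nra.
Qed.

End Pointwise.

Section SecondMoment.
Context {R : realType}.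
Variables (n : nat) (u q z0 : R) (N : nat).
Hypotheses (u0 : 0 <= u) (qc : q <= pole 0).
Hypotheses (z1 : tmean u N q <= z0) (z2 : z0 <= tmean u N q + 1).
Context (d : measure_display) (T : measurableType d)
    (P : {sigma_finite_measure set T -> \bar R}) (w Z : T -> R).
Hypotheses (mw : measurable_fun setT w) (mZ : measurable_fun setT Z)
  (w0 : forall x, 0 <= w x).
Hypothesis wZ : forall l, l < pole 1 -> (\int[P]_x (w x * expR (l * Z x))%:E)%E =
          (\prod_(k < N) lap n u (pole (1 + k)) l)%:E.

Lemma sqr_le_expR (y : R) : y ^+ 2 <= 2 * (expR y + expR (- y)).
Proof.
have H (x : R) : 0 <= x -> x ^+ 2 <= 2 * expR x.
  by move=> x0; have := expr_le_expR 2 x0.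
have e1 := expR_gt0 y; have e2 := expR_gt0 (- y).
have [y0|y0] := leP 0 y; first by have := H y y0; lra.
have /H : 0 <= - y by lra.
rewrite sqrrN; lra.
Qed.

(** Chernoff-type bound: y^2 <= 2 (exp(y) + exp(-y)) at y = h (Z - z0) with h = (1 + u)^(-1/2) moves
    the tilt by h in either direction, still below pole 1. Gamma parts are not in [tmean]; their
    effect is the 2n in the exponent, and the distance of z0 from [tmean] costs at most 1 more. *)
Lemma second_moment :
  (\int[P]_x (w x * expR (q * Z x) * (Z x - z0) ^+ 2)%:E <=
   (4 * (1 + u) * expR (2 + 2 * n%:R) * \prod_(k < N) lap n u (pole k.+1) q)%:E)%E.
Proof.
have := z2; have := z1; have := qc; have := u0 => u_ge0 q_le z_ge z_le.
pose h := (Num.sqrt (1 + u))^-1.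
have u1 : 0 < 1 + u by lra.
have h2 : h ^+ 2 = (1 + u)^-1 by rewrite exprVn sqr_sqrtr// ltW.
have h0 : 0 < h by rewrite invr_gt0 sqrtr_gt0.
have h1 : h <= 1 by rewrite -(@expr_le1 _ 2)// ?(ltW h0)// h2 invf_le1//; lra.
have uh : u * h ^+ 2 <= 1 by rewrite h2 ler_pdivrMr//; lra.
have g0 := @gap_ge R 0; rewrite /gap in g0.
have me l : measurable_fun setT (fun x => w x * expR (l * Z x)).
  apply: measurable_funM => //; apply: measurableT_comp => //.
  exact: measurable_funM.
pose f1 x := expR (- (h * z0)) * (w x * expR ((q + h) * Z x)).
pose f2 x := expR (h * z0) * (w x * expR ((q - h) * Z x)).
have f10 x : 0 <= f1 x by rewrite !mulr_ge0 ?expR_ge0.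
have f20 x : 0 <= f2 x by rewrite !mulr_ge0 ?expR_ge0.
have mf1 : measurable_fun setT f1 by apply: measurable_funM.
have mf2 : measurable_fun setT f2 by apply: measurable_funM.
apply: (@le_trans _ _ (\int[P]_x ((2 * (1 + u))%:E * ((f1 x)%:E + (f2 x)%:E)))%E).
  apply: ge0_le_integral => //.
  - by move=> x _; rewrite lee_fin mulr_ge0 ?exprn_even_ge0// mulr_ge0 ?expR_ge0.
  - apply/measurable_EFinP; apply: measurable_funM; first exact: me.
    by apply: measurable_funX; apply: measurable_funB.
  - by apply/measurable_EFinP; apply: measurable_funM => //; apply: measurable_funD.
  move=> x _; rewrite -EFinD -EFinM lee_fin /f1 /f2.
  have /(ler_wpM2l (_ : 0 <= w x * expR (q * Z x) * (1 + u))) := sqr_le_expR (h * (Z x - z0)).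
  rewrite !mulr_ge0 ?expR_ge0 ?(ltW u1)// => /(_ isT); rewrite exprMn h2.
  rewrite (_ : w x * expR (q * Z x) * (1 + u) * ((1 + u)^-1 * _) =
    w x * expR (q * Z x) * (Z x - z0) ^+ 2); last by field; rewrite gt_eqF.
  have -> : expR (- (h * z0)) * (w x * expR ((q + h) * Z x)) =
      w x * expR (q * Z x) * expR (h * (Z x - z0)).
    by rewrite mulrCA -mulrA -!expRD; congr (_ * expR _); ring.
  have -> : expR (h * z0) * (w x * expR ((q - h) * Z x)) =
      w x * expR (q * Z x) * expR (- (h * (Z x - z0))).
    by rewrite mulrCA -mulrA -!expRD; congr (_ * expR _); ring.
  move=> /le_trans; apply.
  by rewrite le_eqVlt; apply/orP; left; apply/eqP; ring.
have i1 : (\int[P]_x (f1 x)%:E)%E = (expR (- (h * z0)) * \prod_(k < N) lap n u (pole k.+1) (q + h))%:E.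
  rewrite EFinM -(wZ (l := q + h)); last by lra.
  rewrite -ge0_integralZl_EFin ?expR_ge0//; last by apply/measurable_EFinP; exact: me.
  by move=> x _; rewrite lee_fin mulr_ge0 ?expR_ge0.
have i2 : (\int[P]_x (f2 x)%:E)%E = (expR (h * z0) * \prod_(k < N) lap n u (pole k.+1) (q - h))%:E.
  rewrite EFinM -(wZ (l := q - h)); last by lra.
  rewrite -ge0_integralZl_EFin ?expR_ge0//; last by apply/measurable_EFinP; exact: me.
  by move=> x _; rewrite lee_fin mulr_ge0 ?expR_ge0.
rewrite ge0_integralZl_EFin//; last 3 first.
- by move=> x _; rewrite -EFinD lee_fin addr_ge0.
- by apply/measurable_EFinP; apply: measurable_funD.
- by rewrite mulr_ge0// ltW.
rewrite ge0_integralD//; last 4 first.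
- by move=> x _; rewrite lee_fin.
- exact/measurable_EFinP.
- by move=> x _; rewrite lee_fin.
- exact/measurable_EFinP.
rewrite i1 i2 -EFinD -EFinM lee_fin.
have hn : `|h| <= 1 by rewrite gtr0_norm.
have hn' : `|- h| <= 1 by rewrite normrN gtr0_norm.
have uh' : u * (- h) ^+ 2 <= 1 by rewrite sqrrN.
have P1 := @prod_lap_ratio_le R n u u_ge0 N q h qc hn uh.
have P2 := @prod_lap_ratio_le R n u u_ge0 N q (- h) qc hn' uh'.
set Psi := \prod_(k < N) lap n u (pole k.+1) q in P1 P2 *.
have Psi0 : 0 <= Psi.
  apply: prodr_ge0 => k _; have g := @gap_ge R k; rewrite /gap in g.
  by rewrite ltW// lap_gt0 ?pole_gt0//; lra.
have ht : h * tmean u N q <= h * z0 by rewrite ler_wpM2l// ltW.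
have ht' : h * z0 <= h * tmean u N q + 1.
  apply: (@le_trans _ _ (h * (tmean u N q + 1))); first by rewrite ler_wpM2l// ltW.
  by rewrite mulrDr mulr1 lerD2l.
have Q1 : expR (- (h * z0)) * \prod_(k < N) lap n u (pole k.+1) (q + h) <= expR (2 + 2 * n%:R) * Psi.
  apply: (le_trans (ler_wpM2l (expR_ge0 _) P1)); rewrite mulrA ler_wpM2r// -expRD ler_expR; lra.
have Q2 : expR (h * z0) * \prod_(k < N) lap n u (pole k.+1) (q - h) <= expR (2 + 2 * n%:R) * Psi.
  apply: (le_trans (ler_wpM2l (expR_ge0 _) P2)); rewrite mulrA ler_wpM2r// -expRD ler_expR; lra.
rewrite [leRHS](_ : _ = 2 * (1 + u) * (expR (2 + 2 * n%:R) * Psi + expR (2 + 2 * n%:R) * Psi)); last by ring.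
by rewrite ler_wpM2l ?lerD// mulr_ge0// ltW.
Qed.

End SecondMoment.

(** * The tilted integral *)

Section Tilt.
Context {R : realType}.
Notation leb := (@lebesgue_measure R).
Variables (n m : nat) (u v th c b a tau0 A : R).
Hypotheses (n0 : (0 < n)%N) (u0 : 0 < u) (v0 : 0 < v) (th0 : 0 < th) (b0 : 0 < b).
Hypotheses (cE : c = b + th ^+ 2) (aE : a = u * c / (2 * b)) (tauE : tau0 = v / (2 * th))
  (AE : A = th * v / 2).

Let c0 : 0 < c. Proof. by rewrite cE addr_gt0// exprn_gt0. Qed.
Let a0 : 0 < a. Proof. by rewrite aE divr_gt0 ?mulr_gt0. Qed.
Let tau00 : 0 < tau0. Proof. by rewrite tauE divr_gt0 ?mulr_gt0. Qed.

(** Collects what depends neither on r nor on z: the constant of the completed square, the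
    normalisation of the tilted law at pole 0, the Jacobian factors b and tau0, and the density at
    its centre. *)
Definition tiltK : R := expR (- (th * v)) * lap n u c (th ^+ 2) * b *
  (tau0 * (tau0 `^ (m%:R / 2))^-1) * gden n a a.

Lemma tiltK_gt0 : 0 < tiltK.
Proof.
have lp : 0 < lap n u c (th ^+ 2) by rewrite lap_gt0// cE ltrDr.
have gp : 0 < gden n a a by exact: gden_gt0.
have tp : 0 < (tau0 `^ (m%:R / 2))^-1 by rewrite invr_gt0 powR_gt0.
exact: (mulr_gt0 (mulr_gt0 (mulr_gt0 (mulr_gt0 (expR_gt0 _) lp) b0) (mulr_gt0 tau00 tp)) gp).
Qed.

Lemma dens_gden t : dens n u c t = expR (- (u / 2) - c * t + (a + b * t)) * (c / b) ^+ n * b *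
  gden n a (b * t).
Proof.
have bn := lt0r_neq0 b0; rewrite /dens /gden.
have -> : a * (b * t) = u * c * t / 2 by rewrite aE; field.
move: (hG _ _) => g; rewrite mulrA; congr (_ * g).
rewrite (_ : n = n.-1.+1); last by rewrite prednK.
rewrite /= [(c / b) ^+ _]exprS [c ^+ _]exprS expr_div_n [(b * t) ^+ _]exprMn.
have bk : b ^+ n.-1 != 0 by rewrite expf_neq0.
have E : expR (- (u / 2)) * expR (- (c * t)) =
   expR (- (u / 2) - c * t + (a + b * t)) * expR (- (a + b * t)).
  by rewrite -!expRD; congr expR; ring.
move: E; move: (expR _) (expR _) (expR _) (expR _) => e1 e2 e3 e4 E.
rewrite [LHS](_ : _ = e4 * e3 * (c * c ^+ n.-1 * t ^+ n.-1)); last by ring.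
rewrite E; move: (c ^+ n.-1) (t ^+ n.-1) (b ^+ n.-1) bk => x y zz zn.
by field; rewrite bn zn.
Qed.

Lemma tilt_pointwise r z : 0 < r -> 0 < tau0 * r - z ->
  dens n u c (tau0 * r - z) * kern m v (tau0 * r - z + z) * tau0 =
  tiltK * expR (th ^+ 2 * z) * (Hfun n m a b tau0 z r * expR (- (A * igy r))).
Proof.
move=> r0 t0; rewrite /Hfun mulr_gt0// subrK dens_gden.
have bn := lt0r_neq0 b0; have rn := lt0r_neq0 r0; have thn := lt0r_neq0 th0.
have vn := lt0r_neq0 v0.
have gn : gden n a a != 0 by rewrite gt_eqF// gden_gt0.
have lapE : lap n u c (th ^+ 2) = expR (u / 2 * (th ^+ 2 / b)) * (c / b) ^+ n.
  by rewrite /lap cE addrK.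
rewrite /tiltK /kern lapE powRM ?(ltW tau00) ?(ltW r0)// invfM.
(* The completed square, with the exponent of [dens_gden] split off so that it cancels; a and b are
   chosen to make this an identity. *)
have -> : expR (- (v ^+ 2 / (4 * (tau0 * r)))) =
  expR (- (- (u / 2) - c * (tau0 * r - z) + (a + b * (tau0 * r - z)))) *
  (expR (- (th * v)) * expR (u / 2 * (th ^+ 2 / b)) * expR (th ^+ 2 * z) * expR (- (A * igy r))).
  rewrite -!expRD; congr expR; rewrite aE AE /igy cE tauE; field.
  by rewrite bn rn thn vn.
rewrite [expR (- (- (u / 2) - _ + _))]expRN.
have en : expR (- (u / 2) - c * (tau0 * r - z) + (a + b * (tau0 * r - z))) != 0 by rewrite gt_eqF// expR_gt0.
move: (expR (- (u / 2) - _ + _)) en (expR (- (th * v))) (expR (u / 2 * _)) (expR (th ^+ 2 * z)) (expR (- (A * _))) => e1 en e2 e3 e4 e5.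
move: ((_ `^ _)^-1) ((_ `^ _)^-1) (gden n a a) gn (gden _ _ _) ((c / b) ^+ n) => p1 p2 g gn g' k.
by field; rewrite en gn.
Qed.

Lemma continuous_gden (x : R) : continuous (gden n x).
Proof.
have n20 : (0 < n.*2)%N by rewrite double_gt0.
move=> y; exact: hasD_continuous (dM (dM (dcomp (g := fun y : R => - (x + y)) (dexp _) (dN (dD (dcst x y) (did y))))
  (dX n.-1 (did y))) (dcomp (g := fun y : R => x * y) (dhG _ n20) (dM (dcst x y) (did y)))).
Qed.

Lemma measurable_Hfun z (D : set R) : measurable D -> measurable_fun D (Hfun n m a b tau0 z).
Proof.
move=> mD; apply: measurable_funTS.
have ml : measurable_fun setT (fun r : R => b * (tau0 * r - z)).
  by apply: measurable_funM => //; apply: measurable_funB => //; apply: measurable_funM.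
apply: measurable_fun_ifT => //; first exact: measurable_fun_ltr.
apply: measurable_funM.
  rewrite (_ : (fun r : R => _) = (fun r => r `^ (- (m%:R / 2)))); first exact: measurable_powR.
  by apply/funext => r; rewrite powRN.
apply: measurable_funM => //; apply: measurableT_comp => //.
by apply: continuous_measurable_fun; exact: continuous_gden.
Qed.

Lemma Hfun_ge0 z r : 0 <= Hfun n m a b tau0 z r.
Proof.
rewrite /Hfun; case: ifPn => // h.
by rewrite mulr_ge0 ?invr_ge0 ?powR_ge0// divr_ge0// ltW// gden_gt0.
Qed.

Lemma measurable_Hexp z :
  measurable_fun `](0 : R), +oo[ (fun r => Hfun n m a b tau0 z r * expR (- (A * igy r))).
Proof.
apply: measurable_funM; first exact: measurable_Hfun.
apply: measurable_continuous_oy => r r0; exact: continuous_igexp.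
Qed.

(** Substitution t = tau0 r - z. The range becomes r > z/tau0, and it extends to r > 0 because
    [Hfun] is 0 where its time argument is not positive. *)
Lemma inner_integral z : 0 <= z ->
  (\int[leb]_(t in `]0%R, +oo[) (dens n u c t * kern m v (t + z))%:E =
   (tiltK * expR (th ^+ 2 * z))%:E *
   \int[leb]_(r in `]0%R, +oo[) (Hfun n m a b tau0 z r * expR (- (A * igy r)))%:E)%E.
Proof.
move=> z_0; have K0 : 0 <= tiltK * expR (th ^+ 2 * z) by rewrite mulr_ge0 ?expR_ge0// ltW// tiltK_gt0.
have taun := lt0r_neq0 tau00.
have rz r : (z / tau0 < r) = (0 < tau0 * r - z).
  by rewrite ltr_pdivrMr// subr_gt0 mulrC.
have J : `]0, +oo[%classic = (fun r => tau0 * r - z) @` `]z / tau0, +oo[%classic.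
  apply/seteqP; split=> t /=; rewrite in_itv/= andbT.
    move=> t0; exists ((t + z) / tau0); last by field.
    by rewrite in_itv/= andbT ltr_pM2r ?invr_gt0// ltrDr.
  by move=> [r]; rewrite in_itv/= andbT rz => r0 <-.
rewrite (@ge0_substitution_oy R (fun r => tau0 * r - z) (cst tau0) _ (z / tau0) _ J); first last.
- move=> t /=; rewrite in_itv/= andbT => t0.
  by rewrite mulr_ge0 ?dens_ge0 ?(ltW t0) ?(ltW u0) ?(ltW c0)// mulr_ge0 ?invr_ge0 ?powR_ge0 ?expR_ge0.
- move=> t /=; rewrite in_itv/= andbT => t0; have tz : 0 < t + z by lra.
  apply: continuousM; first exact: continuous_dens.
  have tzn : 4 * (t + z) != 0 by rewrite gt_eqF// mulr_gt0.
  have pn : (t + z) `^ (m%:R / 2) != 0 by rewrite gt_eqF// powR_gt0.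
  have dtz := dD (did t) (dcst z t).
  exact: hasD_continuous (dM (dV (f := fun t : R => (t + z) `^ (m%:R / 2)) pn
     (dcomp (g := fun t : R => t + z) (dpowR (m%:R / 2) tz) dtz))
     (dcomp (g := fun t : R => - (v ^+ 2 / (4 * (t + z)))) (dexp _)
       (dN (dM (dcst (v ^+ 2) t) (dV (f := fun t : R => 4 * (t + z)) tzn (dM (dcst 4 t) dtz)))))).
- by [].
- by move=> r _; exact: cvg_cst.
- move=> r _; apply: (deq (dB (dM (dcst tau0 r) (did r)) (dcst z r))).
  by rewrite mul0r add0r mulr1 subr0.
rewrite -ge0_integralZl_EFin//; last 2 first.
- by move=> r _; rewrite lee_fin mulr_ge0 ?expR_ge0// Hfun_ge0.
- by apply/measurable_EFinP; exact: measurable_Hexp.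
rewrite [LHS]integral_mkcond [RHS]integral_mkcond. apply: eq_integral => r _.
rewrite !patchE !mem_setE !in_itv/= !andbT rz.
case: ifPn => [t0|t0].
  have r0 : 0 < r by rewrite (le_lt_trans _ (_ : z / tau0 < r)) ?rz// divr_ge0// ltW.
  by rewrite r0 -EFinM tilt_pointwise.
case: ifPn => // r0; rewrite -EFinM /Hfun pmulr_rgt0// (negbTE t0) mul0r mulr0//.
Qed.

Section Estimate.
Variables (rho al ga z0 : R).
Hypotheses (rho0 : 0 < rho) (rho1 : rho < 1) (al0 : 0 <= al) (ga0 : 0 <= ga) (A2 : 2 <= A).
Hypothesis app : forall z r, 0 <= z -> 0 < r ->
  let D := igw r * (expR (igy r) * (al * igy r + ga * (z - z0) ^+ 2)) in
  Hfun n m a b tau0 z r <= (1 + rho) * igw r + D /\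
  (1 - rho) * igw r <= Hfun n m a b tau0 z r + D.

Let J z : \bar R := (\int[leb]_(r in `]0%R, +oo[) (Hfun n m a b tau0 z r * expR (- (A * igy r)))%:E)%E.
Let s0 := Num.sqrt (pi / A).

Let fD z r := igw r * (expR (igy r) * (al * igy r + ga * (z - z0) ^+ 2)) * expR (- (A * igy r)).

Let fD_ge0 z r : 0 < r -> 0 <= fD z r.
Proof.
move=> r0; rewrite mulr_ge0 ?expR_ge0// mulr_ge0 ?(ltW (igw_gt0 r0))// mulr_ge0 ?expR_ge0//.
by rewrite addr_ge0// mulr_ge0 ?igy_ge0 ?exprn_even_ge0.
Qed.

Let measurable_fD z : measurable_fun `](0 : R), +oo[ (fD z).
Proof.
apply: measurable_continuous_oy => r r0.
apply: continuousM; last exact: continuous_igexp.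
apply: continuousM; first exact: continuous_igw.
apply: continuousM.
  by apply: (@continuous_comp _ _ _ igy (@expR R)); [exact: continuous_igy|exact: continuous_expR].
apply: continuousD; last exact: cvg_cst.
by apply: continuousM; [exact: cvg_cst|exact: continuous_igy].
Qed.

Let A0 : 0 < A. Proof. exact: lt_le_trans A2. Qed.

Let fD_le z : (\int[leb]_(r in `]0%R, +oo[) (fD z r)%:E <=
  (2 * (4 * al / A + ga * (z - z0) ^+ 2) * s0)%:E)%E.
Proof. by apply: ig_error => //; rewrite mulr_ge0// exprn_even_ge0. Qed.

Let igK k : 0 <= k -> (\int[leb]_(r in `]0%R, +oo[) (k * (igw r * expR (- (A * igy r))))%:E = (k * s0)%:E)%E.
Proof.
move=> k0; rewrite EFinM /s0 -ig_integral// -ge0_integralZl_EFin//.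
  by move=> r /=; rewrite in_itv/= andbT => r0; rewrite lee_fin mulr_ge0 ?expR_ge0// ltW// igw_gt0.
by apply/measurable_EFinP; exact: measurable_ig.
Qed.

Let mJ z : measurable_fun `](0 : R), +oo[ (fun r => (Hfun n m a b tau0 z r * expR (- (A * igy r)))%:E).
Proof. by apply/measurable_EFinP; exact: measurable_Hexp. Qed.

Let mfDE z : measurable_fun `](0 : R), +oo[ (fun r => (fD z r)%:E).
Proof. by apply/measurable_EFinP; exact: measurable_fD. Qed.

Let migE k : measurable_fun `](0 : R), +oo[ (fun r => (k * (igw r * expR (- (A * igy r))))%:E).
Proof. by apply/measurable_EFinP; apply: measurable_funM => //; exact: measurable_ig. Qed.

Let ig0 k r : 0 <= k -> 0 < r -> 0 <= k * (igw r * expR (- (A * igy r))).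
Proof. by move=> k0 r0; rewrite mulr_ge0// mulr_ge0 ?expR_ge0// ltW// igw_gt0. Qed.

Let H0 z r : 0 <= Hfun n m a b tau0 z r * expR (- (A * igy r)).
Proof. by rewrite mulr_ge0 ?expR_ge0// Hfun_ge0. Qed.

Lemma J_upper z : 0 <= z ->
  (J z <= (s0 * (1 + rho + 2 * (4 * al / A + ga * (z - z0) ^+ 2)))%:E)%E.
Proof.
move=> z_0; have r1 : 0 <= 1 + rho by rewrite addr_ge0// ltW.
rewrite mulrDr [X in (X + _)%:E]mulrC [X in (_ + X)%:E]mulrC EFinD -igK//.
apply: (@le_trans _ _ (\int[leb]_(r in `]0%R, +oo[)
   (((1 + rho) * (igw r * expR (- (A * igy r))))%:E + (fD z r)%:E))%E).
  apply: ge0_le_integral => //.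
  - by move=> r _; rewrite lee_fin.
  - exact: mJ.
  - by apply: emeasurable_funD; [exact: migE|exact: mfDE].
  move=> r /=; rewrite in_itv/= andbT => r0; rewrite -EFinD lee_fin /fD [X in _ <= X + _]mulrA -mulrDl.
  by rewrite ler_wpM2r ?expR_ge0//; have [] := app z_0 r0.
rewrite ge0_integralD//; last 4 first.
- by move=> r /=; rewrite in_itv/= andbT => r0; rewrite lee_fin ig0.
- exact: migE.
- by move=> r /=; rewrite in_itv/= andbT => r0; rewrite lee_fin fD_ge0.
- exact: mfDE.
by rewrite leeD2l// (le_trans (fD_le z)).
Qed.

(** Kept additive, so that nothing is subtracted in the extended reals. *)
Lemma J_lower z : 0 <= z ->
  (((1 - rho) * s0)%:E <= J z + (2 * (4 * al / A + ga * (z - z0) ^+ 2) * s0)%:E)%E.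
Proof.
move=> z_0; have r1 : 0 <= 1 - rho by rewrite subr_ge0 ltW.
rewrite -igK//; apply: (@le_trans _ _ (J z + \int[leb]_(r in `]0%R, +oo[) (fD z r)%:E)%E); last first.
  by rewrite leeD2l// (le_trans (fD_le z)).
rewrite -ge0_integralD//; last 4 first.
- by move=> r _; rewrite lee_fin.
- exact: mJ.
- by move=> r /=; rewrite in_itv/= andbT => r0; rewrite lee_fin fD_ge0.
- exact: mfDE.
apply: ge0_le_integral => //.
- by move=> r /=; rewrite in_itv/= andbT => r0; rewrite lee_fin ig0.
- exact: migE.
- by apply: emeasurable_funD; [exact: mJ|exact: mfDE].
move=> r /=; rewrite in_itv/= andbT => r0; rewrite -EFinD lee_fin /fD [leLHS]mulrA -mulrDl.
by rewrite ler_wpM2r ?expR_ge0//; have [] := app z_0 r0.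
Qed.

Context (d : measure_display) (T : measurableType d)
    (P : {sigma_finite_measure set T -> \bar R}) (w Z : T -> R) (Psi K2 e : R).
Hypotheses (mw : measurable_fun setT w) (mZ : measurable_fun setT Z)
  (w0 : forall x, 0 <= w x) (Z0 : forall x, 0 <= Z x).
Hypotheses (G1 : (\int[P]_x (w x * expR (th ^+ 2 * Z x))%:E)%E = Psi%:E)
  (G2 : (\int[P]_x (w x * expR (th ^+ 2 * Z x) * (Z x - z0) ^+ 2)%:E <= (K2 * Psi)%:E)%E).
Let F x := ((w x)%:E * \int[leb]_(t in `]0%R, +oo[) (dens n u c t * kern m v (t + Z x))%:E)%E.
Hypotheses (mF : measurable_fun setT F) (FE : (\int[P]_x F x)%E = e%:E).

(** The two bounds on [J] are integrated against the tilted weight; their dependence on z is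
    quadratic around z0, so the total mass [Psi] and the second moment suffice. *)
Lemma tilted_estimate :
  `|e - tiltK * s0 * Psi| <= tiltK * s0 * Psi * (rho + 8 * al / A + 2 * ga * K2).
Proof.
have K0 := tiltK_gt0; have s00 : 0 <= s0 by exact: sqrtr_ge0.
pose G x := w x * expR (th ^+ 2 * Z x).
have G0 x : 0 <= G x by rewrite mulr_ge0 ?expR_ge0.
have mG : measurable_fun setT G.
  by apply: measurable_funM => //; apply: measurableT_comp => //; exact: measurable_funM.
have mG2 : measurable_fun setT (fun x => G x * (Z x - z0) ^+ 2).
  by apply: measurable_funM => //; apply: measurable_funX; exact: measurable_funB.
have G20 x : 0 <= G x * (Z x - z0) ^+ 2 by rewrite mulr_ge0// exprn_even_ge0.
have FJ x : F x = ((tiltK * G x)%:E * J (Z x))%E.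
  by rewrite /F inner_integral// muleA -EFinM mulrCA.
have comb p1 p2 : 0 <= p1 -> 0 <= p2 ->
    (\int[P]_x (p1 * G x + p2 * (G x * (Z x - z0) ^+ 2))%:E <= (p1 * Psi + p2 * (K2 * Psi))%:E)%E.
  move=> p10 p20.
  have -> : (\int[P]_x (p1 * G x + p2 * (G x * (Z x - z0) ^+ 2))%:E)%E =
    (\int[P]_x (p1%:E * (G x)%:E + p2%:E * (G x * (Z x - z0) ^+ 2)%:E))%E by [].
  rewrite ge0_integralD//; last 4 first.
  - by move=> x _; rewrite -EFinM lee_fin mulr_ge0.
  - by apply: measurable_funeM; exact/measurable_EFinP.
  - by move=> x _; rewrite -EFinM lee_fin mulr_ge0.
  - by apply: measurable_funeM; exact/measurable_EFinP.
  rewrite ge0_integralZl_EFin//; last 2 first.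
  - by move=> x _; rewrite lee_fin.
  - exact/measurable_EFinP.
  rewrite ge0_integralZl_EFin//; last 2 first.
  - by move=> x _; rewrite lee_fin.
  - exact/measurable_EFinP.
  by rewrite G1 EFinD !(EFinM _ Psi) (EFinM p2) leeD2l// lee_wpmul2l.
pose al' := 8 * al / A; have al'0 : 0 <= al' by rewrite divr_ge0 ?(ltW A0)// mulr_ge0.
have F0 x : (0 <= F x)%E.
  rewrite FJ mule_ge0//; first by rewrite lee_fin mulr_ge0// ltW.
  by apply: integral_ge0 => r _; rewrite lee_fin.
have KG x : 0 <= tiltK * G x by rewrite mulr_ge0// ltW.
have Ks : 0 <= tiltK * s0 by rewrite mulr_ge0// ltW.
have r1 : 0 <= 1 + rho by rewrite addr_ge0// ltW.
have r2 : 0 <= 1 - rho by rewrite subr_ge0 ltW.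
have up : e <= tiltK * s0 * (1 + rho + al') * Psi + tiltK * s0 * (2 * ga) * (K2 * Psi).
  rewrite -lee_fin -FE; apply: le_trans (comb _ _ _ _); last 2 first.
  - by rewrite mulr_ge0// addr_ge0.
  - by rewrite mulr_ge0// mulr_ge0.
  apply: ge0_le_integral => //.
    apply/measurable_EFinP; apply: measurable_funD; exact: measurable_funM.
  move=> x _; rewrite FJ; apply: (le_trans (lee_wpmul2l _ (J_upper (Z0 x)))); first by rewrite lee_fin.
  by rewrite -EFinM lee_fin le_eqVlt; apply/orP; left; apply/eqP; rewrite /al'; ring.
have lo : tiltK * s0 * (1 - rho) * Psi <= e + (tiltK * s0 * al' * Psi + tiltK * s0 * (2 * ga) * (K2 * Psi)).
  rewrite -lee_fin EFinD.
  have p1 : 0 <= tiltK * s0 * al' by rewrite mulr_ge0.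
  have p2 : 0 <= tiltK * s0 * (2 * ga) by rewrite mulr_ge0// mulr_ge0.
  apply: le_trans (leeD2l _ (comb _ _ p1 p2)).
  rewrite -FE -ge0_integralD//; last 2 first.
  - by move=> x _; rewrite lee_fin addr_ge0// mulr_ge0.
  - by apply/measurable_EFinP; apply: measurable_funD; exact: measurable_funM.
  rewrite EFinM -G1 -ge0_integralZl_EFin//; last 3 first.
  - by move=> x _; rewrite lee_fin G0.
  - exact/measurable_EFinP.
  - by rewrite mulr_ge0.
  apply: ge0_le_integral => //.
  - by move=> x _; rewrite -EFinM lee_fin mulr_ge0// mulr_ge0.
  - by apply: measurable_funeM; exact/measurable_EFinP.
  - apply: emeasurable_funD => //.
    by apply/measurable_EFinP; apply: measurable_funD; exact: measurable_funM.
  move=> x _; rewrite FJ -/(G x).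
  have /(lee_wpmul2l (_ : (0 <= (tiltK * G x)%:E)%E)) := J_lower (Z0 x).
  rewrite lee_fin => /(_ (KG x)); rewrite ge0_muleDr; last 2 first.
  - by apply: integral_ge0 => r _; rewrite lee_fin.
  - rewrite lee_fin mulr_ge0// mulr_ge0// addr_ge0//; last by rewrite mulr_ge0// exprn_even_ge0.
    by rewrite divr_ge0 ?(ltW A0)// mulr_ge0.
  rewrite -!EFinM [X in (X%:E <= _)%E -> _](_ : _ = tiltK * s0 * (1 - rho) * G x); last by ring.
  rewrite [X in (_ <= _ + X%:E)%E -> _](_ : _ = tiltK * s0 * al' * G x + tiltK * s0 * (2 * ga) * (G x * (Z x - z0) ^+ 2)) //.
  by rewrite /al'; ring.
rewrite ler_norml; apply/andP; split; rewrite -/al'; lra.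
Qed.

End Estimate.
End Tilt.

(** * Conclusion *)

Section Limit.
Context {R : realType}.
Notation leb := (@lebesgue_measure R).

Lemma pole0E : pole 0 = pi ^+ 2 :> R.
Proof. by rewrite /pole mulr1. Qed.

Lemma lt_pole0 (th : R) : 0 < th < pi -> th ^+ 2 < pole 0.
Proof. by move=> /andP[t0 tp]; rewrite pole0E ltr_pXn2r ?nnegrE ?pi_ge0 ?(ltW t0). Qed.

(** The transform of [phiN_cvg] continued to s = i theta: coth and sinh become cot and sin. Together
    with exp(-theta v) its exponential yields exp(-d^2/4) in [saddleQE]. *)
Lemma prod_lap_cvg n (u th : R) : 0 < th < pi ->
  expR (- (u / 4)) * \prod_(k < N) lap n u (pole k) (th ^+ 2) @[N --> \oo] -->
  expR (- (u / 4 * (th * cos th / sin th))) * (th / sin th) ^+ n.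
Proof.
move=> tp; have /andP[t0 tpi] := tp.
have s0 : 0 < sin th by exact: sin_gt0_pi.
have qp k : th ^+ 2 < pole k.
  apply: (lt_le_trans (lt_pole0 tp)); rewrite /pole lerXn2r ?nnegrE ?mulr_ge0 ?pi_ge0//.
  by rewrite ler_wpM2l ?pi_ge0// ler1n.
have E N : expR (- (u / 4)) * \prod_(k < N) lap n u (pole k) (th ^+ 2) =
    expR (- (u / 4) + u / 2 * th ^+ 2 * \sum_(k < N) (pole k - th ^+ 2)^-1) *
    (\prod_(k < N) (1 - th ^+ 2 / pole k))^-1 ^+ n.
  rewrite expRD -mulrA; congr (_ * _); rewrite big_split /= -expR_sum; congr (_ * _).
    by rewrite mulr_sumr; congr expR; apply: eq_bigr => k _; rewrite mulrA.
  rewrite prodrXl; congr (_ ^+ _); rewrite -prodfV; apply: eq_bigr => k _.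
  have p0 := lt0r_neq0 (@pole_gt0 R k); have pq : pole k - th ^+ 2 != 0 by rewrite gt_eqF// subr_gt0.
  by move: (pole k) p0 pq => p p0 pq; rewrite (_ : 1 - _ = (p - th ^+ 2) / p) ?invf_div//; field.
rewrite (funext E).
apply: cvgM.
  have E2 : - (u / 4 * (th * cos th / sin th)) =
    - (u / 4) + u / 2 * th ^+ 2 * ((1 - th * cos th / sin th) / (2 * th ^+ 2)).
    by move: (cos th) (sin th) s0 => c s s0; field; rewrite !gt_eqF.
  rewrite E2; apply: (cvg_comp _ expR _ (@continuous_expR R _)).
  apply: cvgD; first exact: cvg_cst.
  by apply: cvgMr; exact: cot_sum.
apply: (cvg_comp _ (fun x => x ^+ n) _ (@exprn_continuous _ n _)).
rewrite -invf_div; apply: cvgV; first by rewrite gt_eqF// divr_gt0.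
exact: sin_product.
Qed.

Lemma tmean_cvg (u th : R) : 0 < th < pi ->
  tmean u N (th ^+ 2) @[N --> \oo] -->
  u / 2 * (mu th / (4 * th) - pole 0 / (pole 0 - th ^+ 2) ^+ 2).
Proof.
move=> tp; apply: cvgMr; have := mu_sum tp; rewrite -cvg_shiftS => cm.
pose K : R := pole 0 / (pole 0 - th ^+ 2) ^+ 2.
have E N : \sum_(k < N) pole k.+1 / (pole k.+1 - th ^+ 2) ^+ 2 =
    \sum_(k < N.+1) pole k / (pole k - th ^+ 2) ^+ 2 - K.
  by rewrite big_ord_recl /= addrAC subrr add0r.
by rewrite (funext E); apply: cvgB => //; exact: cvg_cst.
Qed.

Lemma le_tmean_lim (u th : R) z0 : 0 <= u ->
  tmean u N (th ^+ 2) @[N --> \oo] --> z0 -> forall N, tmean u N (th ^+ 2) <= z0.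
Proof.
move=> u0 cz N; have nd : nondecreasing_seq (fun N => tmean u N (th ^+ 2)).
  apply/nondecreasing_seqP => k; rewrite /tmean big_ord_recr /= ler_wpM2l ?divr_ge0// lerDl.
  by rewrite divr_ge0 ?exprn_even_ge0// ltW// pole_gt0.
have := nondecreasing_cvgn_le nd (cvgP _ cz) N; by rewrite (cvg_lim _ cz).
Qed.

Variables (n m : nat) (u v th a A C rho : R).
Hypotheses (n0 : (0 < n)%N) (m0 : (0 < m)%N) (u0 : 0 < u) (v0 : 0 < v) (tp : 0 < th < pi).
Let b := pole 0 - th ^+ 2.
Let tau0 := v / (2 * th).
Hypotheses (aE : a = u * pole 0 / (2 * b)) (AE : A = th * v / 2)
  (muth : mu th = 4 * v / u) (b1 : b <= 1) (A2 : 2 <= A) (C0 : 0 < C) (rho0 : 0 < rho) (rho1 : rho < 1).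
Hypothesis HC : forall a kap b tau0 z0 r z, 0 < a -> 0 < kap -> kap <= 1 -> a * kap ^+ 2 <= 1 ->
    0 < b -> 0 < tau0 -> a = b * (tau0 - z0) -> b * tau0 <= 2 * a -> 0 <= z -> 0 < r ->
    let D := igw r * (expR (igy r) *
       (C / kap ^+ 2 * igy r + C * ((z - z0) ^+ 2 * (b / (a * kap)) ^+ 2))) in
    Hfun n m a b tau0 z r <= (1 + rho) * igw r + D /\
    (1 - rho) * igw r <= Hfun n m a b tau0 z r + D.

(* [tiltK] times the Gaussian integral and the limit of the other Laplace factors. *)
Definition saddleQ : R := expR (- (th * v)) * (pole 0 - th ^+ 2) *
  (v / (2 * th) * ((v / (2 * th)) `^ (m%:R / 2))^-1) * gden n a a * Num.sqrt (pi / A) *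
  (expR (- (u / 4 * (th * cos th / sin th))) * (th / sin th) ^+ n).

(** [tilted_estimate] holds for every large N with an error free of N; both sides are then passed to
    the limit. The common factor exp(u/4) is divided out. *)
Lemma core_estimate :
  `|heat_p n m u v * (4 * pi) `^ (n%:R + m%:R / 2) - saddleQ| <=
  saddleQ * (rho + 8 * (C * (1 + a)) / A +
    2 * (C * (b ^+ 2 * (1 + a) / a ^+ 2)) * (4 * (1 + u) * expR (2 + 2 * n%:R))).
Proof.
have /andP[t0 tpi] := tp; have u_ge0 := ltW u0.
have b0 : 0 < b by rewrite subr_gt0 lt_pole0.
have c0 := @pole_gt0 R 0.
have a0 : 0 < a by rewrite aE; exact: (divr_gt0 (mulr_gt0 u0 c0) (mulr_gt0 (ltr0Sn R 1) b0)).
have cE : pole 0 = b + th ^+ 2 by rewrite subrK.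
have tau00 : 0 < tau0 by rewrite divr_gt0// mulr_gt0.
set err := (X in saddleQ * X).
(* By the equation for theta this is the limit of the tilted means of the remaining variables, so
   the mean of the first one is a/b. *)
pose zz := tau0 - a / b.
have cz : tmean u N (th ^+ 2) @[N --> \oo] --> zz.
  have := @tmean_cvg u th tp; rewrite muth -/b.
  rewrite (_ : u / 2 * _ = zz)// /zz /tau0 aE; move: (pole 0) c0 => c c0.
  by field; rewrite !gt_eqF.
have tz := le_tmean_lim u_ge0 cz.
have z0u : zz <= u.
  rewrite -(cvg_lim _ cz)//; apply: limr_le; first exact: cvgP cz.
  by apply: nearW => N; apply: tmean_le => //; exact: ltW (lt_pole0 tp).
(* Up to constants the largest kap with kap <= 1 and a kap^2 <= 1: it serves bounded and large a at
   once. *)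
pose kap := (Num.sqrt (1 + a))^-1.
have a10 : 0 < 1 + a by rewrite addr_gt0.
have k0 : 0 < kap by rewrite invr_gt0 sqrtr_gt0.
have k2 : kap ^+ 2 = (1 + a)^-1 by rewrite exprVn sqr_sqrtr// ltW.
have k1 : kap <= 1 by rewrite -(@expr_le1 _ 2)// ?(ltW k0)// k2 invf_le1//; lra.
have ak : a * kap ^+ 2 <= 1 by rewrite k2 ler_pdivrMr//; lra.
have azz : a = b * (tau0 - zz) by rewrite /zz; field; rewrite gt_eqF.
(* The remaining mean is negligible against a/b: zz <= u and b u = 2 a b^2 / pi^2 <= a, using b <=
   1. *)
have bt : b * tau0 <= 2 * a.
  have -> : b * tau0 = a + b * zz by rewrite [in RHS]azz; ring.
  have : b * zz <= b * u by rewrite ler_wpM2l// ltW.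
  have ub : u = 2 * a * b / pole 0 by rewrite aE; move: (pole 0) c0 => c c0; field; rewrite !gt_eqF.
  have c4 : 4 <= pole 0 :> R by rewrite pole0E; exact: pi2_ge4.
  have : b * u <= a.
    rewrite ub mulrA ler_pdivrMr// [leLHS](_ : _ = a * (2 * b ^+ 2)); last by ring.
    have b2 : b ^+ 2 <= 1 by rewrite expr_le1// ltW.
    rewrite ler_wpM2l ?(ltW a0)//; lra.
  lra.
have app z r : 0 <= z -> 0 < r ->
  let D := igw r * (expR (igy r) * (C * (1 + a) * igy r + C * (b ^+ 2 * (1 + a) / a ^+ 2) * (z - zz) ^+ 2)) in
  Hfun n m a b tau0 z r <= (1 + rho) * igw r + D /\
  (1 - rho) * igw r <= Hfun n m a b tau0 z r + D.
  move=> z_0 r0; have := HC a0 k0 k1 ak b0 tau00 azz bt z_0 r0; cbv zeta.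
  have kn : 1 + a != 0 by rewrite gt_eqF.
  have -> : C / kap ^+ 2 = C * (1 + a) by rewrite k2 invrK.
  have -> : (b / (a * kap)) ^+ 2 = b ^+ 2 * (1 + a) / a ^+ 2.
    by rewrite expr_div_n exprMn k2; field; rewrite kn gt_eqF.
  by rewrite (_ : C * ((z - zz) ^+ 2 * _) = C * (b ^+ 2 * (1 + a) / a ^+ 2) * (z - zz) ^+ 2)//; ring.
pose Kr := expR (- (th * v)) * b * (tau0 * (tau0 `^ (m%:R / 2))^-1) * gden n a a * Num.sqrt (pi / A).
pose L N := expR (- (u / 4)) * \prod_(k < N) lap n u (pole k) (th ^+ 2).
have QE : saddleQ = Kr * (expR (- (u / 4 * (th * cos th / sin th))) * (th / sin th) ^+ n) by [].
have cL : Kr * L N.+1 @[N --> \oo] --> saddleQ.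
  rewrite QE; apply: cvgMr; have := @prod_lap_cvg n u th tp; by rewrite -cvg_shiftS.
pose X N := 2 * pN n m u v N.+1.
have p4 : 0 < (4 * pi) `^ (n%:R + m%:R / 2) :> R by rewrite powR_gt0// mulr_gt0// pi_gt0.
have cX : X N @[N --> \oo] --> heat_p n m u v * (4 * pi) `^ (n%:R + m%:R / 2).
  have := heat_p_cvg n0 m0 u0 v0; rewrite -cvg_shiftS => /(@cvgMl _ _ _ _ _ _ _).
  move=> /(_ ((4 * pi) `^ (n%:R + m%:R / 2))); apply: cvg_trans; apply: near_eq_cvg.
  near=> N; rewrite /= /X; move: (_ `^ _) p4 (pN _ _ _ _ _) => x x0 y.
  by field; rewrite gt_eqF.
have ev : \forall N \near \oo, `|X N - Kr * L N.+1| <= Kr * L N.+1 * err.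
  near=> N.
  have mN : (m <= N.+1)%N by near: N; exists m => // k /= /leqW.
  have zN : zz <= tmean u N (th ^+ 2) + 1.
    rewrite -lerBlDr; near: N; apply: (cvgr_ge zz cz); lra.
  have [d [T [P [w [Z [mw mZ w0 Z0 wZ]]]]]] := law_exists n0 1 N u_ge0.
  have [mF FE] := pN_formula v n0 m0 u0 mw mZ w0 Z0 wZ mN.
  have qc := ltW (lt_pole0 tp).
  have G2 := second_moment u_ge0 qc (tz N) zN mw mZ w0 wZ.
  have g1 : th ^+ 2 < pole 1 by have := @gap_ge R 0; rewrite /gap; have := lt_pole0 tp; lra.
  have G1 := wZ _ g1.
  have al0 : 0 <= C * (1 + a) by rewrite mulr_ge0// ltW.
  have ga0 : 0 <= C * (b ^+ 2 * (1 + a) / a ^+ 2).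
    by rewrite mulr_ge0 ?(ltW C0)// divr_ge0 ?exprn_even_ge0// mulr_ge0 ?exprn_even_ge0// ltW.
  have := tilted_estimate n0 u0 v0 t0 b0 cE aE (erefl tau0) AE rho0 rho1 al0 ga0 A2 app mw mZ w0 Z0 G1 G2 mF FE.
  have -> : tiltK n m u v th (pole 0) b a tau0 * Num.sqrt (pi / A) *
     (\prod_(k < N) lap n u (pole (1 + k)) (th ^+ 2)) = expR (u / 4) * (Kr * L N.+1).
    rewrite /L big_ord_recl /tiltK /Kr.
    rewrite [RHS](_ : _ = expR (u / 4) * expR (- (u / 4)) * (Kr * (lap n u (pole 0) (th ^+ 2) * \prod_(k < N) lap n u (pole (1 + k)) (th ^+ 2)))).
      by rewrite -expRD subrr expR0 mul1r /Kr; ring.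
    by rewrite /Kr; ring.
  rewrite -[X in `|X - _|](_ : expR (u / 4) * X N = _); last by rewrite /X; ring.
  rewrite -mulrBr normrM (gtr0_norm (expR_gt0 _)) -mulrA ler_pM2l ?expR_gt0//.
have c1 : `|X N - Kr * L N.+1| @[N --> \oo] --> `|heat_p n m u v * (4 * pi) `^ (n%:R + m%:R / 2) - saddleQ|.
  by apply: cvg_norm; exact: cvgB cX cL.
have c2 : Kr * L N.+1 * err @[N --> \oo] --> saddleQ * err by apply: cvgMl.
exact: (ler_cvg_to c1 c2 ev).
Unshelve. all: by end_near. Qed.

End Limit.

(** * Comparison of the saddle point value with the asserted formula *)

Section Compare.
Context {R : realType}.
Implicit Types u v th e : R.

Lemma cos_ge_1B e : 0 <= e -> e <= 1 -> 1 - e <= cos e.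
Proof.
move=> e0 e1; have h0 : 0 <= e / 2 by lra.
have h1 := sin_lex h0.
have -> : cos e = 1 - 2 * sin (e / 2) ^+ 2.
  have -> : cos e = cos (e / 2 + e / 2) by congr cos; field.
  by rewrite cosD -!expr2 cos2sin2; ring.
have h2 : 0 <= sin (e / 2).
  by apply: sin_ge0_pi; rewrite h0 /=; have := @pi_ge2 R; lra.
have : sin (e / 2) ^+ 2 <= (e / 2) ^+ 2 by rewrite lerXn2r ?nnegrE.
nra.
Qed.

Lemma gden_diag n (a : R) : gden n a a = a ^+ n.-1 * hPhi n.*2 (2 * a).
Proof.
rewrite /gden /hPhi (_ : (2 * a) ^+ 2 / 4 = a * a); last by field.
by rewrite (_ : a + a = 2 * a); [rewrite mulrCA mulrA|ring].
Qed.

Lemma heat_p_equivE n m u v : (0 < n)%N -> (0 < m)%N -> 0 < u -> 0 < v -> 0 < epsilon u v ->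
  let e := epsilon u v in let x := pi / (2 * e) * u in
  heat_p_equiv n m u v * (4 * pi) `^ (n%:R + m%:R / 2) =
  expR (- (dist2 u v / 4)) * (pi ^+ n * (e ^+ n.-1)^-1 * (x / 2) ^+ n.-1) *
  ((Num.sqrt 2 * Num.sqrt v) ^+ m.-1)^-1 * (2 * Num.sqrt pi) ^+ m * hPhi n.*2 x.
Proof.
move=> n0 m0 u0 v0 e0; cbv zeta; rewrite /heat_p_equiv.
set e := epsilon u v in e0 *; set x := pi / (2 * e) * u; have p0 := @pi_gt0 R.
have x0 : 0 < x by rewrite mulr_gt0// divr_gt0// mulr_gt0.
rewrite besselI_hG// (_ : m%:R - 1 = m.-1%:R); last by rewrite -{1}(prednK m0) -natr1 addrK.
rewrite (_ : e ^ (1 - n%:Z) = (e ^+ n.-1)^-1); last first.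
  rewrite (_ : 1 - n%:Z = - (n.-1)%:Z); last by rewrite -{1}(prednK n0); lia.
  by rewrite -exprnN.
have E1 : 2 `^ (- (2 * n%:R) - m.-1%:R / 2) = (2 ^+ n * 2 ^+ n)^-1 * (Num.sqrt 2 ^+ m.-1)^-1 :> R.
  rewrite powRD; last by apply/implyP.
  rewrite !powRN powR_half// (_ : 2 * n%:R = (2 * n)%:R :> R); last by rewrite natrM.
  by rewrite powR_mulrn// mul2n -addnn exprD.
have E2 : v `^ (- (m.-1%:R / 2)) = (Num.sqrt v ^+ m.-1)^-1 by rewrite powRN powR_half.
have E3 : (4 * pi) `^ (n%:R + m%:R / 2) = 2 ^+ n * 2 ^+ n * pi ^+ n * (2 * Num.sqrt pi) ^+ m :> R.
  have p4 : 0 < 4 * pi :> R by rewrite mulr_gt0.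
  rewrite powRD; last by apply/implyP => _; rewrite gt_eqF.
  rewrite powR_half// powR_mulrn ?(ltW p4)// -!exprMn; congr (_ ^+ _ * _ ^+ _); first by ring.
  by rewrite (_ : 4 * pi = 2 ^+ 2 * pi); [rewrite sqrtrM// sqrtr_sqr ger0_norm|ring].
rewrite E1 E2 E3 /hPhi [(Num.sqrt 2 * _) ^+ _]exprMn !invfM.
have t2 : 2 ^+ n != 0 :> R by rewrite expf_neq0.
have en : e ^+ n.-1 != 0 by rewrite expf_neq0 ?gt_eqF.
move: (2 ^+ n) t2 (e ^+ n.-1) en => t t2 en enn.
move: ((Num.sqrt 2 ^+ _)^-1) ((Num.sqrt v ^+ _)^-1) (_ ^+ m) => y1 y2 y3.
field; rewrite ?t2 ?enn //.
Qed.

(** Pure algebra, with th + e in the role of pi and square roots as free variables. The first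
    bracket on the right is written as a product of factors that all tend to 1 with e. *)
Lemma saddle_ratio n m u v th e s sp st sv s2 a x h1 h2 : (0 < n)%N -> (0 < m)%N ->
  0 < u -> 0 < v -> 0 < th -> 0 < e -> 0 < s -> 0 < sp -> 0 < st -> 0 < sv -> 0 < s2 -> 0 < h2 ->
  sp ^+ 2 = th + e -> st ^+ 2 = th -> sv ^+ 2 = v -> s2 ^+ 2 = 2 ->
  a = u * (th + e) ^+ 2 / (2 * (e * (2 * th + e))) -> x = (th + e) / (2 * e) * u ->
  e * (2 * th + e) * (v / (2 * th) * ((sv / (s2 * st)) ^+ m)^-1) * (a ^+ n.-1 * h1) *
    (s2 * sp / (st * sv)) * (th / s) ^+ n =
  ((st / sp) ^+ m.-1 * ((2 * th + e) / (2 * (th + e))) * (e / s) *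
   (th / (th + e) * (e / s) * (2 * (th + e) / (2 * th + e))) ^+ n.-1 * (h1 / h2)) *
  ((th + e) ^+ n * (e ^+ n.-1)^-1 * (x / 2) ^+ n.-1 * ((s2 * sv) ^+ m.-1)^-1 * (2 * sp) ^+ m * h2).
Proof.
move=> n0 m0 u0 v0 th0 e0 s0 sp0 st0 sv0 s20 h20 spE stE svE s2E -> ->.
have te : 0 < th + e by lra.
have te2 : 0 < 2 * th + e by lra.
rewrite -(prednK n0) -(prednK m0) /=; set k := n.-1; set j := m.-1.
rewrite !(exprS _ k) !(exprS _ j).
have A : ((sv / (s2 * st)) ^+ j)^-1 = (st / sp) ^+ j * ((s2 * sv) ^+ j)^-1 * (2 * sp) ^+ j.
  rewrite -!exprVn -!exprMn; congr (_ ^+ _); rewrite -s2E; field; rewrite !gt_eqF//.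
have B : (u * (th + e) ^+ 2 / (2 * (e * (2 * th + e)))) ^+ k * (th / s) ^+ k =
   (th / (th + e) * (e / s) * (2 * (th + e) / (2 * th + e))) ^+ k *
   ((th + e) ^+ k * (e ^+ k)^-1 * ((th + e) / (2 * e) * u / 2) ^+ k).
  rewrite -!exprVn -!exprMn; congr (_ ^+ _); field; rewrite !gt_eqF//.
rewrite (invfM (sv / (s2 * st))) A.
move: A B.
set X1 := (u * _ / _) ^+ k; set Y1 := (th / s) ^+ k; set S1 := (st / sp) ^+ j.
set V1 := ((s2 * sv) ^+ j)^-1; set P1 := (2 * sp) ^+ j; set Z1 := (_ * (e / s) * _) ^+ k.
set T1 := (th + e) ^+ k; set E1 := (e ^+ k)^-1; set W1 := (_ / 2) ^+ k => A B.
rewrite [LHS](_ : _ = X1 * Y1 * (S1 * V1 * P1) *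
  (e * (2 * th + e) * (v / (2 * th) * (sv / (s2 * st))^-1) * h1 * (s2 * sp / (st * sv)) * (th / s))); last by ring.
rewrite B.
rewrite [RHS](_ : _ = Z1 * (T1 * E1 * W1) * (S1 * V1 * P1) *
   ((2 * th + e) / (2 * (th + e)) * (e / s) * (h1 / h2) * (th + e) * (2 * sp) * h2)); last by ring.
congr (_ * _).
have F : (sv / (s2 * st))^-1 * (s2 * sp / (st * sv)) = s2 ^+ 2 * sp / sv ^+ 2 by field; rewrite !gt_eqF.
rewrite [LHS](_ : _ = e * (2 * th + e) * (v / (2 * th)) * h1 * (th / s) *
  ((sv / (s2 * st))^-1 * (s2 * sp / (st * sv)))); last by ring.
by rewrite F s2E svE; field; rewrite !gt_eqF.
Qed.

(** Exponents add up as (m - 1) + 1 + 1 + 3 (n - 1) + 2n, which is below m + 5n + 2. *)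
Lemma saddle_const_close n m th e (u v a x s : R) : (0 < n)%N -> (0 < m)%N -> 0 < u -> 0 < v ->
  0 < th -> 0 < e -> e < 1 -> th + e = pi -> s = sin e ->
  a = u * (th + e) ^+ 2 / (2 * (e * (2 * th + e))) -> x = (th + e) / (2 * e) * u ->
  clo ((1 - e)^-1 ^+ (m + 5 * n + 2)) ((Num.sqrt th / Num.sqrt pi) ^+ m.-1 * ((2 * th + e) / (2 * (th + e))) * (e / s) *
   (th / (th + e) * (e / s) * (2 * (th + e) / (2 * th + e))) ^+ n.-1 * (hPhi n.*2 (2 * a) / hPhi n.*2 x)).
Proof.
move=> n0 m0 u0 v0 th0 e0 e1 the sE aE xE; set T := (1 - e)^-1.
have pi2 := @pi_ge2 R; have n20 : (0 < n.*2)%N by rewrite double_gt0.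
have T1 : 1 <= T by rewrite invf_ge1; lra.
have T0 : 0 < T by rewrite (lt_le_trans _ T1).
have p0 : 0 < th + e by rewrite addr_gt0.
have cth : clo T (th / (th + e)).
  apply: clo_sub => //; rewrite (_ : th / (th + e) - 1 = - (e / (th + e))); last by field; rewrite gt_eqF.
  rewrite normrN ger0_norm ?divr_ge0 ?(ltW e0) ?(ltW p0)// ler_pdivrMr// ler_peMr ?(ltW e0)//; lra.
have csq : clo T (Num.sqrt th / Num.sqrt pi).
  by have := clo_sqrt T1 cth; rewrite the sqrtrM ?(ltW th0)// sqrtrV ?pi_ge0.
have p2 : 0 < 2 * th + e by lra.
have c2 : clo T ((2 * th + e) / (2 * (th + e))).
  apply: clo_sub => //.
  rewrite (_ : (2 * th + e) / (2 * (th + e)) - 1 = - (e / (2 * (th + e)))); last by field; rewrite gt_eqF.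
  rewrite normrN ger0_norm ?divr_ge0 ?(ltW e0)//; last by lra.
  rewrite ler_pdivrMr; last by lra.
  rewrite ler_peMr ?(ltW e0)//; lra.
have c2' : clo T (2 * (th + e) / (2 * th + e)) by rewrite -invf_div; exact: cloV.
have s1 : s <= e by rewrite sE sin_lex// ltW.
have ce := cos_ge_1B (ltW e0) (ltW e1).
have s2 : e * (1 - e) <= s.
  rewrite sE; apply: le_trans (_ : e * cos e <= _); first by rewrite ler_wpM2l// ltW.
  by apply: xcos_le_sin; rewrite (ltW e0) -the lerDr ltW.
have s0 : 0 < s by rewrite (lt_le_trans _ s2)// mulr_gt0//; lra.
have ces : clo T (e / s).
  apply/andP; split; last by rewrite ler_pdivrMr// mulrC /T ler_pdivlMr//; lra.
  apply: (@le_trans _ _ 1); first by rewrite invf_le1.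
  by rewrite ler_pdivlMr// mul1r.
have x0 : 0 < x by rewrite xE mulr_gt0// divr_gt0//; lra.
(* The Bessel argument 2a of the saddle point exceeds the asserted x by this factor, which tends to
   1; [hPhi] is compared across it by its two monotonicities. *)
pose p := 2 * (th + e) / (2 * th + e).
have p1 : 1 <= p by rewrite /p ler_pdivlMr//; lra.
have ax : 2 * a = x * p by rewrite /p aE xE; field; rewrite !gt_eqF.
have h1 := hPhi_gt0 x n20; have h2 := hPhi_gt0 (2 * a) n20.
have ch : clo (T ^+ n.*2) (hPhi n.*2 (2 * a) / hPhi n.*2 x).
  have xx : x <= x * p by rewrite ler_peMr// ltW.
  have A1 := hPhi_le n20 (ltW x0) xx; have A2 := hPhi_mul_ge n20 x0 p1.
  rewrite -ax in A1 A2.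
  have Tn := cloX n.*2 T0 c2'; have /andP[_ pT] := Tn.
  have T1n : 1 <= T ^+ n.*2 by rewrite exprn_ege1.
  have T0n : 0 < T ^+ n.*2 by rewrite exprn_gt0.
  apply/andP; split; last by rewrite (le_trans _ T1n)// ler_pdivrMr// mul1r.
  by rewrite ler_pdivlMr// ler_pdivrMl// (le_trans A2)// ler_wpM2r// ltW.
have c1 x' : clo T x' -> clo (T ^+ 1) x' by [].
have cprod := cloXM T1 (cloXM T1 (c1 _ cth) (c1 _ ces)) (c1 _ c2').
have cpn : clo (T ^+ (3 * n.-1)) ((th / (th + e) * (e / s) * (2 * (th + e) / (2 * th + e))) ^+ n.-1).
  by rewrite exprM; apply: cloX => //; rewrite exprn_gt0.
have := cloXM T1 (cloXM T1 (cloXM T1 (cloXM T1 (cloX m.-1 T0 csq) (c1 _ c2)) (c1 _ ces)) cpn) ch.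
apply: cloXle T1 _; by clear -n0 m0; lia.
Qed.

End Compare.

Section Assembly.
Context {R : realType}.

(** Orders of magnitude: b ~ e, a ~ u/e ~ v e and A ~ v. Hence (1 + a)/A is of order 1/v + e, and
    b/a of order 1/v, which pays for 1 + u <= 2v in the second error. *)
Lemma error_small (u v p th e e1 b a A : R) : 0 < u -> 4 <= v -> u <= v -> 0 < e ->
  2 <= p -> p <= 4 -> 1 <= th -> p = th + e -> b = e * (2 * th + e) -> a = u * p ^+ 2 / (2 * b) ->
  A = th * v / 2 -> u <= 4 * v * e ^+ 2 -> v * e ^+ 2 <= 5 * u -> e <= e1 -> v^-1 <= e1 ->
  (1 + a) / A <= 34 * e1 /\ b ^+ 2 * (1 + a) / a ^+ 2 * (1 + u) <= 240 * 240 * e1.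
Proof.
move=> u0 v4 uv e0 p2 p4 th1 pE bE aE AE h1 h2 ee ve.
have v0 : 0 < v by lra.
have bl : 2 * e <= b by rewrite bE [leLHS]mulrC ler_wpM2l ?(ltW e0)//; lra.
have bu : b <= 8 * e by rewrite bE [leRHS]mulrC ler_wpM2l ?(ltW e0)//; lra.
have b0 : 0 < b by lra.
have pp : 4 <= p ^+ 2 <= 16 by rewrite expr2; apply/andP; split; nra.
have a0 : 0 < a by rewrite aE divr_gt0 ?mulr_gt0//; lra.
have ab : a * (2 * b) = u * p ^+ 2 by rewrite aE divfK// gt_eqF// mulr_gt0.
have ae : a * e <= 4 * u.
  have : a * (4 * e) <= a * (2 * b) by rewrite ler_wpM2l ?(ltW a0)//; lra.
  have : u * p ^+ 2 <= u * 16 by rewrite ler_wpM2l ?(ltW u0)//; lra.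
  lra.
have av : a <= 16 * v * e.
  by rewrite -(ler_pM2r e0) (le_trans ae)//; move: h1; rewrite expr2; lra.
have au : u <= 4 * (a * e).
  have : a * (2 * b) <= a * (16 * e) by rewrite ler_wpM2l ?(ltW a0)//; lra.
  have : u * 4 <= u * p ^+ 2 by rewrite ler_wpM2l ?(ltW u0)//; lra.
  lra.
have A1 : v / 2 <= A.
  by rewrite AE -{1}[v]mul1r -!mulrA ler_wpM2r//; lra.
have A0 : 0 < A by lra.
have ve1 : 1 <= v * e1 by rewrite mulrC -ler_pdivrMr// mul1r.
have e10 : 0 < e1 by lra.
split.
  rewrite ler_pdivrMr//.
  have : 34 * e1 * (v / 2) <= 34 * e1 * A by rewrite ler_wpM2l//; lra.
  have : v * e <= v * e1 by rewrite ler_wpM2l// ltW.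
  lra.
pose y := b / a.
have y0 : 0 < y by rewrite divr_gt0.
have yv : y * v <= 160.
  rewrite /y mulrAC ler_pdivrMr//.
  have : b * v <= 8 * e * v by rewrite ler_wpM2r// ltW.
  move=> /le_trans; apply.
  have : e * (v * e) <= e * (20 * a).
    by move: h2; rewrite expr2; nra.
  by rewrite ler_pM2l//; lra.
have -> : b ^+ 2 * (1 + a) / a ^+ 2 * (1 + u) = (y * y + y * b) * (1 + u).
  by rewrite /y; field; rewrite gt_eqF.
have yb : 0 <= y * y + y * b by rewrite addr_ge0// mulr_ge0// ltW.
apply: (@le_trans _ _ ((y * y + y * b) * (2 * v))); first by rewrite ler_wpM2l//; lra.
have y1 : y <= 160 * e1.
  by rewrite -(ler_pM2r v0) (le_trans yv)//; lra.
have yv0 : 0 <= y * v := mulr_ge0 (ltW y0) (ltW v0).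
have b8 : b <= 8 * e1 by lra.
have : y * (y * v) <= 160 * e1 * 160 by apply: ler_pM => //; exact: ltW.
have : b * (y * v) <= 8 * e1 * 160 by apply: ler_pM => //; exact: ltW.
lra.
Qed.

Lemma saddleQE n m (u v : R) : (0 < n)%N -> (0 < m)%N -> 0 < u -> 0 < v -> u <= v ->
  let th := theta u v in let e := epsilon u v in
  let x := pi / (2 * e) * u in let a := u * pole 0 / (2 * (pole 0 - th ^+ 2)) in
  saddleQ n m u v th a (th * v / 2) =
  ((Num.sqrt th / Num.sqrt pi) ^+ m.-1 * ((2 * th + e) / (2 * (th + e))) * (e / sin e) *
   (th / (th + e) * (e / sin e) * (2 * (th + e) / (2 * th + e))) ^+ n.-1 * (hPhi n.*2 (2 * a) / hPhi n.*2 x)) *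
  (heat_p_equiv n m u v * (4 * pi) `^ (n%:R + m%:R / 2)).
Proof.
move=> n0 m0 u0 v0 uv th e x a; have pi2 := @pi_ge2 R.
have [/andP[tl tu] muth _ _] := theta_spec u0 uv; rewrite -/th in tl tu muth.
have th0 : 0 < th by lra.
have e0 : 0 < e by rewrite /e /epsilon subr_gt0.
have the : th + e = pi by rewrite /e /epsilon -/th addrC subrK.
have s0 : 0 < sin th by apply: sin_gt0_pi; rewrite th0.
have se : sin e = sin th.
  by rewrite /e /epsilon -/th sinB sinpi cospi mul0r sub0r mulN1r opprK.
have sn := lt0r_neq0 s0; have tn := lt0r_neq0 th0; have un := lt0r_neq0 u0; have vn := lt0r_neq0 v0.
have p0 := @pi_gt0 R.
rewrite heat_p_equivE//; cbv zeta; rewrite -/e -/x.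
have bE : pole 0 - th ^+ 2 = e * (2 * th + e) :> R by rewrite pole0E -the; ring.
have x0 : 0 < x by rewrite mulr_gt0// divr_gt0// mulr_gt0.
have n20 : (0 < n.*2)%N by rewrite double_gt0.
have rat := @saddle_ratio R n m u v th e (sin e) (Num.sqrt pi) (Num.sqrt th) (Num.sqrt v) (Num.sqrt 2) a x
  (hPhi n.*2 (2 * a)) (hPhi n.*2 x) n0 m0 u0 v0 th0 e0.
have {rat} rat := rat (_ : 0 < sin e) (_ : 0 < Num.sqrt pi) (_ : 0 < Num.sqrt th) (_ : 0 < Num.sqrt v) (_ : 0 < Num.sqrt 2)
   (hPhi_gt0 x n20) (_ : Num.sqrt pi ^+ 2 = th + e) (sqr_sqrtr (ltW th0)) (sqr_sqrtr (ltW v0)) (sqr_sqrtr (_ : 0 <= 2))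
   (_ : a = _) (_ : x = _).
rewrite /saddleQ gden_diag bE powR_half ?divr_gt0 ?mulr_gt0//.
have -> : Num.sqrt (v / (2 * th)) = Num.sqrt v / (Num.sqrt 2 * Num.sqrt th).
  by rewrite sqrtrM ?(ltW v0)// sqrtrV ?mulr_ge0 ?(ltW th0)// sqrtrM.
have -> : Num.sqrt (pi / (th * v / 2)) = Num.sqrt 2 * Num.sqrt pi / (Num.sqrt th * Num.sqrt v).
  rewrite (_ : pi / (th * v / 2) = 2 * pi / (th * v)).
    rewrite sqrtrM ?mulr_ge0 ?(ltW p0)// sqrtrV ?mulr_ge0 ?(ltW th0) ?(ltW v0)//.
    by rewrite sqrtrM// sqrtrM// ltW.
  by move: (pi : R) => q; field; rewrite tn vn.
(* Here the distance appears: 4v/u = mu(theta) gives theta v + (u/4) theta cot theta = (u/4)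
   (theta/sin theta)^2. *)
have ex : expR (- (th * v)) * expR (- (u / 4 * (th * cos th / sin th))) = expR (- (dist2 u v / 4)).
  rewrite -expRD /dist2 -/th; congr expR; move: muth; rewrite muE// => mE.
  have vE : v = u / 4 * ((th - sin th * cos th) / sin th ^+ 2) by rewrite mE; field.
  rewrite {1}vE; move: (sin th) (cos th) sn => s c sn'; field; exact: sn'.
rewrite -[in RHS]the mulrACA.
set E := expR (- (dist2 u v / 4)) in ex *.
rewrite [LHS](_ : _ = E * (e * (2 * th + e) * (v / (2 * th) * ((Num.sqrt v / (Num.sqrt 2 * Num.sqrt th)) ^+ m)^-1) *
   (a ^+ n.-1 * hPhi n.*2 (2 * a)) * (Num.sqrt 2 * Num.sqrt pi / (Num.sqrt th * Num.sqrt v)) * (th / sin e) ^+ n)); last first.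
  by rewrite se -ex; ring.
rewrite rat.
- by rewrite the; ring.
- by rewrite se.
- by rewrite sqrtr_gt0.
- by rewrite sqrtr_gt0.
- by rewrite sqrtr_gt0.
- by rewrite sqrtr_gt0.
- by rewrite sqr_sqrtr ?the// ltW.
- by [].
- by rewrite /a bE the pole0E.
- by rewrite /x the.
Qed.

Lemma ratio_close (eta X Q r : R) : 0 < eta -> eta <= 8^-1 -> 0 < Q ->
  `|X - Q| <= Q * (2 * eta) -> clo (1 + eta) r -> `|X / Q * r - 1| <= 5 * eta.
Proof.
move=> eta0 eta8 Q0; rewrite ler_norml => /andP[X1 X2] /andP[r3 r4].
have r1 : X / Q <= 1 + 2 * eta by rewrite ler_pdivrMr//; lra.
have r2 : 1 - 2 * eta <= X / Q by rewrite ler_pdivlMr//; lra.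
have ee0 : 0 <= eta * eta by rewrite mulr_ge0// ltW.
have ee2 : eta * eta <= eta * 8^-1 by rewrite ler_wpM2l// ltW.
have r5 : 1 - eta <= r.
  apply: le_trans r3; rewrite -[leRHS]mul1r ler_pdivlMr; lra.
have u1 : X / Q * r <= (1 + 2 * eta) * (1 + eta) by apply: ler_pM => //; lra.
have l1 : (1 - 2 * eta) * (1 - eta) <= X / Q * r by apply: ler_pM => //; lra.
rewrite ler_norml; apply/andP; split; lra.
Qed.

End Assembly.

Theorem theorem2 (R : realType) (n m : nat) (hn : (1 <= n)%N) (hm : (1 <= m)%N) :
  forall rho : R, 0 < rho ->
  exists M : R, 0 < M /\
    forall u v : R, 0 < u -> M <= v -> M * u <= v ->
      `| heat_p n m u v / heat_p_equiv n m u v - 1 | <= rho.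
Proof.
(* The final error is 5 eta, and [ratio_close] requires eta <= 1/8. *)
move=> rho rho0; pose eta := Num.min rho 1 / 8.
have mr : 0 < Num.min rho 1 by rewrite lt_min rho0 ltr01.
have mr1 : Num.min rho 1 <= 1 by rewrite ge_min lexx orbT.
have mr2 : Num.min rho 1 <= rho by rewrite ge_min lexx.
have eta0 : 0 < eta by rewrite divr_gt0.
have eta1 : eta < 1 by rewrite /eta; lra.
have eta8 : eta <= 8^-1 by rewrite /eta; lra.
have er : 5 * eta <= rho by rewrite /eta; lra.
have [C C0 HC] := Hfun_approx hn hm eta0 eta1.
have [d [d0 d1 dK]] := clo_exists (m + 5 * n + 2) eta0.
pose E : R := expR (2 + 2 * n%:R); have E0 : 0 < E by exact: expR_gt0.
(* By [error_small] the two error terms of [core_estimate] add up to at most e1 times this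
   constant. *)
pose Kc := 8 * C * 34 + 2 * C * (4 * E) * (240 * 240).
have Kc0 : 0 < Kc := addr_gt0 (mulr_gt0 (mulr_gt0 (ltr0Sn R 7) C0) (ltr0Sn R 33)) (mulr_gt0 (mulr_gt0 (mulr_gt0 (ltr0Sn R 1) C0) (mulr_gt0 (ltr0Sn R 3) E0)) (mulr_gt0 (ltr0Sn R 239) (ltr0Sn R 239))).
(* The common bound for epsilon and 1/v: d controls the factors tending to 1, 1/8 ensures b <= 8
   epsilon <= 1, and eta/Kc controls the errors. *)
pose e1 := Num.min d (Num.min 8^-1 (eta / Kc)).
have e10 : 0 < e1 by rewrite !lt_min d0 invr_gt0 divr_gt0// ltr0n.
have e1d : e1 <= d by rewrite ge_min lexx.
have e18 : e1 <= 8^-1 by rewrite /e1 !ge_min lexx orbT.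
have e1K : e1 * Kc <= eta by rewrite -ler_pdivlMr// /e1 !ge_min lexx !orbT.
(* The summands ensure v >= 4 and u <= v, then 1/v <= e1, and then epsilon <= e1 through v epsilon^2
   <= 5u <= v e1^2. *)
pose M := 4 + e1^-1 + 5 / e1 ^+ 2.
have M4 : 4 <= M by rewrite /M -addrA lerDl addr_ge0 ?invr_ge0 ?divr_ge0 ?exprn_ge0 ?(ltW e10).
have M1 : e1^-1 <= M by rewrite /M addrAC lerDr addr_ge0 ?divr_ge0 ?exprn_ge0 ?(ltW e10).
have M5 : 5 / e1 ^+ 2 <= M by rewrite /M lerDr addr_ge0 ?invr_ge0 ?(ltW e10).
exists M; split; first by lra.
move=> u v u0 Mv Muv; have v0 : 0 < v by lra.
have uv : u <= v.
  by apply: le_trans Muv; rewrite ler_peMl ?(ltW u0)//; lra.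
have [/andP[tl tu] muth h1 h2] := theta_spec u0 uv.
have pi2 := @pi_ge2 R; have /andP[_ pi4] := @pihalf_02 R.
set th := theta u v in tl tu muth; set e := epsilon u v in h1 h2.
have e0 : 0 < e by rewrite /e /epsilon subr_gt0.
have the : pi = th + e by rewrite /e /epsilon -/th addrC subrK.
have ee : e <= e1.
  rewrite -(@ler_pXn2r _ 2)// ?nnegrE ?(ltW e0) ?(ltW e10)//.
  have A1 : 5 / e1 ^+ 2 * u <= v by apply: le_trans Muv; rewrite ler_wpM2r// ltW.
  have e12 : 0 < e1 ^+ 2 by rewrite exprn_gt0.
  have A2 : 5 * u <= v * e1 ^+ 2 by rewrite -ler_pdivrMr// mulrAC.
  by rewrite -(ler_pM2l v0) (le_trans h2).
have ve : v^-1 <= e1.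
  by rewrite -[leRHS]invrK lef_pV2 ?posrE ?invr_gt0// (le_trans M1).
have th0 : 0 < th by lra.
have tp : 0 < th < pi by rewrite th0 tu.
have th1 : 1 <= th by lra.
pose a := u * pole 0 / (2 * (pole 0 - th ^+ 2)); pose A := th * v / 2.
have bE : pole 0 - th ^+ 2 = e * (2 * th + e) :> R by rewrite pole0E the; ring.
have v4 : 4 <= v by lra.
have aE : a = u * pi ^+ 2 / (2 * (e * (2 * th + e))) by rewrite /a bE pole0E.
have [er1 er2] := error_small u0 v4 uv e0 pi2 (ltac:(lra) : pi <= 4) th1 the (erefl _) aE (erefl A) h1 h2 ee ve.
have b1 : pole 0 - th ^+ 2 <= 1.
  have pi8 : 2 * th + e <= 8 by move: pi4 tu e0 the; clear; lra.
  have th8 : 0 <= 2 * th + e by rewrite addr_ge0 ?mulr_ge0// ltW.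
  rewrite bE (@le_trans _ _ (e1 * 8))//; last by rewrite -ler_pdivlMr// mul1r.
  exact: ler_pM (ltW e0) th8 ee pi8.
have A2 : 2 <= A.
  by rewrite /A ler_pdivlMr// -[leLHS]mul1r ler_pM//; lra.
have core := core_estimate hn hm u0 v0 tp (erefl a) (erefl A) muth b1 A2 C0 eta0 eta1 HC.
set X := heat_p n m u v * _ in core; set Q := saddleQ _ _ _ _ _ _ _ in core.
set Y := heat_p_equiv n m u v * (4 * pi) `^ (n%:R + m%:R / 2).
have QE := saddleQE hn hm u0 v0 uv; cbv zeta in QE.
rewrite -/th -/e -/a -/A -/Q -/Y in QE.
have se1 : e < 1 by rewrite (le_lt_trans ee)// (le_lt_trans e18)// invf_lt1// ltr1n.
have ae' : a = u * (th + e) ^+ 2 / (2 * (e * (2 * th + e))) by rewrite aE the.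
have cl := saddle_const_close hn hm u0 v0 th0 e0 se1 (esym the) (erefl (sin e)) ae' (erefl ((th + e) / (2 * e) * u)).
have xE : pi / (2 * e) * u = (th + e) / (2 * e) * u by rewrite the.
rewrite xE in QE; set rt := (X in clo _ X) in cl; rewrite -/rt in QE.
have b0 : 0 < pole 0 - th ^+ 2 by rewrite subr_gt0 lt_pole0.
have c0 := @pole_gt0 R 0.
have a0 : 0 < a by rewrite /a; exact: (divr_gt0 (mulr_gt0 u0 c0) (mulr_gt0 (ltr0Sn R 1) b0)).
have A0 : 0 < A by exact: lt_le_trans A2.
have Q0 : 0 < Q.
  have st : 0 < sin th by apply: sin_gt0_pi.
  have g0 : 0 < gden n a a by exact: gden_gt0.
  have t0 : 0 < v / (2 * th) by rewrite divr_gt0// mulr_gt0.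
  have t1 : 0 < ((v / (2 * th)) `^ (m%:R / 2))^-1 by rewrite invr_gt0 powR_gt0.
  have q0 : 0 < Num.sqrt (pi / A) by rewrite sqrtr_gt0 divr_gt0// pi_gt0.
  have f0 : 0 < (th / sin th) ^+ n by rewrite exprn_gt0// divr_gt0.
  exact: (mulr_gt0 (mulr_gt0 (mulr_gt0 (mulr_gt0 (mulr_gt0 (expR_gt0 _) b0) (mulr_gt0 t0 t1)) g0) q0)
    (mulr_gt0 (expR_gt0 _) f0)).
have T1 : 0 < (1 - e)^-1 by rewrite invr_gt0 subr_gt0.
have rtc : clo (1 + eta) rt.
  apply: clo_le cl; first by rewrite exprn_gt0.
  apply: le_trans dK; have d10 : 0 < 1 - d by rewrite subr_gt0.
  have de : 1 - d <= 1 - e by rewrite lerD2l lerN2 (le_trans ee).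
  have ie : (1 - e)^-1 <= (1 - d)^-1 by rewrite lef_pV2 ?posrE// (lt_le_trans d10).
  by rewrite lerXn2r ?nnegrE// ?(ltW T1)// invr_ge0 ltW.
have rt0 : 0 < rt by apply: clo_gt0 rtc; rewrite addr_gt0.
have Y0 : Y != 0 by apply/eqP => Yz; move: Q0; rewrite QE Yz mulr0 ltxx.
have err : eta + 8 * (C * (1 + a)) / A +
    2 * (C * ((pole 0 - th ^+ 2) ^+ 2 * (1 + a) / a ^+ 2)) * (4 * (1 + u) * expR (2 + 2 * n%:R)) <= 2 * eta.
  rewrite bE -/E.
  have f1 := ler_wpM2l (mulr_ge0 (ler0n _ 8) (ltW C0)) er1.
  have := ler_wpM2l (_ : 0 <= 2 * C * (4 * E)) er2 => /(_ _).
  move=> /(_ (mulr_ge0 (mulr_ge0 (ler0n _ 2) (ltW C0)) (mulr_ge0 (ler0n _ 4) (ltW E0)))) f2.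
  apply: (@le_trans _ _ (eta + e1 * Kc)); last by rewrite mulr_natl mulr2n lerD2l.
  rewrite -addrA lerD2l [e1 * Kc](_ : _ = 8 * C * (34 * e1) + 2 * C * (4 * E) * (240 * 240 * e1)); last by rewrite /Kc; ring.
  apply: lerD; first by rewrite [leLHS](_ : _ = 8 * C * ((1 + a) / A))//; ring.
  by apply: le_trans f2; rewrite le_eqVlt; apply/orP; left; apply/eqP; ring.
have XQ : `|X - Q| <= Q * (2 * eta) by apply: (le_trans core); rewrite ler_wpM2l// ltW.
have XY : heat_p n m u v / heat_p_equiv n m u v = X / Q * rt.
  have pw : (4 * pi) `^ (n%:R + m%:R / 2) != 0 :> R by rewrite gt_eqF// powR_gt0// mulr_gt0// pi_gt0.
  have eq0 : heat_p_equiv n m u v != 0.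
    by apply/eqP => z; move: Y0; rewrite /Y z mul0r eqxx.
  rewrite QE /X /Y; move: (heat_p_equiv _ _ _ _) eq0 (heat_p _ _ _ _) (_ `^ _) pw => y yn x w wn.
  by field; rewrite yn wn gt_eqF.
by rewrite XY (le_trans _ er)// ratio_close.
Qed.
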